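(* Let $G_0$ be a finite group such that $\mathrm{cd}(G_0)=\{1,p^\alpha q^\beta,r^\gamma q^\delta\}$, where $p,q,r$ are three distinct prime numbers and $\alpha,\beta,\gamma,\delta$ are positive integers. Then, after interchanging the roles of $(p,\alpha,\beta)$ and $(r,\gamma,\delta)$ if necessary, there exists a subgroup $A\le \mathbf{Z}(G_0)$ such that the factor group $G:=G_0/A$ satisfies all of the following: (i) $G$ contains a normal Sylow $p$-subgroup $P$; (ii) $P=G'=\mathbf{F}(G)$; (iii) $P$ is semiextraspecial and $G/P$ is cyclic; (iv) $G/P'$ is a Frobenius group with Frobenius kernel $P/P'$; (v) $P<\mathbf{C}_G(P')<G$ (strict inclusions); (vi) $G/\mathbf{C}_G(P')$ acts as a Frobenius group on $P'$ (that is, every non-identity element of $G/\mathbf{C}_G(P')$ acts fixed-point-freely on $P'\setminus\{1\}$); (vii) $\mathrm{cd}(G)=\mathrm{cd}(G_0)$, where $p^{2\alpha}=|P:P'|$ and $q^\beta=|G:\mathbf{C}_G(P')|$; (viii) if $L$ is the (normal) $q$-complement of $G$, then $L$ is of Lewis type $1$.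
   Context: For a finite group $G$, $\mathrm{cd}(G)$ is the set of degrees of irreducible complex characters of $G$; $\mathbf{Z}(G)$, $G'$, $\mathbf{F}(G)$ are the centre, derived subgroup and Fitting subgroup. A $p$-group $P$ is semiextraspecial if for every maximal subgroup $N$ of $\mathbf{Z}(P)$ the factor group $P/N$ is extraspecial. Fully ramified: if $C\trianglelefteq P$, a character $\chi\in\mathrm{Irr}(P)$ is fully ramified with respect to $P/C$ if $\chi_C=e\varphi$ for some $\varphi\in\mathrm{Irr}(C)$ with $e^2=|P:C|$. Lewis type $1$ (from M. L. Lewis's classification of solvable groups whose prime graph on character degrees is disconnected): a finite group $X$ is of Lewis type $1$ if, for some prime $p$, it has a normal non-abelian Sylow $p$-subgroup $P$ and an abelian $p$-complement $K$, such that $P'\le \mathbf{C}_P(K)$ and every non-linear irreducible character of $P$ is fully ramified with respect to $P/\mathbf{C}_P(K)$. *)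

(* Defs.v *)
From mathcomp Require Import all_boot all_order all_algebra.
From mathcomp Require Import all_fingroup all_solvable all_field all_character.

Set Implicit Arguments.
Unset Strict Implicit.
Unset Printing Implicit Defensive.

Import GRing.Theory.
Local Open Scope ring_scope.
Local Open Scope group_scope.

(* A list with repetitions; to be compared up to [=i], i.e. as a set.
   'chi[G]_i ranges over the irreducible characters with values in algC, which
   are exactly the irreducible complex characters of G. *)
Definition cd (gT : finGroupType) (G : {group gT}) : seq algC :=
  [seq 'chi[G]_i 1%g | i : Iirr G].

Definition semiextraspecial (gT : finGroupType) (p : nat) (P : {group gT}) :
    Prop :=
  p.-group P /\
  forall N : {group gT}, maximal N 'Z(P) -> extraspecial (P / N).

Definition fully_ramified (gT : finGroupType) (P C : {group gT})
    (chi : 'CF(P)) : Prop :=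
  C <| P /\
  exists (e : nat) (j : Iirr C),
    'Res[C] chi = (e%:R *: 'chi_j)%R /\ (e ^ 2)%N = #|P : C|.

Definition lewis_type1 (gT : finGroupType) (X : {group gT}) : Prop :=
  exists (p : nat) (P K : {group gT}),
    [/\ prime p,
        [/\ p.-Sylow(X) P, P <| X & ~~ abelian P],
        p^'.-Hall(X) K /\ abelian K,
        P^`(1) \subset 'C_P(K)
      & forall i : Iirr P, 'chi_i \isn't a linear_char ->
          fully_ramified 'C_P(K)%G 'chi_i].

Definition acts_as_Frobenius (aT rT : finGroupType) (D : {set aT})
    (to : action D rT) (G : {group aT}) (V : {group rT}) : Prop :=
  [acts G, on V | to] /\ {in G^#, forall x, 'Fix_(V | to)[x] = 1}.

(* In the Frobenius-action clause, 'J %% C is the action of cosets of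
   C = 'C_G(P^`(1)) by conjugation with a representative: it is the intended
   action on P^`(1), because C centralises P^`(1). *)
Definition quotient_structure (gT : finGroupType) (G0 : {group gT})
    (p q alpha beta : nat) : Prop :=
  exists A : {group gT}, A \subset 'Z(G0) /\
    let G := (G0 / A)%G in
    exists P : {group coset_of A},
      let C := 'C_G(P^`(1))%G in
      [/\ p.-Sylow(G) P /\ P <| G,
          P :=: G^`(1) /\ P :=: 'F(G),
          semiextraspecial p P /\ cyclic (G / P),
          [Frobenius G / P^`(1) with kernel P / P^`(1)]
        & [/\ P \proper C /\ C \proper G,
              acts_as_Frobenius ('J %% C) (G / C) P^`(1),
              [/\ cd G =i cd G0,
                  (p ^ (2 * alpha))%N = #|P : P^`(1)|
                & (q ^ beta)%N = #|G : C|]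
            & exists L : {group coset_of A},
                [/\ q^'.-Hall(G) L, L <| G & lewis_type1 L]]].

(* Main.v *)
Require Import Defs.
From HB Require Import structures.
From mathcomp Require Import all_boot all_order all_algebra.
From mathcomp Require Import all_fingroup all_solvable all_field all_character.

(* Write m = p^alpha q^beta and n = r^gamma q^delta. As q divides every
   nonlinear degree, Thompson's theorem gives a normal q-complement L of G0,
   with G0 / L abelian and degrees 1, p^alpha, r^gamma; such an L is solvable.
   A chief factor of G0 at the bottom of L' yields normal subgroups
   N < K < L of G0 such that K / N is an elementary abelian s-group on which
   L \ K and some q-element act without fixed points. Inducing from K shows
   that |L : K| is p^alpha or r^gamma, say r^gamma, and then s = p. Again by
   Thompson's theorem K has an abelian normal p-complement M. It is central
   in K: a minimal counterexample would be a p-group in a semilinear group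
   over a finite field, whose fixed subfields leave no room for both fixed-point
   free actions. Hence K is the direct product of M and a Sylow p-subgroup P,
   which is a normal Sylow subgroup of G0 with abelian quotient.

   Now G0 = P : H. The degrees say that nonlinear characters of P have degree
   p^alpha and H-orbits of length q^beta, and that linear ones have H-orbits of
   length 1 or n. Thus the q'-part R of H fixes all nonlinear characters of P,
   so R and [P, R] centralise P'; this forces G0' and Z(G0) to intersect
   trivially, and one may factor out A = Z(G0) without changing the degrees.
   Afterwards P = [P, R], hence P' <= Z(P), every nontrivial linear character
   of P has a trivial stabiliser in H, and nonlinear characters of P vanish
   outside P'; all the assertions can be read off from this. *)

(** The prime [q] enters in two ways. A nonlinear character of L cannot be invariant in G0, since by
    coprimality it would extend to G0 with a degree prime to [q]; this is the source of the
    [q]-element acting without fixed points on K / N. Later, the nonlinear characters of P lie in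
    orbits of length q^beta, and these are counted modulo [q]. The hard point is the centrality of M
    in K. In the counterexample a complement R of K in L commutes with a [q]-element y, and both act
    as field automorphisms on the field spanned by a cyclic p-group B. The degrees make every vector
    B-conjugate to an R-fixed one. Hence R fixes the fixed field of y, each element of R acts on a
    generator of B as a power of y does, and since the orders are coprime R centralises B, whereas B
    was chosen with C_B(R) = 1. The centre can be factored out without losing degrees because its
    linear characters extend to G0, and multiplying by a suitable extension makes any character
    trivial on the centre. *)

Section CoprimeAction.
Set Implicit Arguments.
Unset Strict Implicit.
Unset Printing Implicit Defensive.
Import Order.TTheory GroupScope GRing.Theory Num.Theory.

Variable gT : finGroupType.
Implicit Types A G H : {group gT}.

Lemma coprime_commg_cent_mulG A G :
  A \subset 'N(G) -> coprime #|G| #|A| -> solvable G ->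
  [~: G, A] * 'C_G(A) = G.
Proof.
move=> nGA coGA solG; have sRG: [~: G, A] \subset G by rewrite commg_subl.
have nRA: A \subset 'N([~: G, A]) := commg_normr A G.
have nRG: G \subset 'N([~: G, A]) := commg_norml G A.
have defC := coprime_quotient_cent sRG nRA coGA solG.
rewrite -quotientK ?subIset ?nRG // defC (setIidPl _).
  by rewrite quotientGK // /normal sRG.
by rewrite quotient_cents2r.
Qed.

Lemma coprime_commg_id A G :
  A \subset 'N(G) -> coprime #|G| #|A| -> solvable G ->
  [~: G, A, A] = [~: G, A].
Proof.
move=> nGA coGA solG; apply/eqP; rewrite eqEsubset commSg ?commg_subl //=.
have nAC: 'C_G(A) \subset 'N([~: G, A, A]).
  rewrite normsR //; last by rewrite subIset // cent_sub ?orbT.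
  by rewrite subIset // commg_norml.
rewrite -{1}(coprime_commg_cent_mulG nGA coGA solG) commMG //.
have ->: [~: 'C_G(A), A] = 1 by apply/commG1P; rewrite subsetIr.
by rewrite mulg1.
Qed.

Lemma coprime_abelian_dprod A G :
  A \subset 'N(G) -> coprime #|G| #|A| -> abelian G ->
  [~: G, A] \x 'C_G(A) = G.
Proof.
move=> nGA coGA cGG; have sRG: [~: G, A] \subset G by rewrite commg_subl.
rewrite dprodE ?coprime_commg_cent_mulG ?abelian_sol //.
- by rewrite subIset // (subset_trans cGG) // centS.
- apply/trivgP; rewrite -(coprime_abel_cent_TI nGA coGA cGG).
  by rewrite setIS // subsetIr.
Qed.

(** Coprimeness gives [G, A] = [G, A, A], and the latter lies in [H, A] = 1. *)
Lemma coprime_stable_cent A G H :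
  A \subset 'N(G) -> coprime #|G| #|A| -> solvable G ->
  [~: G, A] \subset H -> A \subset 'C(H) -> A \subset 'C(G).
Proof.
move=> nGA coGA solG sRH cHA.
rewrite centsC; apply/commG1P; rewrite -(coprime_commg_id nGA) //.
by apply/commG1P; rewrite (subset_trans sRH) // centsC.
Qed.

Lemma normal_Hall_mulG (pi : nat_pred) G (L Q : {group gT}) :
  L <| G -> pi^'.-Hall(G) L -> pi.-Hall(G) Q -> L * Q = G.
Proof.
move=> /andP[sLG nLG] hallL hallQ; have sQG := pHall_sub hallQ.
apply/eqP; rewrite eqEsubset mul_subG //= -quotientSK //.
rewrite (pHall_id (quotient_pHall (subset_trans sQG nLG) hallQ)) ?subxx //.
by rewrite /pgroup card_quotient //; case/and3P: hallL; rewrite pnatNK.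
Qed.

End CoprimeAction.

(** * Cyclic groups acting irreducibly *)

Section FieldAction.
Set Implicit Arguments.
Unset Strict Implicit.
Unset Printing Implicit Defensive.
Import Order.TTheory GroupScope GRing.Theory Num.Theory.
Import MatrixGenField.
Local Open Scope ring_scope.

(** The product of the factors X - t^i b over a full cycle of t has t-fixed, hence s-fixed,
    coefficients, so s maps its root b to another root. The number n.+1 may be any multiple of the
    period of b: repeated roots do no harm. *)
Lemma conjugate_of_fixed_field (F : fieldType) (s t : {rmorphism F -> F})
    (n : nat) (b : F) :
    (forall f, t f = f -> s f = f) -> iter n.+1 t b = b ->
  exists i : nat, s b = iter i t b.
Proof.
move=> fix_ts tnb.
pose P := \prod_(i < n.+1) ('X - (iter i t b)%:P).
have tP: map_poly t P = P.
  rewrite /P rmorph_prod /= [RHS]big_ord_recl [RHS]mulrC /=.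
  rewrite big_ord_recr /= rmorphB /= map_polyX map_polyC /= -[t (iter _ _ _)]/(iter n.+1 t b).
  rewrite tnb; congr (_ * _); apply: eq_bigr => i _.
  by rewrite rmorphB /= map_polyX map_polyC /= add0n.
have sP: map_poly s P = P.
  apply/polyP=> i; rewrite coef_map; apply: fix_ts.
  by rewrite -[in RHS]tP coef_map.
have: root P (s b).
  rewrite -sP /root horner_map fmorph_eq0; apply/eqP.
  by rewrite /P big_ord_recl hornerM hornerXsubC subrr mul0r.
rewrite /root horner_prod prodf_seq_eq0 => /hasP[i _] /=.
by rewrite hornerXsubC subr_eq0 => /eqP->; exists i.
Qed.

(* [F] is the field generated by [b]; since every vector can be moved by [B]
   to an [R]-fixed one, the subfield of [F] centralised by [y] is centralised
   by [R], so that [b ^ x] is a root of the minimal polynomial of [b] over it. *)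
Lemma cyclic_irr_fixed_trivial (k : fieldType) (gT : finGroupType)
    (X B R : {group gT}) (n : nat) (rX : mx_representation k X n.+1)
    (y : gT) (sBX : B \subset X) :
    mx_irreducible (subg_repr rX sBX) -> cyclic B -> X \subset 'N(B) ->
    {in B, forall c, rX c = 1%:M -> c = 1%g} ->
    R \subset X -> y \in X -> R \subset 'C[y] -> coprime #|R| #[y] ->
    'C_B(R) = 1%g -> 'C_B[y] = 1%g ->
    (forall u : 'rV_n.+1, exists2 c, c \in B &
       {in R, forall x, u *m rX c *m rX x = u *m rX c}) ->
  B :=: 1%g.
Proof.
move=> irrB /cyclicP[b defB] nBX ffulB sRX Xy cRy coRy regR regy fixR.
have Bb: b \in B by rewrite defB cycle_id.
have sXB c: c \in B -> c \in X by apply: (subsetP sBX).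
have cGA: centgmx (subg_repr rX sBX) (rX b).
  apply/centgmxP=> c Bc; rewrite /= -!repr_mxM ?sXB //; congr (rX _).
  have cBB: abelian B by rewrite defB cycle_abelian.
  exact: (centsP cBB).
pose FA := gen_of irrB cGA; pose mv := @mxval _ _ _ _ _ _ irrB cGA.
(* The embedding of B into the field: c is sent to the power of the generator [groot] whose exponent
   is the position of c among the powers of b. *)
pose emb c : FA := groot irrB cGA ^+ (index c [seq b ^+ i | i <- iota 0 #[b]])%g.
have embE c: c \in B -> mv (emb c) = rX c.
  rewrite defB /emb => /cyclePmin[i lti ->].
  rewrite /mv rmorphXn /= mxval_groot; set j := index _ _.
  have jlt: (j < #[b])%N.
    rewrite -[X in (_ < X)%N](size_iota 0) -(size_map (fun i => b ^+ i)%g).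
    by rewrite index_mem map_f // mem_iota.
  have defj: (b ^+ j = b ^+ i)%g.
    have := @nth_index _ 1%g (b ^+ i)%g [seq b ^+ i | i <- iota 0 #[b]]%g.
    rewrite (nth_map 0%N) ?size_iota // nth_iota // add0n => -> //.
    by rewrite map_f // mem_iota.
  by rewrite -defj repr_mxX // sXB.
have mvI: injective mv by apply: mxval_inj.
have mv1: mv 1 = 1%:M := @mxval1 _ _ _ _ _ _ irrB cGA.
have mvM f h: mv (f * h) = mv f *m mv h := mxvalM f h.
have mvB f h: mv (f - h) = mv f - mv h := mxval_is_zmod_morphism f h.
(* Conjugation by g sends b to some b^j, hence a polynomial in b to the same polynomial in b^j: it
   preserves the field spanned by B and is an automorphism of it. *)
have conj_gen g: g \in X -> exists s : {rmorphism FA -> FA},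
    forall f, mv (s f) = rX g^-1%g *m mv f *m rX g.
  move=> Xg.
  have ex f: exists h, mv h == rX g^-1%g *m mv f *m rX g.
    have [j bj]: exists j, (b ^ g = b ^+ j)%g.
      by apply/cycleP; rewrite -defB memJ_norm // (subsetP nBX).
    pose p := pval f; pose h := (map_poly (gen irrB cGA) p).[groot irrB cGA ^+ j].
    exists h; apply/eqP.
    have conjX i: rX g^-1%g *m rX b ^+ i *m rX g = rX b ^+ (j * i).
      have Xb := sXB b Bb.
      rewrite exprM -!repr_mxX ?groupX // -bj -!repr_mxM ?groupM ?groupV ?groupX //.
      by rewrite -conjXg conjgE mulgA.
    rewrite /h /mv horner_coef !mxval_sum.
    rewrite [in RHS]/mxval /horner_mx /horner_morph -/p horner_coef.
    rewrite mulmx_sumr mulmx_suml !size_map_poly.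
    apply: eq_bigr => i _.
    rewrite !coef_map /= mxvalM rmorphXn /= rmorphXn /= mxval_groot genK.
    rewrite -exprM -conjX -[_ * _ ^+ i]/(_ *m _) !mul_scalar_mx -scalemxAr.
    by rewrite -!scalemxAl.
  pose s f := xchoose (ex f).
  have sE f: mv (s f) = rX g^-1%g *m mv f *m rX g.
    exact/eqP/(xchooseP (ex f)).
  have s_zmod: zmod_morphism s.
    by move=> f h; apply: mvI; rewrite mvB !sE mvB mulmxBr mulmxBl.
  have s_mon: monoid_morphism s.
    split=> [|f h]; apply: mvI; rewrite ?mvM !sE.
      by rewrite mv1 mulmx1 -repr_mxM ?groupV // mulVg repr_mx1.
    by rewrite mvM !mulmxA (repr_mxK rX Xg).
  pose sm := GRing.isMonoidMorphism.Build _ _ s s_mon.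
  pose sz := GRing.isZmodMorphism.Build _ _ s s_zmod.
  pose S : {rmorphism FA -> FA} := HB.pack s sm sz.
  by exists S.
have mvU f (v : 'rV_n.+1): f != 0 -> v *m mv f = 0 -> v = 0.
  move=> nzf /(congr1 (mulmx^~ (mv f^-1))).
  by rewrite -mulmxA -mvM mulfV // mv1 mulmx1 mul0mx.
have mv0: mv 0 = 0 := @mxval0 _ _ _ _ _ _ irrB cGA.
have embM c c': c \in B -> c' \in B -> emb (c * c')%g = emb c * emb c'.
  by move=> Bc Bc'; apply: mvI; rewrite mvM !embE ?groupM // repr_mxM ?sXB.
have emb_inj c c': c \in B -> c' \in B -> emb c = emb c' -> c = c'.
  move=> Bc Bc' /(congr1 mv); rewrite !embE // => eq_cc'.
  apply/eqP; rewrite eq_mulgV1; apply/eqP/ffulB; first by rewrite groupM ?groupV.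
  by rewrite repr_mxM ?groupV ?sXB // eq_cc' -repr_mxM ?groupV ?sXB // mulgV repr_mx1.
have conjE g (s : {rmorphism FA -> FA}): g \in X ->
    (forall f, mv (s f) = rX g^-1%g *m mv f *m rX g) ->
  forall c, c \in B -> s (emb c) = emb (c ^ g)%g.
  move=> Xg sE c Bc; have Bcg: (c ^ g)%g \in B by rewrite memJ_norm ?(subsetP nBX).
  have Xc := sXB c Bc; apply: mvI; rewrite sE !embE // conjgE !repr_mxM ?groupM ?groupV //.
  by rewrite mulmxA.
have [v0 nzv0 fixv0]: exists2 v : 'rV_n.+1, v != 0 &
    {in R, forall x, v *m rX x = v}.
  have [c Bc fixc] := fixR (delta_mx 0 0).
  exists (delta_mx 0 0 *m rX c) => //; apply/eqP=> /(congr1 (mulmx^~ (rX c^-1%g))).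
  rewrite mul0mx repr_mxK ?sXB // => /matrixP/(_ 0 0)/eqP.
  by rewrite !mxE !eqxx oner_eq0.
have [t tE] := conj_gen y Xy.
(* Choose c in B such that v0 f c is R-fixed. As v0 is R-fixed and nonzero field elements are
   invertible, f c is itself R-fixed. Since y commutes with R, so is its image f c^y under t, hence
   c^-1 c^y lies in C_B(R) = 1. Thus c is in C_B[y] = 1, and f is R-fixed. *)
have fix_yR f: t f = f ->
    forall x (s : {rmorphism FA -> FA}), x \in R ->
    (forall f, mv (s f) = rX x^-1%g *m mv f *m rX x) -> s f = f.
  move=> tf; have [-> x s _ _| nzf] := eqVneq f 0; first exact: rmorph0.
  have [c Bc fixc] := fixR (v0 *m mv f).
  have sg x (s : {rmorphism FA -> FA}): x \in R ->
      (forall f, mv (s f) = rX x^-1%g *m mv f *m rX x) ->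
    s (f * emb c) = f * emb c.
    move=> Rx sE; apply/eqP; rewrite -subr_eq0; apply: contraR nzv0 => nz.
    apply/eqP; apply: mvU nz _; rewrite mvB mulmxBr sE !mulmxA fixv0 ?groupV //.
    by rewrite mvM embE // !mulmxA fixc // subrr.
  have Bcy: (c ^ y)%g \in B by rewrite memJ_norm ?(subsetP nBX).
  have c1: c = 1%g.
    apply/set1gP; rewrite -regy inE Bc /=; apply/cent1P/commgP/eqP.
    apply/set1gP; rewrite -regR inE commgEl groupM ?groupV //=.
    apply/centP=> x Rx; have Xx := subsetP sRX x Rx.
    have [s sE] := conj_gen x Xx.
    have Bd: (c^-1 * c ^ y)%g \in B by rewrite groupM ?groupV.
    apply/commgP/conjg_fixP/emb_inj => //.
      by rewrite memJ_norm ?(subsetP nBX).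
    rewrite -(conjE x s) //; apply: (@mulfI _ (f * emb c)).
      rewrite mulf_neq0 //; apply/eqP=> /(congr1 mv); rewrite embE // mv0 => c0.
      by have:= repr_mx_unit rX (sXB c Bc); rewrite c0 unitr0.
    have tg: t (f * emb c) = f * emb c * emb (c^-1 * c ^ y)%g.
      by rewrite rmorphM /= tf (conjE y) // -mulrA -embM // mulKVg.
    rewrite -{1}(sg x s) // -rmorphM /= -tg.
    have cxy: (x * y = y * x)%g by apply/cent1P; rewrite (subsetP cRy).
    have: s (t (f * emb c)) = t (s (f * emb c)).
      apply: mvI; rewrite sE tE tE sE !mulmxA.
      rewrite -!repr_mxM ?groupM ?groupV // -!mulmxA -!repr_mxM ?groupM ?groupV //.
      by rewrite -!invMg cxy.
    by rewrite (sg x s).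
  move=> x s Rx /(sg x s Rx); rewrite c1.
  have -> : emb 1%g = 1 by apply: mvI; rewrite embE ?group1 // mv1 repr_mx1.
  by rewrite mulr1.
have iter_t i: iter i t (emb b) = emb (b ^ (y ^+ i))%g.
  elim: i => [|i IHi]; first by rewrite expg0 conjg1.
  rewrite iterS IHi (conjE y) ?memJ_norm ?(subsetP nBX) ?groupX //.
  by rewrite -conjgM -expgSr.
suffices b1: b = 1%g by rewrite defB b1 cycle1.
apply/set1gP; rewrite -regR inE Bb; apply/centP=> x Rx.
have Xx := subsetP sRX x Rx; have [s sE] := conj_gen x Xx.
have [||i] := @conjugate_of_fixed_field _ s t #[y].-1 (emb b).
- by move=> f tf; apply: (fix_yR f tf x).
- by rewrite prednK ?order_gt0 // iter_t expg_order conjg1.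
rewrite (conjE x) // iter_t => /emb_inj bx.
have{bx}: (b ^ x)%g = (b ^ (y ^+ i))%g.
  by apply: bx; rewrite memJ_norm ?(subsetP nBX) ?groupX.
move/(canLR (conjgK _)); rewrite -conjgM => /conjg_fixP/commgP/cent1P cbz.
have cxy: commute x (y ^+ i)^-1.
  by apply/commuteV/commuteX/cent1P; rewrite (subsetP cRy).
(* Raising to the power #[y] removes y; the remaining power of x still generates <[x]>, because the
   orders are coprime. *)
have: ((x * (y ^+ i)^-1) ^+ #[y])%g \in 'C[b] by rewrite groupX // cent1C.
rewrite expgMn // expgVn -expgM mulnC expgM expg_order expg1n invg1 mulg1 => cbx.
have: x \in <[(x ^+ #[y])%g]>.
  have: generator <[x]> (x ^+ #[y])%g.
    by rewrite generator_coprime; apply: coprime_dvdl coRy; apply: order_dvdG.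
  by move/eqP <-; apply: cycle_id.
by case/cycleP=> j ->; apply/cent1P; rewrite cent1C groupX.
Qed.

(** Reduction to the cyclic case: B turns out to act irreducibly, and a faithful irreducible abelian
    group is cyclic. Irreducibility holds because a proper decomposition would offer R-fixed vectors
    in both summands, and B cannot move two independent components to R-fixed ones by different
    elements. *)
Lemma abelian_pgroup_fixed_trivial (k : fieldType) (gT : finGroupType)
    (p : nat) (X B R : {group gT}) (n : nat)
    (rX : mx_representation k X n.+1) (y : gT) :
    p.-group B -> [pchar k]^'.-group B -> abelian B ->
    B \subset X -> X \subset 'N(B) ->
    {in B, forall c (u : 'rV_n.+1), u != 0 -> u *m rX c = u -> c = 1%g} ->
    R \subset X -> y \in X -> R \subset 'C[y] ->
    coprime #|R| #[y] -> coprime #|B| #[y] ->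
    'C_B(R) = 1%g -> ~~ (B \subset 'C[y]) ->
    (forall u : 'rV_n.+1, exists2 c, c \in B &
       {in R, forall x, u *m rX c *m rX x = u *m rX c}) ->
  False.
Proof.
move=> pB k'B cBB sBX nBX fpf sRX Xy cRy coRy coBy regR ncBy fixR.
have sXB c: c \in B -> c \in X by apply: (subsetP sBX).
have [b Bb nt_b]: exists2 b, b \in B & b != 1%g.
  apply/trivgPn; apply: contra ncBy => /eqP->; exact: sub1G.
have ffulB: {in B, forall c, rX c = 1%:M -> c = 1%g}.
  move=> c Bc c1; apply: (fpf c Bc (delta_mx 0 0)).
    by apply/eqP=> /matrixP/(_ 0 0)/eqP; rewrite !mxE !eqxx oner_eq0.
  by rewrite c1 mulmx1.
have fix_nz (U : 'M_n.+1): mxmodule (subg_repr rX sBX) U -> U != 0 ->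
    exists u : 'rV_n.+1, [/\ u != 0, (u <= U)%MS & {in R, forall x, u *m rX x = u}].
  move=> modU nzU; have [c Bc fixc] := fixR (nz_row U).
  exists (nz_row U *m rX c); split=> //.
    apply: contra nzU => /eqP u0; rewrite -nz_row_eq0.
    by rewrite -[nz_row U](repr_mxK rX (sXB c Bc)) u0 mul0mx.
  exact: submx_trans (submxMr _ (nz_row_sub U)) (mxmoduleP modU c Bc).
have irrB: mx_irreducible (subg_repr rX sBX).
  apply/mx_irrP; split=> // U modU nzU.
  have [W modW defUW dxUW] := mx_Maschke_pchar (subg_repr rX sBX) k'B modU (submx1 U).
  have [W0 | nzW] := eqVneq W 0.
    by rewrite -sub1mx -defUW W0 addsmx0.
  have [u [nzu Uu fixu]] := fix_nz U modU nzU.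
  have [w [nzw Ww fixw]] := fix_nz W modW nzW.
  (* The factor b is inserted so that the components u and w are moved by c and by b c; both
     elements will be forced to be 1, although b is not. *)
  have [c Bc fixc] := fixR (u + w *m rX b).
  have Bbc: (b * c)%g \in B by rewrite groupM.
  (* If v and v d are both R-fixed, then d^-1 d^x fixes v for each x in R, so d^x = d by fixed-point
     freeness and d lies in C_B(R) = 1. *)
  have fix1 (v : 'rV_n.+1) d: v != 0 -> {in R, forall x, v *m rX x = v} -> d \in B ->
     {in R, forall x, v *m rX d *m rX x = v *m rX d} -> d = 1%g.
    move=> nzv fixv Bd fixvd; apply/set1gP; rewrite -regR inE Bd /=.
    apply/centP=> x Rx; apply/commgP; rewrite commgEl; apply/eqP.
    have Xx := subsetP sRX x Rx.
    have Bdx: (d ^ x)%g \in B by rewrite memJ_norm ?(subsetP nBX).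
    have Bdd: (d^-1 * d ^ x)%g \in B by rewrite groupM ?groupV.
    apply: (fpf _ Bdd v nzv).
    have ->: (d^-1 * d ^ x = d ^ x * d^-1)%g by apply: (centsP cBB); rewrite ?groupV.
    rewrite repr_mxM ?groupV ?sXB // mulmxA.
    have Xd := sXB d Bd; rewrite conjgE mulgA !repr_mxM ?groupM ?groupV // !mulmxA.
    by rewrite fixv ?groupV // fixvd // repr_mxK ?sXB.
  (* B-submodules are R-stable: if v d is R-fixed, then v x = v d (d^-1)^x is a B-translate of v. *)
  have modR (Y : 'M_n.+1) x (v : 'rV_n.+1): mxmodule (subg_repr rX sBX) Y -> x \in R ->
      (v <= Y)%MS -> (v *m rX x <= Y)%MS.
    move=> modY Rx Yv; have [d Bd fixd] := fixR v; have Xx := subsetP sRX x Rx.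
    have Bdx: (d^-1 ^ x)%g \in B by rewrite memJ_norm ?(subsetP nBX) ?groupV.
    have ->: v *m rX x = v *m rX d *m rX (d^-1 ^ x)%g.
      have Xd := sXB d Bd.
      rewrite -[in RHS](fixd x Rx) -!mulmxA -!repr_mxM ?groupM ?groupV //.
      by rewrite conjgE !mulgA mulgK mulgV mul1g.
    by do 2!apply: (submx_trans (submxMr _ _) (mxmoduleP modY _ _)) => //.
  have fix_both x: x \in R -> u *m rX c *m rX x = u *m rX c
                           /\ w *m rX (b * c)%g *m rX x = w *m rX (b * c)%g.
    move=> Rx; have := fixc x Rx.
    have ->: (u + w *m rX b) *m rX c = u *m rX c + w *m rX (b * c)%g.
      by rewrite mulmxDl -mulmxA -repr_mxM ?sXB.
    set u1 := u *m _; set w1 := w *m _; rewrite mulmxDl => eq_x.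
    have Uu1: (u1 <= U)%MS.
      apply: submx_trans (mxmoduleP modU c Bc); exact: submxMr.
    have Ww1: (w1 <= W)%MS.
      apply: submx_trans (mxmoduleP modW _ Bbc); exact: submxMr.
    have eq_uw: u1 *m rX x - u1 = w1 - w1 *m rX x.
      by apply/eqP; rewrite subr_eq addrAC eq_sym subr_eq addrC -eq_x addrC.
    have: (u1 *m rX x - u1 <= U :&: W)%MS.
      rewrite sub_capmx {2}eq_uw; apply/andP; split; apply: addmx_sub.
      - exact: modR.
      - by rewrite eqmx_opp.
      - by [].
      - by rewrite eqmx_opp; apply: modR.
    rewrite (mxdirect_addsP dxUW) submx0 => /eqP eq_u.
    split; apply/eqP; rewrite -subr_eq0; first exact/eqP.
    by rewrite -oppr_eq0 opprB -eq_uw eq_u.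
  have c1: c = 1%g by apply: (fix1 u) => // x Rx; case: (fix_both x Rx).
  have: (b * c)%g = 1%g by apply: (fix1 w) => // x Rx; case: (fix_both x Rx).
  by rewrite c1 mulg1 => b1; rewrite b1 eqxx in nt_b.
have cycB: cyclic B.
  apply: (@mx_faithful_irr_abelian_cyclic _ _ _ _ (subg_repr rX sBX)) => //.
  apply/subsetP=> c /setIdP[Bc /eqP]; rewrite mul1mx => c1.
  by apply/set1gP/ffulB.
(* In a cyclic p-group one of the factors of B = [B, y] x C_B(y) is trivial, and B is not
   centralised by y. *)
have regy: 'C_B[y] = 1%g.
  have nBy: <[y]> \subset 'N(B) by rewrite cycle_subG (subsetP nBX).
  have := coprime_abelian_dprod nBy coBy cBB.
  case/(cyclic_pgroup_dprod_trivg pB cycB) => [] [h1 h2].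
    by case/negP: ncBy; rewrite -h2 cent_cycle subsetIr.
  by rewrite -cent_cycle.
have B1 := cyclic_irr_fixed_trivial irrB cycB nBX ffulB sRX Xy cRy coRy regR regy fixR.
by rewrite B1 inE (negPf nt_b) in Bb.
Qed.

End FieldAction.

(** * Character degrees, inertia groups and normal complements *)

Section CharacterDegrees.
Set Implicit Arguments.
Unset Strict Implicit.
Unset Printing Implicit Defensive.
Import Order.TTheory GroupScope GRing.Theory Num.Theory.
Local Open Scope ring_scope.

Definition deg (gT : finGroupType) (G : {group gT}) (i : Iirr G) : nat :=
  Num.truncn ('chi_i 1%g).

Section OneGroup.
Variables (gT : finGroupType) (G : {group gT}).

Lemma degE (i : Iirr G) : 'chi_i 1%g = (deg i)%:R.
Proof. by rewrite truncnK ?Cnat_irr1. Qed.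

Lemma eq_deg (i : Iirr G) n : 'chi_i 1%g = n%:R -> deg i = n.
Proof. by move=> di; apply/eqP; rewrite -(eqr_nat algC) -degE di. Qed.

Lemma deg_gt0 (i : Iirr G) : (0 < deg i)%N.
Proof. by rewrite -(ltr_nat algC) -degE irr1_gt0. Qed.

Lemma lin_deg (i : Iirr G) : ('chi_i \is a linear_char) = (deg i == 1%N).
Proof. by rewrite qualifE /= irr_char degE pnatr_eq1. Qed.

Lemma deg_dvd_card (i : Iirr G) : (deg i %| #|G|)%N.
Proof. by have := dvd_irr1_cardG i; rewrite degE dvdC_nat. Qed.

Lemma deg_sum_square : (\sum_(i : Iirr G) deg i ^ 2 = #|G|)%N.
Proof.
apply/eqP; rewrite -(eqr_nat algC) -irr_sum_square natr_sum; apply/eqP.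
by apply: eq_bigr => i _; rewrite degE natrX.
Qed.

End OneGroup.

Lemma deg_mod (gT : finGroupType) (G N : {group gT}) (i : Iirr (G / N)) : N <| G -> deg (mod_Iirr i) = deg i.
Proof. by move=> nsNG; apply: eq_deg; rewrite mod_IirrE // cfMod1 degE. Qed.

Lemma deg_constt_dvd (gT : finGroupType) (G N : {group gT}) i j : N <| G ->
  j \in irr_constt ('Res[N] 'chi[G]_i) -> (deg j %| deg i)%N.
Proof.
move=> nsNG jNi; have [n] := dvdn_constt_Res1_irr1 nsNG jNi.
rewrite !degE -natrM => /eqP; rewrite eqr_nat => /eqP->.
exact: dvdn_mull.
Qed.

Lemma constt_Res_between (gT : finGroupType) (G N M : {group gT})
    (i : Iirr G) (j : Iirr N) :
    N \subset M -> M \subset G -> j \in irr_constt ('Res[N] 'chi_i) ->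
  exists2 k, k \in irr_constt ('Res[M] 'chi_i) & j \in irr_constt ('Res[N] 'chi_k).
Proof.
move=> sNM sMG jNi; apply/exists_inP; apply: contraLR jNi.
rewrite negb_exists_in negbK => /forall_inP nj.
rewrite -(cfResRes _ sNM sMG) cfdot_Res_l.
rewrite ['Res[M] _]cfun_sum_constt cfdot_suml big1 // => k kMi.
have := nj k kMi; rewrite cfdotZl -cfdot_Res_l negbK => /eqP->.
by rewrite mulr0.
Qed.


Lemma constt_Res_cfclass (gT : finGroupType) (G N : {group gT}) i j k :
    N <| G -> j \in irr_constt ('Res[N] 'chi[G]_i) ->
    k \in irr_constt ('Res[N] 'chi_i) ->
  ('chi_k \in 'chi_j ^: G)%CF.
Proof.
move=> nsNG jNi; apply: contraTT => not_k.
rewrite irr_consttE (Clifford_Res_sum_cfclass nsNG jNi) negbK.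
rewrite cfdotZl reindex_cfclass // cfdot_suml big1 ?mulr0 // => u ju.
by rewrite cfdot_irr; case: eqP ju not_k => // -> ->.
Qed.

(** Solvability of G / N allows a descent through normal subgroups M of prime index. Restriction to
    M is either irreducible, which keeps the degree, or a sum of |G : M| conjugates, which divides
    the degree by |G : M|. *)
Lemma deg_constt_index (gT : finGroupType) (G N : {group gT}) i j :
    N <| G -> solvable (G / N) -> j \in irr_constt ('Res[N] 'chi[G]_i) ->
  exists2 e, deg i = (e * deg j)%N & (e %| #|G : N|)%N.
Proof.
have [n] := ubnP #|G : N|; elim: n => // n IHn in G N i j *; rewrite ltnS.
move=> leGn nsNG solGN jNi; have [sNG nNG] := andP nsNG.
have [GN1 | ntGN] := eqVneq (G / N)%g 1%g.
  have eqNG: N = G.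
    by apply/val_inj/eqP; rewrite eqEsubset sNG /= -quotient_sub1 // GN1.
  move: j jNi; rewrite eqNG cfRes_id => j; rewrite constt_irr => /eqP->.
  by exists 1%N; rewrite ?mul1n.
have [Mb nsMbG pr_Mb] := sol_prime_factor_exists solGN ntGN.
have [M defMb sNM nsMG] := inv_quotientN nsNG nsMbG.
have sMG := normal_sub nsMG.
have pr_iM: prime #|G : M|.
  by rewrite -(index_quotient_eq _ sMG nNG) -?defMb // subIset ?sNM ?orbT.
have [k kMi jNk] := constt_Res_between sNM sMG jNi.
have nsNM: N <| M by rewrite (normalS sNM sMG).
have solMN: solvable (M / N) by rewrite (solvableS _ solGN) ?quotientS.
have [|e dk e_dv] := IHn M N k j _ nsNM solMN jNk.
  rewrite (leq_trans _ leGn) // -(Lagrange_index sMG sNM).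
  by rewrite ltn_Pmull ?prime_gt1 ?indexg_gt0.
have [irrMi | [c inj_c defMi]] := cfRes_prime_irr_cases i nsMG (erefl _) pr_iM.
  exists e; last by rewrite -(Lagrange_index sMG sNM) dvdn_mull.
  move: kMi; have /irrP[k1 def_k1] := irrMi; rewrite def_k1 constt_irr => /eqP eqk.
  by rewrite -dk eqk; apply: eq_deg; rewrite -degE -def_k1 cfRes1.
exists (#|G : M| * e)%N; last first.
  by rewrite -(Lagrange_index sMG sNM) dvdn_mul.
rewrite -mulnA -dk; apply: eq_deg; rewrite -(cfRes1 M).
have cl t: 'chi_(c t) 1%g = 'chi_k 1%g.
  have ct: c t \in irr_constt ('Res[M] 'chi_i).
    rewrite irr_consttE defMi cfdot_suml (bigD1 t) //= cfnorm_irr big1 ?addr0 ?oner_eq0 //.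
    by move=> u ne_ut; rewrite cfdot_irr (inj_eq inj_c) (negPf ne_ut).
  have := constt_Res_cfclass nsMG kMi ct.
  by case/cfclassP=> y _ ->; rewrite cfConjg1.
rewrite defMi sum_cfunE (eq_bigr (fun=> 'chi_k 1%g)) => [|t _]; last exact: cl.
rewrite sumr_const card_ord degE.
by rewrite natrM mulr_natl.
Qed.

(** By coprimality the character extends to its inertia group, and the Clifford correspondence makes
    the induced extension irreducible. *)
Lemma deg_Ind_Hall (gT : finGroupType) (G N : {group gT}) (j : Iirr N) :
    N <| G -> solvable (G / N) -> coprime #|N| #|G : N| ->
  exists2 i, deg i = (#|G : 'I_G['chi_j]| * deg j)%N
           & j \in irr_constt ('Res[N] 'chi[G]_i).
Proof.
move=> nsNG solGN coN; have [sNG nNG] := andP nsNG.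
set T := 'I_G['chi_j]%G; have sTG: T \subset G := Inertia_sub _ _.
have nsNT: N <| T := normal_Inertia 'chi_j sNG.
have [|||c [cN _ _]] := @extend_solvable_coprime_irr _ T N j nsNT.
- by rewrite (solvableS _ solGN) ?quotientS.
- exact: subsetIr.
- rewrite coprime_sym coprimeMl.
  have coT d: (d %| #|N|)%N -> coprime d #|T : N|.
    move=> dN; apply: coprime_dvdl dN _; apply: coprime_dvdr coN.
    by rewrite -(Lagrange_index sTG (normal_sub nsNT)) dvdn_mull.
  by rewrite !coT ?cfDet_order_dvdG //; apply: deg_dvd_card.
have Tc: c \in irr_constt ('Ind[T] 'chi_j).
  by rewrite constt_Ind_Res cN constt_irr inE.
have [irrInd _ _ _ IndRes] := constt_Inertia_bijection j nsNG.
have /irrP[i def_i] := irrInd c Tc; exists i.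
  apply: eq_deg; rewrite -def_i cfInd1 // natrM; congr (_ * _).
  by rewrite -(cfRes1 N) cN degE.
have /= := IndRes c Tc; rewrite def_i cN cfnorm_irr => i1.
by rewrite irr_consttE -i1 oner_eq0.
Qed.

Lemma Ind_irr_inertia_sub (gT : finGroupType) (G N : {group gT}) (j : Iirr N) :
  N <| G -> 'I_G['chi_j] \subset N -> 'Ind[G] 'chi_j \in irr G.
Proof.
move=> nsNG sIN; rewrite irrEchar cfInd_char ?irr_char //=.
rewrite -cfdot_Res_r cfResInd // cfdotZr cfdot_sumr.
rewrite (eq_bigr (fun y => (y \in 'I_G['chi_j])%:R)) => [|y Gy]; last first.
  exact: cfdot_irr_conjg.
have -> : \sum_(y in G) (y \in 'I_G['chi_j])%:R = #|N|%:R :> algC.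
  rewrite -natr_sum -big_mkcondr /= sum1_card; congr _%:R; apply: eq_card => y.
  apply/andP/idP => [[_ /(subsetP sIN)] // | Ny].
  have sNG := normal_sub nsNG.
  by split; [apply: (subsetP sNG) | apply: (subsetP (sub_Inertia _ sNG))].
by rewrite fmorphV /= conjC_nat mulVf // neq0CG.
Qed.

(** A weighted fixed-point congruence: each level set of f is stable under A, so the usual
    congruence applies to it. The weights used below are squared degrees. *)
Lemma pgroup_fix_sum (p : nat) (aT : finGroupType) (sT : finType)
    (D : {group aT}) (to : action D sT) (A : {group aT}) (S : {set sT}) (f : sT -> nat) :
    p.-group A -> [acts A, on S | to] ->
    {in A & S, forall a x, f (to x a) = f x} ->
  (\sum_(x in S) f x = \sum_(x in 'Fix_(S | to)(A)) f x %[mod p])%N.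
Proof.
move=> pA actsA fA; pose m := \max_(x in S) f x.
have fm x: x \in S -> (f x < m.+1)%N.
  by move=> Sx; rewrite ltnS; apply: (@leq_bigmax_cond _ [pred y in S] f).
have part (R : {set sT}) : R \subset S ->
   (\sum_(x in R) f x = \sum_(v < m.+1) #|[set x in R | f x == v]| * v)%N.
  move=> sRS; rewrite (partition_big (fun x => inord (f x) : 'I_m.+1) predT) //=.
  apply: eq_bigr => v _; rewrite -sum_nat_const; apply: eq_big => x.
    rewrite inE; case Rx: (x \in R) => //=; rewrite -val_eqE /= inordK //.
    by rewrite fm // (subsetP sRS).
  case/andP=> Rx /eqP <-; rewrite inordK //.
  by rewrite fm // (subsetP sRS).
rewrite !part ?subsetIl //.
elim/big_rec2: _ => // v s1 s2 _ eq_s.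
set Sv := [set x in S | f x == v].
have actsv: [acts A, on Sv | to].
  apply/subsetP=> a Aa; have := subsetP actsA a Aa; rewrite !inE => /andP[-> _].
  apply/subsetP=> x; rewrite !inE => /andP[Sx fx].
  by rewrite (acts_act actsA) // Sx fA.
have ->: [set x in 'Fix_(S | to)(A) | f x == v] = 'Fix_(Sv | to)(A).
  by apply/setP=> x; rewrite !inE andbAC.
have eq_fix := pgroup_fix_mod pA actsv.
by rewrite -modnDm -modnMml eq_fix eq_s modnMml modnDm.
Qed.

Lemma conjg_Iirr_is_action (gT : finGroupType) (N : {group gT}) :
  is_action 'N(N) (@conjg_Iirr gT N).
Proof.
split=> [y|i y z Ny Nz]; first exact: conjg_Iirr_inj.
by apply: irr_inj; rewrite !conjg_IirrE cfConjgMnorm.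
Qed.

Definition conjg_Iirr_act (gT : finGroupType) (N : {group gT}) :=
  Action (conjg_Iirr_is_action N).

Lemma afix_conjg_Iirr (gT : finGroupType) (N A : {group gT}) (i : Iirr N) :
  A \subset 'N(N) ->
  (i \in 'Fix_(conjg_Iirr_act N)(A)) = (A \subset 'I['chi_i]).
Proof.
move=> nNA; apply/afixP/subsetP=> fixi y Ay.
  rewrite inE (subsetP nNA) //=; apply/eqP.
  by rewrite -conjg_IirrE; congr 'chi_(_); apply: fixi.
by apply: irr_inj; rewrite /= conjg_IirrE inertiaJ ?fixi.
Qed.

(** W is O^p(G), given by generators. An element of prime order s != p in G / W is the image of the
    p'-part of a lift, which lies in W. *)
Lemma p'gen_quotient_pgroup (gT : finGroupType) (p : nat) (G : {group gT}) :
  let W := <<[set x in G | p^'.-elt x]>>%G in W <| G /\ p.-group (G / W).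
Proof.
move=> W; have nsWG: W <| G.
  rewrite /normal gen_subG; apply/andP; split.
    by apply/subsetP=> x; rewrite inE => /andP[].
  apply: subset_trans (norm_gen _); apply/subsetP=> y Gy; rewrite inE.
  apply/subsetP=> _ /imsetP[x /setIdP[Gx p'x] ->].
  by rewrite inE groupJ // p_eltJ.
split=> //; apply/pgroupP=> s pr_s /Cauchy[] // xb /morphimP[x nWx Gx ->] ox.
apply/idPn=> s'p; have p'xb: p^'.-elt (coset W x).
  by rewrite /p_elt ox pnatE // inE.
have Wx: x.`_p^' \in W.
  by rewrite mem_gen // inE p_elt_constt groupX.
have: #[coset W x] = 1%N.
  have <-: coset W x.`_p^' = coset W x by rewrite morph_constt // constt_p_elt.
  by rewrite coset_id // order1.
by rewrite ox => s1; rewrite s1 in pr_s.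
Qed.

(** The quotient is generated by images of p'-elements, and in an abelian group these generate a
    p'-group. *)
Lemma p'gen_abelian_quotient (gT : finGroupType) (p : nat) (G M : {group gT}) :
  let W := <<[set x in G | p^'.-elt x]>>%G in
  M <| W -> abelian (W / M) -> p^'.-group (W / M).
Proof.
move=> W nsMW cWM; have [sMW nMW] := andP nsMW.
have hallO := nilpotent_pcore_Hall p^' (abelian_nil cWM).
have memO z: z \in (W / M)%g -> p^'.-elt z -> z \in 'O_p^'(W / M).
  by move=> Wz; rewrite (mem_normal_Hall hallO) ?pcore_normal.
suffices: (W / M)%g \subset 'O_p^'(W / M).
  by move=> sWO; rewrite (pgroupS sWO) ?pcore_pgroup.
have defWM: (W / M)%g = <<[set x in G | p^'.-elt x] / M>>%g.
  by rewrite quotient_gen //; apply: subset_trans (subset_gen _) nMW.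
apply: (@subset_trans _ _ <<[set x in G | p^'.-elt x] / M>>%g).
  by rewrite defWM.
rewrite gen_subG; apply/subsetP=> _ /morphimP[x nMx /setIdP[Gx p'x] ->].
apply: memO; last exact: morph_p_elt.
by apply: mem_quotient; rewrite mem_gen // inE Gx.
Qed.

(** Let W = O^p(G), K = [W, G] and let P be a Sylow p-subgroup. Modulo p, the sum |W| of the squared
    degrees of W reduces to the P-invariant characters of degree prime to p. These are exactly the
    characters of the abelian group W / K, whose order is prime to p. Hence so is |W|, while G / W
    is a p-group. *)
Lemma Thompson_normal_complement (gT : finGroupType) (G : {group gT}) (p : nat) :
    prime p ->
    (forall i : Iirr G, 'chi_i \isn't a linear_char -> (p %| deg i)%N) ->
  p^'.-Hall(G) 'O_p^'(G).
Proof.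
move=> pr_p p_deg; pose W := <<[set x in G | p^'.-elt x]>>%G.
have [nsWG pGW] := p'gen_quotient_pgroup p G; rewrite -/W in nsWG pGW.
have [sWG nWG] := andP nsWG.
have p'ab (M : {group gT}) := @p'gen_abelian_quotient gT p G M.
rewrite /= -/W in p'ab.
have iGW: p.-nat #|G : W| by rewrite -card_quotient.
have solGW: solvable (G / W) by apply: pgroup_sol pGW.
have [P sylP] := Sylow_exists p G; have [sPG pP _] := and3P sylP.
have defG: (W * P)%g = G.
  apply/eqP; rewrite eqEsubset mul_subG //= -quotientSK //.
  have sylPW := quotient_pHall (subset_trans sPG nWG) sylP.
  by rewrite (pHall_id sylPW).
suffices p'W: p^'.-group W.
  have hallW: p^'.-Hall(G) W by rewrite /pHall sWG p'W pnatNK.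
  by rewrite (normal_Hall_pcore hallW).
pose K := [~: W, G]%G.
have nsKW: K <| W by rewrite /normal commg_subl nWG (subset_trans sWG) // commg_normr.
have cWK: abelian (W / K) by rewrite sub_der1_abelian // commgS.
have p'WK := p'ab K nsKW cWK.
have nNP: P \subset 'N(W) := subset_trans sPG nWG.
have actsP: [acts P, on [set: Iirr W] | conjg_Iirr_act W].
  apply/subsetP=> y Py; apply/setIP; split; first exact: (subsetP nNP).
  by rewrite inE; apply/subsetP=> i; rewrite !inE.
have := pgroup_fix_sum (f := fun i => (deg i ^ 2)%N) pP actsP.
rewrite (eq_bigl xpredT) => [|i]; last by rewrite inE.
rewrite deg_sum_square => eqW; rewrite /pgroup p'natE //.
rewrite /dvdn eqW; last first.
  move=> y i _ _; congr (_ ^ 2)%N; apply: eq_deg.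
  by rewrite conjg_IirrE cfConjg1 degE.
rewrite setTI (bigID (fun i => p %| deg i)%N) /= -modnDml.
have /dvdnP[m ->]: (p %| \sum_(i in 'Fix_(conjg_Iirr_act W)(P) | p %| deg i) deg i ^ 2)%N.
  by apply: dvdn_sum => i /andP[_ pi]; rewrite dvdn_mulr.
rewrite modnMl add0n -/(p %| _)%N.
(* A P-invariant character is invariant in G = W P. If its degree is prime to p it extends to G, its
   determinant also having order prime to p; the extension is then linear, so it is trivial on K. *)
have lin_fix i: (i \in 'Fix_(conjg_Iirr_act W)(P)) && ~~ (p %| deg i)%N
              = (K \subset cfker 'chi_i).
  rewrite afix_conjg_Iirr //; apply/andP/idP=> [[sPI p'i] | sKi].
    have sGI: G \subset 'I['chi_i] by rewrite -defG mul_subG ?sub_inertia.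
    have [|c [cW _ _]] := extend_solvable_coprime_irr nsWG solGW sGI.
      apply: pnat_coprime iGW _; rewrite pnatM; apply/andP; split; last first.
        by rewrite -/(deg i) p'natE.
      set mu := cfDet 'chi_i; have lin_mu: mu \is a linear_char := cfDet_lin_char _.
      rewrite /cfDet_order -/mu cforder_lin_char // (pnat_dvd (exponent_dvdn _)) //.
      apply: p'ab; first exact: cfker_normal.
      have /irrP[k def_k] := lin_char_irr lin_mu.
      by rewrite sub_der1_abelian // def_k -lin_irr_der1 -def_k.
    have lin_c: 'chi_c \is a linear_char.
      apply: contraR p'i => /p_deg; congr (p %| _)%N; apply: eq_deg.
      by rewrite -degE -cW cfRes1.
    rewrite -cW cfker_Res ?irr_char // subsetI commg_subl nWG.
    by rewrite lin_irr_der1 in lin_c; rewrite (subset_trans _ lin_c) ?commSg.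
  have lin_i: 'chi_i \is a linear_char.
    by rewrite lin_irr_der1 (subset_trans _ sKi) // commgS.
  split; last first.
    by move: lin_i; rewrite lin_deg => /eqP->; rewrite dvdn1 neq_ltn prime_gt1 ?orbT.
  apply/subsetP=> y Py; have NWy := subsetP nNP y Py; rewrite inE NWy /=.
  apply/eqP/cfun_inP=> x Wx; rewrite cfConjgE //.
  have Gy: y^-1%g \in G by rewrite groupV (subsetP sPG).
  have kxy: [~ x, y^-1] \in cfker 'chi_i by rewrite (subsetP sKi) // mem_commg.
  by have ->: (x ^ y^-1 = x * [~ x, y^-1])%g; rewrite ?cfkerMr // commgEl mulKVg.
rewrite (eq_big (fun i => K \subset cfker 'chi_i) (fun=> 1%N)) //; last first.
  move=> i; rewrite lin_fix => sKi; suffices /eqP->: deg i == 1%N by [].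
  by rewrite -lin_deg lin_irr_der1 (subset_trans _ sKi) // commgS.
rewrite sum1_card -(on_card_preimset (mod_Iirr_bij nsKW)).
rewrite (_ : #|_| = #|Iirr (W / K)|); last first.
  by apply: eq_card => b; rewrite !inE mod_IirrE // cfker_mod.
by rewrite card_Iirr_abelian // -p'natE.
Qed.

(* Evaluating the regular character at a central element of a Sylow
   p-subgroup kills the p-power degrees, leaving -1 as a multiple of r. *)
Lemma simple_two_prime_degrees_abelian (gT : finGroupType) (G : {group gT})
    (p r : nat) :
    prime r -> simple G ->
    (forall i : Iirr G, p.-nat (deg i) || r.-nat (deg i)) ->
  abelian G.
Proof.
move=> pr_r simpleG degG; apply/idPn=> not_cGG.
have [ntG minG] := simpleP _ simpleG.
have fful_i (i : Iirr G): i != 0 -> cfker 'chi_i = [1].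
  move=> nz_i; have /minG[//|/eqP] := cfker_normal 'chi_i.
  by rewrite eqEsubset subGcfker (negPf nz_i) andbF.
have trivZ: 'Z(G) = [1] by have /minG[|/center_idP/idPn] := center_normal G.
have trivZi (i : Iirr G): i != 0 -> ('Z('chi_i))%CF = [1].
  move=> nz_i; apply/trivgP; rewrite -quotient_sub1 ?norms1 //=.
  rewrite -(fful_i i) // cfcenter_eq_center fful_i // subG1.
  by rewrite -(isog_eq1 (isog_center (quotient1_isog G))) /= trivZ.
have deg1 (i : Iirr G): i != 0 -> deg i != 1%N.
  move=> nz_i; rewrite -lin_deg lin_irr_der1; apply: contra not_cGG => sG'k.
  by apply/derG1P/trivgP; rewrite -(fful_i i nz_i).
(* A central element of a Sylow p-subgroup has a class of size prime to p. If p does not divide |G|,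
   any nontrivial g will do, as a degree that is a p-number must be 1. *)
have [g [Gg nt_g co_g]]: exists g, [/\ g \in G, g != 1%g &
    forall i : Iirr G, p.-nat (deg i) -> deg i != 1%N -> coprime (deg i) #|g ^: G|].
  have [p_dv | p'G] := boolP (p \in \pi(#|G|)).
    have [P sylP] := Sylow_exists p G; have [sPG pP p'GP] := and3P sylP.
    have ntP: P :!=: 1%g by rewrite -rank_gt0 (rank_Sylow sylP) p_rank_gt0.
    have /trivgPn[g /setIP[Pg cPg] nt_g]: 'Z(P) != 1%g.
      by rewrite center_nil_eq1 // (pgroup_nil pP).
    exists g; rewrite (subsetP sPG) //; split=> // i pi _.
    apply: pnat_coprime pi _; rewrite -index_cent1 (pnat_dvd _ p'GP) ?indexgS //.
    by rewrite subsetI sPG sub_cent1.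
  have /trivgPn[g Gg nt_g] := ntG; exists g; split=> // i pi nti.
  case/negP: nti; apply/eqP/(pnat_1 pi); apply: pnat_dvd (deg_dvd_card i) _.
  by rewrite p'natEpi ?cardG_gt0.
have supp_g (i : Iirr G): i != 0 -> ~~ (r %| deg i)%N -> 'chi_i g = 0.
  move=> nz_i r'i; have /orP[pi | ri] := degG i; last first.
    case/negP: r'i; have:= deg1 i nz_i; have [k ->] := p_natP ri.
    by case: k => // k _; rewrite dvdn_exp.
  by rewrite coprime_degree_support_cfcenter ?trivZi ?inE // co_g ?deg1.
pose alpha := \sum_(i | (r %| deg i)%N && (i != 0)) (deg i %/ r)%:R * 'chi[G]_i g.
have nz_r: r%:R != 0 :> algC by rewrite pnatr_eq0 -lt0n prime_gt0.
have Dalpha: alpha = - 1 / r%:R.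
  apply/(canRL (mulfK nz_r))/eqP; rewrite -addr_eq0 addrC; apply/eqP/esym.
  transitivity (cfReg G g); first by rewrite cfRegE (negPf nt_g).
  rewrite cfReg_sum sum_cfunE (bigD1 0) //= irr0 !cfunE cfun11 cfun1E Gg.
  rewrite mulr1; congr (1 + _); rewrite (bigID (fun i => r %| deg i)%N) /= addrC.
  rewrite big1 => [|i /andP[nz_i r'i]]; last by rewrite cfunE supp_g ?mulr0.
  rewrite add0r big_andbC mulr_suml; apply: eq_bigr => i /andP[r_dv _].
  by rewrite mulrAC -natrM divnK // cfunE degE.
have: alpha \in Num.int.
  rewrite Cint_rat_Aint ?Dalpha ?rpred_div ?rpredN ?rpred1 ?rpred_nat //.
  by rewrite -Dalpha rpred_sum // => i _; rewrite rpredM ?Aint_irr ?rpred_nat.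
rewrite Dalpha mulNr mul1r rpredN => /intrP[z def_z].
have: (r%:Z * z)%R == 1 by rewrite -(eqr_int algC) intrM -def_z mulfV.
move/eqP/(congr1 absz); rewrite abszM /= => /eqP; rewrite muln_eq1 => /andP[/eqP r1 _].
by rewrite r1 in pr_r.
Qed.

Lemma two_prime_degrees_solvable (gT : finGroupType) (G : {group gT})
    (p r : nat) :
    prime r -> (forall i : Iirr G, p.-nat (deg i) || r.-nat (deg i)) ->
  solvable G.
Proof.
move=> pr_r; have [n] := ubnP #|G|; elim: n => // n IHn in gT G *.
rewrite ltnS => leGn degG.
have [simpleG | ] := boolP (simple G).
  exact/abelian_sol/(simple_two_prime_degrees_abelian pr_r simpleG degG).
have [->|ntG] := eqVneq (G : {set gT}) 1%g; first by rewrite solvable1.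
move/simpleP=> not_simple; have [N nsNG]: exists2 N : {group gT}, N <| G
    & (N :!=: 1%g) && (N :!=: G).
  apply/exists_inP; apply: contraPT not_simple.
  rewrite negb_exists_in => /forall_inP minG; case; split=> // N nsNG.
  by have:= minG N nsNG; rewrite negb_and !negbK => /orP[]/eqP; [left | right].
case/andP=> ntN neqNG; have [sNG nNG] := andP nsNG.
rewrite (series_sol nsNG) !IHn //.
- by apply: leq_trans leGn; apply: ltn_quotient.
- by move=> i; have := degG (mod_Iirr i); rewrite deg_mod.
- by apply: leq_trans leGn; rewrite proper_card // properEneq neqNG.
move=> j; have [i iInd] := constt_cfInd_irr j sNG.
rewrite constt_Ind_Res in iInd; have jd := deg_constt_dvd nsNG iInd.
by case/orP: (degG i) => /(pnat_dvd jd) ->; rewrite ?orbT.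
Qed.

Definition degrees (gT : finGroupType) (G : {group gT}) (s : seq nat) : Prop :=
  (forall i : Iirr G, deg i \in s) /\
  (forall d, d \in s -> exists i : Iirr G, deg i = d).

Lemma cd_degrees (gT : finGroupType) (G : {group gT}) (s : seq nat) :
  degrees G s <-> cd G =i [seq n%:R | n <- s].
Proof.
split=> [[degG Gdeg] x | cdG].
  apply/imageP/mapP=> [[i _ ->] | [d /Gdeg[i <-] ->]]; last first.
    by exists i; rewrite ?degE.
  by exists (deg i); rewrite ?degG ?degE.
split=> [i | d sd].
  have: 'chi_i 1%g \in cd G by apply/imageP; exists i.
  by rewrite cdG degE => /mapP[d sd /eqP]; rewrite eqr_nat => /eqP->.
have: d%:R \in cd G by rewrite cdG map_f.
by case/imageP=> i _ di; exists i; apply: eq_deg.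
Qed.

Lemma partn_pi'_mul (pi : nat_pred) e t :
  pi.-nat e -> pi^'.-nat t -> ((e * t)`_pi^' = t)%N.
Proof.
move=> pi_e pi't; have [/andP[e0 _] /andP[t0 _]] := (pi_e, pi't).
rewrite partnM //; by rewrite part_p'nat ?pnatNK // mul1n part_pnat_id.
Qed.

(** The ratio of the degrees divides the pi-number |G : L|, whereas deg j divides the pi'-number
    |L|. *)
Lemma degree_constt_Hall (gT : finGroupType) (G L : {group gT}) (pi : nat_pred) i j :
    L <| G -> solvable (G / L) -> pi^'.-Hall(G) L ->
    j \in irr_constt ('Res[L] 'chi[G]_i) ->
  deg j = ((deg i)`_pi^')%N.
Proof.
move=> nsLG solGL /and3P[_ pi'L piGL] jLi.
have [e -> e_dv] := deg_constt_index nsLG solGL jLi.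
rewrite partn_pi'_mul ?(pnat_dvd (deg_dvd_card j)) //.
by apply: pnat_dvd e_dv _; rewrite pnatNK in piGL.
Qed.

Lemma constt_Res_eq_deg (gT : finGroupType) (G L : {group gT}) i j :
    L \subset G -> j \in irr_constt ('Res[L] 'chi[G]_i) -> deg i = deg j ->
  'Res[L] 'chi_i = 'chi_j.
Proof.
move=> sLG jLi eq_d; have [chi1 Nchi1 def_i] := constt_charP j (cfRes_char L (irr_char i)) jLi.
rewrite def_i; apply/eqP; rewrite -subr_eq0 addrAC subrr add0r -char1_eq0 //.
have := congr1 (fun chi : 'CF(L) => chi 1%g) def_i.
rewrite cfRes1 cfunE !degE eq_d -[X in X = _]addr0 => /addrI <-.
by rewrite eqxx.
Qed.

(** The q'-part of a degree of G is a degree of L, and it is 1 only for linear characters. So G / L,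
    a q-group, is abelian; and a linear character of L is the restriction of a linear character of
    G, so that its kernel contains [L, G]. These kernels intersect in L'. *)
Lemma normal_q'_Hall_of_degrees (gT : finGroupType) (G : {group gT})
    (p q r a b c d : nat) :
    prime p -> prime q -> prime r -> p != q -> r != q ->
    (0 < a)%N -> (0 < b)%N -> (0 < c)%N -> (0 < d)%N ->
    degrees G [:: 1; p ^ a * q ^ b; r ^ c * q ^ d]%N ->
  solvable G /\ exists L : {group gT},
    [/\ q^'.-Hall(G) L, L <| G, abelian (G / L), [~: L, G] \subset (L^`(1))%g
      & degrees L [:: 1; p ^ a; r ^ c]%N].
Proof.
move=> pr_p pr_q pr_r neq_pq neq_rq a0 b0 c0 d0 [degG Gdeg].
have hallL: q^'.-Hall(G) 'O_q^'(G).
  apply: Thompson_normal_complement => // i; rewrite lin_deg => nlin_i.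
  have:= degG i; rewrite !inE (negPf nlin_i) /= => /orP[] /eqP->.
    by rewrite dvdn_mull // dvdn_exp.
  by rewrite dvdn_mull // dvdn_exp.
set L := 'O_q^'(G)%G in hallL *.
have nsLG: L <| G := pcore_normal _ _; have [sLG nLG] := andP nsLG.
have qGL: q.-group (G / L).
  by rewrite /pgroup card_quotient //; case/and3P: hallL; rewrite pnatNK.
have solGL := pgroup_sol qGL.
have degL i j := @degree_constt_Hall _ G L q i j nsLG solGL hallL.
have q'X s k : prime s -> s != q -> q^'.-nat (s ^ k)%N.
  by move=> pr_s neq_sq; rewrite pnatX pnatE // inE neq_sq.
have part1 s k l : prime s -> s != q -> ((s ^ k * q ^ l)`_q^' = s ^ k)%N.
  move=> pr_s neq_sq; rewrite mulnC partn_pi'_mul ?q'X //.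
  by rewrite pnatX pnat_id.
have gt1X s k: prime s -> (0 < k)%N -> (s ^ k != 1)%N.
  by move=> pr_s k0; rewrite -(expn0 s) eqn_exp2l ?prime_gt1 // -lt0n.
have partG i: ((deg i)`_q^' \in [:: 1; p ^ a; r ^ c])%N
    /\ ((deg i)`_q^' = 1 -> @deg _ G i = 1)%N.
  have:= degG i; rewrite !inE => /or3P[] /eqP->.
  - by rewrite partn1.
  - by rewrite part1 // eqxx !orbT; split=> // pa1; case/eqP: (gt1X p a pr_p a0).
  - by rewrite part1 // eqxx !orbT; split=> // pa1; case/eqP: (gt1X r c pr_r c0).
split; last first.
  exists L; split=> //.
  - apply/char_abelianP=> i; rewrite lin_deg -(deg_mod i nsLG).
    apply/eqP/(proj2 (partG _)); rewrite deg_mod //.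
    by rewrite part_p'nat // pnatNK (pnat_dvd (deg_dvd_card i)).
  - rewrite -cap_cfker_lin_irr; apply/bigcapsP=> j lin_j.
    have [i] := constt_cfInd_irr j sLG; rewrite constt_Ind_Res => jLi.
    have dj: deg j = 1%N by apply/eqP; rewrite -lin_deg.
    have di: deg i = 1%N by apply: (proj2 (partG i)); rewrite -(degL i j).
    rewrite -(constt_Res_eq_deg sLG jLi) ?di // cfker_Res ?irr_char //.
    rewrite subsetI commg_subl nLG (subset_trans (commSg G sLG)) //.
    by rewrite -lin_irr_der1 lin_deg di.
  - split=> [j | m].
      have [i] := constt_cfInd_irr j sLG; rewrite constt_Ind_Res => jLi.
      by rewrite (degL i j jLi); case: (partG i).
    have ex i: exists j : Iirr L, deg j = ((@deg _ G i)`_q^')%N.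
      by have [j jLi] := constt_cfRes_irr L i; exists j; apply: degL.
    rewrite !inE => /or3P[]/eqP->.
    + by have [i di] := Gdeg 1%N isT; have [j dj] := ex i; exists j; rewrite dj di partn1.
    + have [|i di] := Gdeg (p ^ a * q ^ b)%N; first by rewrite !inE eqxx orbT.
      by have [j dj] := ex i; exists j; rewrite dj di part1.
    + have [|i di] := Gdeg (r ^ c * q ^ d)%N; first by rewrite !inE eqxx !orbT.
      by have [j dj] := ex i; exists j; rewrite dj di part1.
rewrite (series_sol nsLG) solGL andbT.
apply: (two_prime_degrees_solvable (p := p) pr_r) => j.
have [i] := constt_cfInd_irr j sLG; rewrite constt_Ind_Res => jLi.
have := proj1 (partG i); rewrite -(degL i j jLi) !inE => /or3P[]/eqP->.
- by [].
- by rewrite pnatX pnat_id.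
- by rewrite !pnatX [r.-nat r]pnat_id ?orbT.
Qed.

End CharacterDegrees.

(** * A section with fixed-point-free action *)

Section ChiefSections.
Set Implicit Arguments.
Unset Strict Implicit.
Unset Printing Implicit Defensive.
Local Open Scope group_scope.

(** For x normalising K and N, this says that x fixes no nontrivial element of K / N. Stated with
    representatives, it passes easily to quotients and preimages. *)
Definition fpf_on (gT : finGroupType) (K N : {set gT}) (x : gT) : Prop :=
  {in K, forall z, [~ z, x] \in N -> z \in N}.

(** G / L' is the product of the images of L and of a Sylow q-subgroup, which are abelian and
    commute. *)
Lemma der1_sub_normal_Hall (gT : finGroupType) (G L : {group gT}) (q : nat) :
    L <| G -> q^'.-Hall(G) L -> abelian (G / L) -> [~: L, G] \subset L^`(1) ->
  G^`(1) \subset L^`(1).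
Proof.
move=> nsLG hallL cGL sLG_L'; have [sLG nLG] := andP nsLG.
have [Q sylQ] := Sylow_exists q G; have [sQG qQ _] := and3P sylQ.
have q'L: q^'.-group L by case/and3P: hallL.
have defG: L * Q = G := normal_Hall_mulG nsLG hallL sylQ.
have coLQ: coprime #|L| #|Q| by rewrite coprime_sym (pnat_coprime qQ).
have tiLQ: L :&: Q = 1 by apply: coprime_TIg.
have cQQ: abelian Q.
  by rewrite (isog_abelian (quotient_isog (subset_trans sQG nLG) tiLQ)) (abelianS _ cGL) ?quotientS.
have nVG: G \subset 'N(L^`(1)) by rewrite gFnorm_trans.
have nVL := subset_trans sLG nVG; have nVQ := subset_trans sQG nVG.
have: abelian (G / L^`(1)).
  rewrite -defG quotientMl // abelianM sub_der1_abelian // quotient_abelian //.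
  rewrite quotient_cents2 // commGC; exact: subset_trans (commgS _ sQG) sLG_L'.
by rewrite /abelian quotient_cents2.
Qed.

(** Let V = L', K = C_L(V), let y be an element of a Sylow q-subgroup outside C(V), and N = C_K(y).
    As G' lies in V, coprime action gives K = V N with V and N meeting trivially and N central in G.
    So K / N is a copy of V, on which the elements outside C(V) act without fixed points. If K were
    L, then L = V N would be abelian. *)
Lemma minnormal_der1_section (gT : finGroupType) (G L : {group gT}) (q : nat) :
    solvable L -> L <| G -> q^'.-Hall(G) L -> abelian (G / L) ->
    [~: L, G] \subset L^`(1) -> minnormal L^`(1) G ->
    (forall Q : {group gT}, q.-Sylow(G) Q -> ~~ (Q \subset 'C(L))) ->
  exists s (K N : {group gT}) (y : gT),
    [/\ prime s, K <| G, N <| G & s.-abelem (K / N)] /\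
    [/\ L^`(1) \subset K, K \proper L, N \proper K & y \in G /\ q.-elt y] /\
    [/\ {in L :\: K, forall x, fpf_on K N x} & fpf_on K N y].
Proof.
move=> solL nsLG hallL cGL sLG_L' minV nc_Q; have [sLG nLG] := andP nsLG.
pose V := (L^`(1))%G; have sVL: V \subset L := der_sub 1 L.
have nVG: G \subset 'N(V) by case/mingroupP: (minV) => /andP[].
have ntV: V :!=: 1 by case/mingroupP: (minV) => /andP[].
have [_ _ /is_abelemP[s pr_s abelV]] := minnormal_solvable minV sVL solL.
have cVV := abelem_abelian abelV.
have [Q sylQ] := Sylow_exists q G; have [sQG qQ _] := and3P sylQ.
have q'L: q^'.-group L by case/and3P: hallL.
have defG: L * Q = G := normal_Hall_mulG nsLG hallL sylQ.
have coLQ: coprime #|L| #|Q| by rewrite coprime_sym (pnat_coprime qQ).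
have tiLQ: L :&: Q = 1 by apply: coprime_TIg.
have cQQ: abelian Q.
  by rewrite (isog_abelian (quotient_isog (subset_trans sQG nLG) tiLQ)) (abelianS _ cGL) ?quotientS.
have sG'V: [~: G, G] \subset V := der1_sub_normal_Hall nsLG hallL cGL sLG_L'.
have [y Qy ncVy]: exists2 y, y \in Q & y \notin 'C(V).
  apply/subsetPn; apply: contra (nc_Q Q sylQ) => cVQ.
  apply: (coprime_stable_cent (subset_trans sQG nLG) coLQ solL) cVQ.
  by rewrite (subset_trans (commgS _ sQG)).
have Gy := subsetP sQG y Qy.
have comV g h: g \in G -> h \in G -> [~ g, h] \in V.
  by move=> Gg Gh; rewrite (subsetP sG'V) // mem_commg.
(* C_V(g) is normal in G, since each conjugate of g differs from g by an element of the abelian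
   group V; minimality makes it 1 or V. *)
have fixV g: g \in G -> g \notin 'C(V) -> 'C_V[g] = 1.
  move=> Gg ncVg; apply/eqP; apply: contraR ncVg => ntC.
  have [_ minG] := mingroupP minV.
  have -> : V :=: 'C_V[g]; last by apply/centP=> v /setIP[_ /cent1P].
  apply/esym/minG; last exact: subsetIl.
  rewrite ntC; apply/subsetP=> h Gh; rewrite inE; apply/subsetP=> _ /imsetP[v /setIP[Vv cgv] ->].
  have Vvh: v ^ h \in V by rewrite memJ_norm ?(subsetP nVG).
  rewrite inE Vvh; apply/cent1P.
  have defg: g = g ^ h * [~ g, h]^-1 by rewrite commgEl invMg invgK mulKVg.
  have c1: commute (v ^ h) (g ^ h).
    by rewrite /commute -!conjMg (cent1P cgv).
  have c2: commute (v ^ h) [~ g, h]^-1.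
    by apply: (centsP cVV); rewrite ?groupV ?comV.
  by rewrite {1}defg; apply: commuteM.
pose K := 'C_L(V)%G; pose N := 'C_K[y]%G.
have sVK: V \subset K by rewrite subsetI sVL.
have nsKG: K <| G.
  by rewrite /normal subIset ?sLG //= normsI // norms_cent.
have sKL: K \subset L := subsetIl _ _; have [sKG nKG] := andP nsKG.
have cVK: K \subset 'C(V) := subsetIr _ _.
have tiVN: V :&: N = 1.
  by apply/trivgP; rewrite -(fixV y Gy ncVy) setISS // subsetIr.
have defK: V * N = K.
  have nKy: <[y]> \subset 'N(K) by rewrite cycle_subG (subsetP nKG).
  have coKy: coprime #|K| #|<[y]>|.
    by apply: coprimeSg sKL (coprimegS _ coLQ); rewrite cycle_subG.
  apply/eqP; rewrite eqEsubset mul_subG ?subsetIl //=.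
  rewrite -{1}(coprime_commg_cent_mulG nKy coKy (solvableS sKL solL)).
  rewrite cent_cycle mulSg // (subset_trans _ sLG_L') // commgSS //.
  by rewrite cycle_subG.
have nsNG: N <| G.
  rewrite /normal subIset ?sKG //=.
  apply/subsetP=> h Gh; rewrite inE; apply/subsetP=> _ /imsetP[n /setIP[Kn cyn] ->].
  have Knh: n ^ h \in K by rewrite memJ_norm ?(subsetP nKG).
  rewrite inE Knh; apply/cent1P.
  have defy: y = y ^ h * [~ y, h]^-1 by rewrite commgEl invMg invgK mulKVg.
  have c1: commute (n ^ h) (y ^ h).
    by rewrite /commute -!conjMg (cent1P cyn).
  have c2: commute (n ^ h) [~ y, h]^-1.
    by apply: (centsP cVK); rewrite ?groupV ?comV.
  by rewrite {1}defy; apply: commuteM.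
have cGN: N \subset 'C(G).
  apply/commG1P/trivgP; rewrite -tiVN subsetI commg_subl normal_norm // andbT.
  by rewrite (subset_trans _ sLG_L') // commSg // subIset ?sKL.
have fpfG g: g \in G -> g \notin 'C(V) -> fpf_on K N g.
  move=> Gg ncVg z; rewrite -{1}defK => /mulsgP[v n Vv Nn ->].
  have -> : [~ v * n, g] = [~ v, g].
    have cNG h: h \in G -> commute n h by apply: (centsP cGN).
    rewrite commMgJ; have /eqP->: [~ n, g] == 1 by apply/commgP/cNG.
    rewrite mulg1; apply/conjg_fixP/commgP/commute_sym/cNG.
    by rewrite (subsetP sLG) ?(subsetP sVL) // comV // (subsetP sLG) ?(subsetP sVL).
  move=> Nvg; have: [~ v, g] \in V :&: N by rewrite inE Nvg comV // (subsetP sLG) ?(subsetP sVL).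
  rewrite tiVN => /set1gP/eqP/commgP/cent1P cvg.
  suffices: v \in 'C_V[g] by rewrite fixV // => /set1gP->; rewrite mul1g.
  by rewrite inE Vv cvg.
exists s, K, N, y; split; [split | split; [split|split]] => //.
- by have := quotientMidr N V; rewrite defK => ->; apply: quotient_abelem.
- rewrite properEneq sKL andbT; apply/eqP=> eqKL.
  case/negP: ntV; apply/eqP/derG1P; rewrite -eqKL -defK abelianM cVV.
  have cNG (H : {group gT}) : H \subset G -> N \subset 'C(H) by move=> sHG; rewrite (subset_trans cGN) ?centS.
  by rewrite /abelian !cNG ?(subset_trans sVL sLG) ?normal_sub.
- rewrite properEneq subsetIl andbT; apply: contra ntV => /eqP eqNK.
  by rewrite -subG1 -tiVN subsetI subxx eqNK.
- by rewrite (mem_p_elt qQ).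
- move=> x /setDP[Lx nKx]; apply: fpfG; first exact: (subsetP sLG).
  by apply: contra nKx => cVx; rewrite inE Lx.
exact: fpfG.
Qed.

Lemma fpf_on_cosetpre (gT : finGroupType) (X : {group gT}) 
    (K N : {group coset_of X}) (x : gT) :
  x \in 'N(X) -> fpf_on K N (coset X x) ->
  fpf_on (coset X @*^-1 K) (coset X @*^-1 N) x.
Proof.
move=> nXx fpfx z /morphpreP[nXz Kz] /morphpreP[_ Nzx].
by rewrite mem_morphpre //; apply: fpfx; rewrite -?morphR.
Qed.

(** Factoring out a largest X normal in G and properly inside L' makes the image of L' minimal
    normal. If a Sylow q-subgroup of G / X centralised L / X, the nonlinear characters of L / X
    would be invariant in G, against the last hypothesis. *)
Lemma exists_fpf_section (gT : finGroupType) (G L : {group gT}) (q : nat) :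
    solvable L -> L <| G -> q^'.-Hall(G) L -> abelian (G / L) ->
    [~: L, G] \subset L^`(1) -> ~~ abelian L ->
    (forall j : Iirr L, ('chi_j)%R \isn't a linear_char ->
       ~~ (G \subset 'I[('chi_j)%R])) ->
  exists s (K N : {group gT}) (y : gT),
    [/\ prime s, K <| G, N <| G & s.-abelem (K / N)] /\
    [/\ L^`(1) \subset K, K \proper L, N \proper K & y \in G /\ q.-elt y] /\
    [/\ {in L :\: K, forall x, fpf_on K N x} & fpf_on K N y].
Proof.
move=> solL nsLG hallL cGL sLG_L' ncLL ninv; have [sLG nLG] := andP nsLG.
have ntL': L^`(1) != 1 by apply: contra ncLL => /eqP/derG1P.
have nsL'G: L^`(1) <| G by apply: gFnormal_trans.
have [|X maxX _] := @maxgroup_exists _ [pred M : {group gT} | M \proper L^`(1) & G \subset 'N(M)] 1%G.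
  by rewrite /= proper1G ntL' norms1.
have chiefX: chief_factor G X L^`(1) by rewrite /chief_factor nsL'G andbT.
have minV := chief_factor_minnormal chiefX.
have /andP[prXL' nXG] := maxgroupp maxX.
have sXL': X \subset L^`(1) := proper_sub prXL'.
have sXL: X \subset L := subset_trans sXL' (der_sub 1 L).
have nsXG: X <| G by rewrite /normal nXG (subset_trans sXL).
have nsXL: X <| L := normalS sXL sLG nsXG.
have nXL := normal_norm nsXL.
rewrite quotient_der // in minV.
have [|||||||s [K [N [y]]]] := @minnormal_der1_section _ (G / X)%G (L / X)%G q.
- exact: quotient_sol.
- exact: quotient_normal.
- exact: quotient_pHall.
- by rewrite (isog_abelian (third_isog sXL nsXG nsLG)).
- by rewrite -quotientR // -quotient_der // quotientS.
- exact: minV.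
- move=> Q sylQ; apply/negP=> cLQ.
  have ncLX: ~~ abelian (L / X).
    by rewrite /abelian quotient_cents2 //; apply: proper_subn prXL'.
  have [i nlin_i]: exists i : Iirr (L / X), ('chi_i)%R \isn't a linear_char.
    apply/existsP; apply: contraR ncLX; rewrite negb_exists => /forallP lin.
    by apply/char_abelianP=> i; have:= lin i; rewrite negbK.
  have: ('chi_(mod_Iirr i))%R \isn't a linear_char.
    by rewrite mod_IirrE // cfMod_lin_charE.
  move/ninv/negP; case; rewrite mod_IirrE //.
  apply: (subset_trans _ (subsetIr G _)); rewrite inertia_mod_pre //.
  rewrite subsetI subxx -sub_quotient_pre // subsetI subxx /=.
  have nLGX: G / X \subset 'N(L / X) by rewrite quotient_norms.
  have <-: (L / X) * Q = G / X.
    by apply: normal_Hall_mulG sylQ; rewrite ?quotient_normal ?quotient_pHall.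
  by rewrite mul_subG ?sub_inertia // (subset_trans cLQ) // cent_sub_inertia.
case=> [[pr_s nsKG nsNG abelKN] [[sL'K prKL prNK [Gy qy]] [fpfL fpfy]]].
have [sKG _] := andP nsKG; have [sNG _] := andP nsNG.
have defG: coset X @*^-1 (G / X) = G by rewrite quotientGK.
have defL: coset X @*^-1 (L / X) = L by rewrite quotientGK.
have [y0 nXy0 Gy0 def_y] := morphimP Gy.
(* The lift y0 need not be a q-element; its q-part has the same image. *)
exists s, (coset X @*^-1 K)%G, (coset X @*^-1 N)%G, (y0.`_q).
split; [split | split; [split|split]] => //=.
- by rewrite -[X in _ <| X]defG cosetpre_normal.
- by rewrite -[X in _ <| X]defG cosetpre_normal.
- have sNK: N \subset K := proper_sub prNK.
  set K1 := (coset X @*^-1 K)%G; set N1 := (coset X @*^-1 N)%G.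
  have nsNK: N1 <| K1 by rewrite cosetpre_normal (normalS sNK sKG).
  have nsXK: X <| K1.
    by rewrite /normal sub_cosetpre (subset_trans _ nXG) // -defG cosetpreSK.
  rewrite -(isog_abelem (third_isog (sub_cosetpre N) nsXK nsNK)).
  by rewrite /= !cosetpreK.
- by rewrite -sub_quotient_pre ?(subset_trans (der_sub 1 L)) // quotient_der.
- by rewrite -defL cosetpre_proper.
- by rewrite cosetpre_proper.
- by rewrite groupX // p_elt_constt.
- move=> x /setDP[Lx nKx]; have nXx := subsetP nXL x Lx.
  apply: fpf_on_cosetpre => //; apply: fpfL; rewrite inE mem_quotient // andbT.
  by apply: contra nKx => Kx; rewrite mem_morphpre.
apply: fpf_on_cosetpre; first by rewrite groupX.
by rewrite /= morph_constt // -def_y constt_p_elt.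
Qed.

End ChiefSections.

(** * Induction and extension of characters *)

Section CharacterExtension.
Set Implicit Arguments.
Unset Strict Implicit.
Unset Printing Implicit Defensive.
Import Order.TTheory GroupScope GRing.Theory Num.Theory.
Local Open Scope ring_scope.

(** The map z |-> [z, x] is injective on the finite group K / N, hence onto: modulo N every element
    is a commutator [z, x], where an x-invariant linear character takes the value 1. *)
Lemma fpf_on_lin_char (gT : finGroupType) (K N : {group gT}) (x : gT)
    (lam : 'CF(K)) :
    N <| K -> abelian (K / N) -> x \in 'N(K) -> x \in 'N(N) -> fpf_on K N x ->
    lam \is a linear_char -> N \subset cfker lam -> x \in 'I[lam] -> lam = 1.
Proof.
move=> nsNK cKN nKx nNx fpfx lin_lam sN_lam Ix.
have [sNK nNK] := andP nsNK; pose f (z : coset_of N) := [~ z, coset N x].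
have KNx z: z \in (K / N)%g -> (z ^ coset N x)%g \in (K / N)%g.
  case/morphimP=> w Nw Kw ->; rewrite -morphJ // mem_quotient //.
  by rewrite memJ_norm.
have fpf1 z: z \in (K / N)%g -> f z = 1%g -> z = 1%g.
  case/morphimP=> w Nw Kw -> /eqP; rewrite /f -morphR //= => /eqP/coset_idr Nwx.
  by apply/coset_id/fpfx/Nwx => //; rewrite groupR.
have f_inj: {in (K / N)%g &, injective f}.
  move=> z w Kz Kw; rewrite /f !commgEl => eq_zw; apply/eqP; rewrite eq_mulgV1.
  have Kzw: (z * w^-1)%g \in (K / N)%g by rewrite groupM ?groupV.
  apply/eqP/fpf1 => //; rewrite /f commgEl conjMg conjVg invMg invgK.
  have [Kzx Kwx] := (KNx z Kz, KNx w Kw).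
  rewrite -mulgA (mulgA z^-1%g) eq_zw -mulgA mulgV mulg1 mulgV //.
have f_onto: [set f z | z in (K / N)%g] = (K / N)%g.
  apply/eqP; rewrite eqEcard (card_in_imset f_inj) leqnn andbT.
  by apply/subsetP=> _ /imsetP[z Kz ->]; rewrite /f commgEl groupM ?groupV ?KNx.
apply/cfun_inP=> w Kw; rewrite cfun1E Kw.
have: coset N w \in [set f z | z in (K / N)%g] by rewrite f_onto mem_quotient.
case/imsetP=> _ /morphimP[z Nz Kz ->]; rewrite /f -morphR //= => eq_w.
have Kzx: (z ^ x)%g \in K by rewrite memJ_norm.
have Kczx: [~ z, x] \in K by rewrite commgEl groupM ?groupV.
have lam_w v: v \in K -> lam v = (lam / N)%CF (coset N v).
  by move=> Kv; rewrite cfQuoE.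
rewrite lam_w // eq_w -lam_w // commgEl lin_charM ?groupV //.
by rewrite (inertia_valJ _ Ix) lin_charV // mulVf ?lin_char_neq0.
Qed.

(* A twist [lam * theta] with inertia group [K] exists: otherwise some [x]
   fixes [theta] and some [x'] fixes [lam * theta] with [lam != 1]; as [x] and
   [x'] commute modulo [K], [x] fixes [lam / lam ^ x'], so that [lam = 1]. *)
Lemma deg_fpf_index (gT : finGroupType) (L K N : {group gT}) (s : nat)
    (t : Iirr K) :
    prime s -> K <| L -> N <| L -> N \proper K -> s.-abelem (K / N) ->
    (L^`(1) \subset K)%g -> {in L :\: K, forall x, fpf_on K N x} ->
    ~~ (s %| deg t)%N ->
  exists i : Iirr L, deg i = (#|L : K| * deg t)%N.
Proof.
move=> pr_s nsKL nsNL prNK abelKN sL'K fpfL s't.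
have [[sKL nKL] [_ nNL]] := (andP nsKL, andP nsNL).
have nsNK: N <| K := normalS (proper_sub prNK) sKL nsNL.
have cKN := abelem_abelian abelKN.
pose Lam := [pred lam : 'CF(K) | (lam \is a linear_char) && (N \subset cfker lam)].
have LamJ lam x: Lam lam -> x \in L -> Lam (lam ^ x)%CF.
  case/andP=> lin_lam sNl Lx; rewrite /= cfConjg_lin_char //=.
  have [nKx nNx] := (subsetP nKL x Lx, subsetP nNL x Lx).
  by rewrite cfker_conjg // -(normP nNx) conjSg.
have LamV lam mu: Lam lam -> Lam mu -> Lam (lam / mu).
  case/andP=> lin_l sNl /andP[lin_m sNm]; rewrite /= rpred_div //=.
  apply/subsetP=> z Nz; have Kz := subsetP (normal_sub nsNK) z Nz.
  rewrite cfkerEchar ?lin_charW ?rpred_div // inE Kz invr_lin_char // !cfunE.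
  by rewrite (cfker1 (subsetP sNl z Nz)) (cfker1 (subsetP sNm z Nz)) eqxx.
have fix1 lam x: Lam lam -> x \in L :\: K -> x \in 'I[lam] -> lam = 1.
  case/andP=> lin_l sNl LKx Ix; have [Lx _] := setDP LKx.
  have [nKx nNx] := (subsetP nKL x Lx, subsetP nNL x Lx).
  exact: (fpf_on_lin_char nsNK cKN nKx nNx (fpfL x LKx) lin_l sNl Ix).
have Lam_s lam: Lam lam -> lam ^+ s = 1.
  case/andP=> lin_l sNl; apply/cfun_inP=> z Kz; rewrite cfun1E Kz.
  have Nzs: (z ^+ s)%g \in N.
    have [nNz KNz] := (subsetP (normal_norm nsNK) z Kz, mem_quotient N Kz).
    apply: coset_idr; first exact: groupX.
    by rewrite morphX //; case/abelemP: abelKN => // _ ->.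
  by rewrite exp_cfunE // -lin_charX // (cfker1 (subsetP sNl _ Nzs)) lin_char1.
(* Determinants tell twists apart: if two agree, the order of lam / mu divides deg t as well as s,
   and these are coprime. *)
have twist_inj lam mu: Lam lam -> Lam mu -> lam * 'chi_t = mu * 'chi_t -> lam = mu.
  move=> Ll Lm eq_lm; have [[lin_l _] [lin_m _]] := (andP Ll, andP Lm).
  have:= congr1 (fun phi => cfDet phi) eq_lm; rewrite !cfDet_mul_lin ?irr_char // -/(deg t).
  have Ut := lin_char_unitr (cfDet_lin_char 'chi_t); move/(mulIr Ut) => eq_deg.
  have Um := lin_char_unitr lin_m.
  pose nu : 'CF(K) := lam / mu.
  suffices: nu == 1 by move/eqP/divr1_eq.
  have Lnu: Lam nu := LamV lam mu Ll Lm.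
  have ds: (#[nu]%CF %| s)%N by rewrite dvdn_cforder Lam_s.
  have dt: (#[nu]%CF %| deg t)%N.
    by rewrite dvdn_cforder /nu expr_div_n eq_deg divrr ?unitrX.
  have: (#[nu]%CF %| gcdn s (deg t))%N by rewrite dvdn_gcd ds.
  by rewrite (eqP (_ : coprime s (deg t))) ?prime_coprime // dvdn_cforder expr1.
pose twist (b : Iirr (K / N)) := 'chi_(mod_Iirr b) * 'chi_t.
have LamI (b : Iirr (K / N)): Lam 'chi_(mod_Iirr b : Iirr K).
  have /char_abelianP/(_ b) lin_b: abelian (K / N)%G by [].
  by rewrite /= mod_IirrE // cfMod_lin_charE // lin_b cfker_mod.
have irr_twist b: twist b \in irr K.
  by rewrite mul_lin_irr ?mem_irr //; case/andP: (LamI b).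
have [/existsP[b Ib] | ] := boolP [exists b, 'I_L[twist b] \subset K].
  have /irrP[j def_j] := irr_twist b.
  have: 'Ind[L] (twist b) \in irr L.
    by rewrite def_j Ind_irr_inertia_sub // -def_j.
  case/irrP=> i def_i; exists i; apply: eq_deg; rewrite -def_i cfInd1 // natrM.
  rewrite cfunE -degE; have /andP[lin_b _] := LamI b.
  by rewrite (lin_char1 lin_b) mul1r.
rewrite negb_exists => /forallP noK.
have fix_out b: exists2 x, x \in L :\: K & x \in 'I[twist b].
  by have /subsetPn[x /setIP[Lx Ix] nKx] := noK b; exists x; rewrite // inE nKx.
have [x LKx] := fix_out 0; have [Lx nKx] := setDP LKx.
rewrite /twist mod_Iirr0 irr0 mul1r => Ix.
have [|b nz_b] := @has_nonprincipal_irr _ (K / N)%G.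
  by rewrite /= -subG1 quotient_sub1 ?normal_norm // proper_subn.
have [x' LKx' Ix'] := fix_out b; have [Lx' _] := setDP LKx'.
set lam := 'chi_(mod_Iirr b) in Ix'; have Ll: Lam lam := LamI b.
case/eqP: nz_b; apply: (can_inj (mod_IirrK nsNK)); apply: irr_inj.
rewrite mod_Iirr0 irr0; apply: (fix1 _ x') => //; rewrite -/lam.
have [Nx Nx'] := (subsetP nKL x Lx, subsetP nKL x' Lx').
have Llx' := LamJ lam x' Ll Lx'; have [lin_lx' _] := andP Llx'.
have Ulx' := lin_char_unitr lin_lx'.
pose mu := lam / (lam ^ x')%CF; have Lmu: Lam mu := LamV _ _ Ll Llx'.
have def_tx': ('chi_t ^ x')%CF = mu * 'chi_t.
  have := inertiaJ Ix'; rewrite /twist -/lam rmorphM /= => eq_lt.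
  by rewrite /mu mulrAC -eq_lt mulrC mulKr.
(* As x fixes 'chi_t and x', x commute modulo K, transforming 'chi_t by x' and then x gives the same
   as by x' alone: mu^x and mu give the same twist of 'chi_t, so x fixes mu. *)
have mu1: mu = 1.
  apply: (fix1 mu x) => //; rewrite inE Nx /=; apply/eqP.
  apply: (twist_inj _ _ (LamJ mu x Lmu Lx) Lmu).
  rewrite -def_tx' -{1}(inertiaJ Ix) -rmorphM /= -def_tx'.
  rewrite -(cfConjgMnorm _ Nx' Nx) (commgC x' x).
  have Kc: [~ x', x] \in K.
    by rewrite (subsetP sL'K) // mem_commg.
  have Nc := subsetP (normG K) _ Kc.
  rewrite (cfConjgMnorm _ (groupM Nx Nx') Nc) (cfConjgMnorm _ Nx Nx').
  by rewrite (inertiaJ Ix) (cfConjg_id _ Kc).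
by rewrite inE Nx' /=; apply/eqP/esym/divr1_eq.
Qed.

Lemma lin_char_of_morph (gT : finGroupType) (G : {group gT}) (f : gT -> algC) :
    f 1%g = 1 -> {in G &, {morph f : x y / (x * y)%g >-> x * y}} ->
  exists2 i : Iirr G, 'chi_i \is a linear_char & {in G, 'chi_i =1 f}.
Proof.
move=> f1 fM.
have f_repr: mx_repr G (fun x => (f x)%:M : 'M_1).
  by split=> [|x y Gx Gy]; rewrite ?f1 // fM // scalar_mxM.
pose rG := MxRepresentation f_repr.
have f_char: cfRepr rG \is a character := cfRepr_char rG.
have lin_f: cfRepr rG \is a linear_char.
  by rewrite qualifE /= f_char cfRepr1 eqxx.
have /irrP[i def_i] := lin_char_irr lin_f; exists i; rewrite -?def_i // => x Gx.
by rewrite cfunE Gx mulr1n /= mxtrace_scalar.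
Qed.

(** Extend by the value 1 on H; this is multiplicative because H fixes the character. *)
Lemma lin_char_extend_sdprod (gT : finGroupType) (T V H : {group gT}) (j : Iirr V) :
    V ><| H = T -> 'chi_j \is a linear_char -> H \subset 'I['chi_j] ->
  exists2 c : Iirr T, 'chi_c \is a linear_char & 'Res[V] 'chi_c = 'chi_j.
Proof.
move=> defT lin_j sHI; have [_ defVH nVH tiVH] := sdprodP defT.
have [||c lin_c cE] := @lin_char_of_morph _ T (fun x => 'chi_j (divgr V H x)).
- by rewrite divgr_id ?lin_char1.
- rewrite -defVH => _ _ /mulsgP[v h Vv Hh ->] /mulsgP[w k Vw Hk ->].
  have nVh := subsetP nVH h Hh.
  have Vwh: (w ^ h^-1)%g \in V by rewrite memJ_norm ?groupV.
  have -> : (v * h * (w * k) = v * w ^ h^-1 * (h * k))%g.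
    by rewrite conjgE invgK !mulgA mulgKV.
  rewrite !divgrMid ?(groupM Vv Vwh) ?(groupM Hh Hk) // (lin_charM lin_j) //.
  congr (_ * _).
  by rewrite inertia_valJ // groupV (subsetP sHI).
exists c => //; apply/cfun_inP=> v Vv.
have sVT: V \subset T by case/sdprod_context: defT => /andP[].
by rewrite cfResE // cE ?(subsetP sVT) // divgr_id.
Qed.

Lemma inertia_commg_cfker (gT : finGroupType) (V A : {group gT}) (lam : 'CF(V)) :
  lam \is a linear_char -> A \subset 'I[lam] -> [~: V, A] \subset cfker lam.
Proof.
move=> lin_lam sAI; have nVA := subset_trans sAI (norm_inertia lam).
rewrite gen_subG; apply/subsetP=> _ /imset2P[v x Vv Ax ->].
have Vvx: (v ^ x)%g \in V by rewrite memJ_norm ?(subsetP nVA).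
have Vc: [~ v, x] \in V by rewrite commgEl groupM ?groupV.
rewrite /= (cfkerEchar (lin_charW lin_lam)) inE Vc lin_char1 // commgEl.
rewrite (lin_charM lin_lam) ?groupV //.
by rewrite (inertia_valJ _ (subsetP sAI x Ax)) lin_charV // mulVf ?lin_char_neq0 ?eqxx.
Qed.

(** Coordinates for the characters of V: u stands for the character sending v to w^(v.u), with w a
    primitive l-th root of unity. X acts by inverse transposes, so that vectors transform as the
    characters do. *)
Lemma dual_abelem_repr (gT : finGroupType) (l : nat) (V X : {group gT}) :
    l.-abelem V -> V :!=: 1%g -> X \subset 'N(V) ->
  exists n (rX : mx_representation 'F_l X n.+1) (lam : 'rV['F_l]_n.+1 -> Iirr V),
  [/\ injective lam, lam 0 = 0,
      {in X, forall x u, 'chi_(lam (u *m rX x)) = ('chi_(lam u) ^ x)%CF}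
    & {in X, forall x, rX x = 1%:M -> x \in 'C(V)}].
Proof.
move=> abelV ntV nVX.
have [pr_l _ _] := pgroup_pdiv (abelem_pgroup abelV) ntV.
pose rV := abelem_rV abelV ntV; pose rX0 := abelem_repr abelV ntV nVX.
have dual_repr: mx_repr X (fun x => (rX0 x^-1%g)^T).
  split=> [|x y Xx Xy]; first by rewrite invg1 repr_mx1 trmx1.
  by rewrite invMg repr_mxM ?groupV // trmx_mul.
have [w prim_w] := C_prim_root_exists (prime_gt0 pr_l).
pose eps (a : 'F_l) := w ^+ a.
(* The additive structure of 'F_l is that of residues modulo [pdiv l]; primality turns this into l,
   the order of w. *)
have defFl: (Zp_trunc (pdiv l)).+2 = l := Fp_cast pr_l.
have ltFl (a : 'F_l): (a < l)%N by apply: leq_trans (ltn_ord a) _; rewrite defFl.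
have modFl c: (c %% (Zp_trunc (pdiv l)).+2 = c %% l)%N by rewrite defFl.
have epsD a b: eps (a + b) = eps a * eps b.
  rewrite /eps -exprD -(prim_expr_mod prim_w (a + b)%N); congr (w ^+ _).
  exact: modFl.
have eps_inj: injective eps.
  move=> a b /eqP; rewrite (eq_prim_root_expr prim_w) !modn_small // => /eqP.
  exact: val_inj.
have [f fE]: {f : 'rV_('dim V) -> gT -> algC |
    forall u v, f u v = eps ((rV v *m u^T) 0 0)}.
  by exists (fun u v => eps ((rV v *m u^T) 0 0)).
have ex_lam u: exists i, 'chi[V]_i \is a linear_char /\ [forall v in V, 'chi_i v == f u v].
  have [||i lin_i iE] := @lin_char_of_morph _ V (f u).
  - by rewrite fE /rV morph1 mul0mx mxE /eps expr0.
  - move=> v v' Vv Vv'; rewrite !fE /rV abelem_rV_M // mulmxDl mxE epsD //.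
  by exists i; split=> //; apply/forall_inP=> v Vv; rewrite iE.
have ex_lam' u: exists i, [forall v in V, 'chi[V]_i v == f u v].
  by have [i [_ iE]] := ex_lam u; exists i.
pose lam u := xchoose (ex_lam' u).
have lamE u v: v \in V -> 'chi_(lam u) v = f u v.
  by move=> Vv; apply/eqP/(forall_inP (xchooseP (ex_lam' u))).
pose rX := MxRepresentation dual_repr.
have rXE x: rX x = (rX0 x^-1%g)^T by [].
exists _, rX, lam; split.
- move=> u u' eq_uu'; apply: trmx_inj; apply/matrixP=> i j; rewrite ord1.
  have eqf v: v \in V -> f u v = f u' v by move=> Vv; rewrite -!lamE // eq_uu'.
  have := eqf _ (mem_rVabelem abelV ntV (delta_mx 0 i)).
  by rewrite !fE /rV rVabelemK => /eps_inj; rewrite -!rowE !mxE.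
- apply: irr_inj; apply/cfun_inP=> v Vv; rewrite irr0 cfun1E Vv (lamE 0) //.
  by rewrite fE trmx0 mulmx0 mxE /eps expr0.
- move=> x Xx u; apply/cfun_inP=> v Vv; have nVx := subsetP nVX x Xx.
  have Vvx: (v ^ x^-1)%g \in V by rewrite memJ_norm ?groupV.
  rewrite cfConjgE // (lamE u) // (lamE (u *m rX x)) // !fE rXE trmx_mul trmxK mulmxA.
  by rewrite /rV (abelem_rV_J abelV ntV nVX) ?groupV.
move=> x Xx; rewrite rXE => /(congr1 trmx); rewrite trmxK trmx1 => x1.
have: x^-1%g \in rker rX0 by rewrite inE groupV Xx x1 mulmx1 eqxx.
by rewrite rker_abelem inE groupV => /andP[_]; rewrite groupV.
Qed.

End CharacterExtension.

(** * The normal Sylow subgroup *)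

Section MinimalCounterexample.
Set Implicit Arguments.
Unset Strict Implicit.
Unset Printing Implicit Defensive.
Import Order.TTheory GRing.Theory Num.Theory.
Local Open Scope ring_scope.
Local Open Scope group_scope.

Lemma deg_le_index_abelian (gT : finGroupType) (G A : {group gT}) (i : Iirr G) :
  A \subset G -> abelian A -> (deg i <= #|G : A|)%N.
Proof.
move=> sAG /char_abelianP cAA; have [j jAi] := constt_cfRes_irr A i.
rewrite -constt_Ind_Res in jAi.
have [chi Nchi def_ind] := constt_charP i (cfInd_char G (irr_char j)) jAi.
have := congr1 (fun phi : 'CF(G) => phi 1%g) def_ind; rewrite /= cfInd1 // cfunE.
rewrite (lin_char1 (cAA j)) mulr1 degE => def_n.
by rewrite -(ler_nat algC) def_n lerDl char1_ge0.
Qed.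

Lemma invariant_lin_char_trivial (gT : finGroupType) (V S : {group gT}) (j : Iirr V) :
    abelian V -> S \subset 'N(V) -> coprime #|V| #|S| -> 'C_V(S) = 1 ->
    S \subset 'I[('chi_j)%R] -> j = 0%R.
Proof.
move=> cVV nVS coVS regVS sSI; apply/eqP; rewrite -subGcfker.
have lin_j: ('chi_j)%R \is a linear_char by move/char_abelianP: cVV.
rewrite -{1}(coprime_commg_cent_mulG nVS coVS (abelian_sol cVV)) regVS mulg1.
exact: inertia_commg_cfker.
Qed.

Section Core.
Variables (gT : finGroupType) (G L K V N : {group gT}) (p r q a : nat) (y0 : gT).
Hypotheses (pr_p : prime p) (pr_r : prime r) (neq_rp : r != p) 
  (neq_qp : q != p) (neq_qr : q != r).
Hypotheses (nsVG : V <| G) (nsKG : K <| G) (nsLG : L <| G) (nsNG : N <| G).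
Hypotheses (sVN : V \subset N) (sKL : K \subset L) (prNK : N \proper K) (prKL : K \proper L).
Hypotheses (minV : minnormal V G) (cVV : abelian V) (p'V : p^'.-group V)
  (pKV : p.-group (K / V)) (regVK : 'C_V(K) = 1).
Hypotheses (sG'K : G^`(1) \subset K) (p'GK : p^'.-group (G / K))
  (rLK : r.-group (L / K)) (cKN : abelian (K / N)).
Hypotheses (degK : forall t : Iirr K, deg t != 1%N -> deg t = (p ^ a)%N)
  (degL : forall i : Iirr L, (p %| deg i)%N -> deg i = (p ^ a)%N) (a_gt0 : (0 < a)%N).
Hypotheses (fpfL : {in L :\: K, forall x, fpf_on K N x})
  (Gy0 : y0 \in G) (qy0 : q.-elt y0) (fpfy0 : fpf_on K N y0).
Hypothesis noPN : forall W : {group gT}, W <| G -> W \subset N -> p.-group W -> W :=: 1.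

(* Every nontrivial character of [V] is fixed by an [S]-conjugate of [R], with [S] a
   Sylow [p]-subgroup of [K] and [R] a complement to [S] in [N_L(S)]; comparing
   degrees, [S] acts faithfully on [V] and is abelian. Then [[S, R]] acts irreducibly
   on the dual of [V], contrary to [cyclic_irr_fixed_trivial]. *)
Lemma noncentral_core_false : False.
Proof.
have sKG := normal_sub nsKG; have sLG := normal_sub nsLG.
have sNK := proper_sub prNK; have sVK := subset_trans sVN sNK.
have nsVK : V <| K := normalS sVK sKG nsVG.
have ntV: V :!=: 1 by case/mingroupP: (minV) => /andP[].
have hallV: p^'.-Hall(K) V.
  by rewrite /pHall sVK p'V pnatNK -card_quotient ?normal_norm.
have [S sylS] := Sylow_exists p K; have [sSK pS _] := and3P sylS.
have defK: V * S = K := normal_Hall_mulG nsVK hallV sylS.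
have coVS: coprime #|V| #|S| by rewrite coprime_sym (pnat_coprime pS).
have tiVS: V :&: S = 1 by apply: coprime_TIg.
have [nVG nVK] := (normal_norm nsVG, normal_norm nsVK).
have nVS := subset_trans sSK nVK.
have regVS: 'C_V(S) = 1.
  apply/trivgP; rewrite -regVK subsetI subsetIl -defK centM subsetI.
  by rewrite (subset_trans (subsetIl _ _) cVV) subsetIr.
pose X := 'N_G(S)%G.
have sSG := subset_trans sSK sKG; have sVG := normal_sub nsVG.
have sSX: S \subset X by rewrite subsetI sSG normG.
have nsSX: S <| X by rewrite /normal sSX subsetIr.
have sXG: X \subset G := subsetIl _ _.
have nVX: X \subset 'N(V) := subset_trans sXG nVG.
have defG: V * X = G.
  rewrite -(Frattini_arg nsKG sylS) -defK -mulgA; congr (_ * _).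
  by rewrite mulSGid.
have tiVX: V :&: X = 1.
  apply/trivgP; rewrite -regVS subsetI subsetIl /=.
  apply/commG1P/trivgP; rewrite -tiVS subsetI; apply/andP; split.
    by apply: subset_trans (commSg S (subsetIl V X)) _; rewrite commg_subl.
  apply: subset_trans (commSg S (subsetIr V X)) _.
  by rewrite commg_subr subsetIr.
have tiXK: X :&: K = S.
  by rewrite -defK -group_modr // setIC tiVX mul1g.
have oGK: #|X : S| = #|G : K|.
  by rewrite -!divgS // -defG -defK !TI_cardMg // divnMl.
have hallS: Hall X S.
  rewrite /Hall sSX oGK (pnat_coprime pS) //.
  by rewrite -card_quotient ?normal_norm.
(* Y complements K in G, and is abelian because its derived subgroup lies in G' and hence in K. Its
   part R in L complements K in L. *)
have [Y complY] := splitsP (SchurZassenhaus_split hallS nsSX).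
have defX: S ><| Y = X.
  have [tiSY defSY] := complP complY; rewrite sdprodE //.
  by rewrite (subset_trans _ (normal_norm nsSX)) // -defSY mulG_subr.
have [_ defSY nSY tiSY] := sdprodP defX.
have sYX: Y \subset X by rewrite -defSY mulG_subr.
have sYG := subset_trans sYX sXG.
have tiYK: Y :&: K = 1.
  by rewrite -(setIidPl sYX) -setIA tiXK setIC.
have cYY: abelian Y.
  apply/commG1P/trivgP; rewrite -tiYK subsetI commg_subl normG /=.
  by apply: subset_trans sG'K; apply: commgSS.
have defKY: K * Y = G by rewrite -defK -mulgA defSY.
pose R := (Y :&: L)%G.
have sRY: R \subset Y := subsetIl _ _; have sRL: R \subset L := subsetIr _ _.
have defKR: K * R = L by rewrite group_modl // defKY (setIidPr sLG).
have tiRK: R :&: K = 1 by apply/trivgP; rewrite -tiYK setSI.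
have nKR: R \subset 'N(K) by rewrite (subset_trans _ (normal_norm nsKG)) // (subset_trans sRY).
have rR: r.-group R.
  rewrite /pgroup (card_isog (quotient_isog nKR _)) 1?setIC //; apply: pgroupS rLK.
  exact: quotientS.
have ntR: R :!=: 1.
  by apply: contraTneq prKL => R1; rewrite -defKR R1 mulg1 properxx.
(* Passing to the Y-component of y0 leaves the action on the abelian group K / N unchanged, and
   gains commutation with R. *)
have [y Yy [qy fpfy]]: exists2 y, y \in Y & q.-elt y /\ fpf_on K N y.
  have: y0 \in K * Y by rewrite defKY.
  case/mulsgP=> k y Kk Yy def_y0; exists y => //; split.
    have nKy := subsetP (normal_norm nsKG) y (subsetP sYG y Yy).
    have nKk := subsetP (normG K) k Kk.
    have eq_yy0: coset K y0 = coset K y by rewrite def_y0 morphM //= (coset_id Kk) mul1g.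
    have qc: q.-nat #[coset K y] by rewrite -eq_yy0; apply: morph_p_elt qy0; rewrite def_y0 groupM.
    apply: pnat_dvd qc; rewrite order_dvdn; apply/eqP/set1gP; rewrite -tiYK inE groupX //=.
    by apply: coset_idr; rewrite ?groupX // morphX // expg_order.
  move=> z Kz Nzy; have Gz := subsetP sKG z Kz; have nNG := normal_norm nsNG.
  have def_y: y = k^-1 * y0 by rewrite def_y0 mulKg.
  have Nzk: [~ z, k^-1] ^ y0 \in N.
    rewrite memJ_norm ?(subsetP nNG) //.
    have: [~: K, K] \subset N.
      by rewrite -quotient_cents2 ?(subset_trans sKG nNG).
    by move/subsetP; apply; rewrite mem_commg ?groupV.
  apply: fpfy0 => //; rewrite -(groupMr _ Nzk) -commgMJ -?def_y //.
have fpfR x: x \in R^# -> fpf_on K N x.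
  case/setD1P=> ntx Rx; apply: fpfL; rewrite inE (subsetP sRL) // andbT.
  by apply: contra ntx => Kx; rewrite -in_set1 -[[set 1]]tiRK inE Rx.
have [_ _ /is_abelemP[l pr_l abelV]] := minnormal_solvable minV (subxx V) (abelian_sol cVV).
have neq_l_p: l != p.
  have [_ l_dv _] := pgroup_pdiv (abelem_pgroup abelV) ntV.
  exact: (pgroupP p'V).
have [n [rX [lam [lam_inj lam0 lamJ ffulX]]]] := dual_abelem_repr abelV ntV nVX.
have lam_nz u: u != 0%R -> lam u != 0%R by rewrite -lam0 (inj_eq lam_inj).
have coSR: coprime #|S| #|R|.
  by rewrite (pnat_coprime pS) // (pi_pnat rR) // inE.
have lin_lam u: ('chi_(lam u))%R \is a linear_char by move/char_abelianP: cVV.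
(* A linear t would restrict to an S-invariant character of V, which is trivial since C_V(S) = 1. *)
have nlinK u (t : Iirr K) : u != 0%R -> t \in irr_constt ('Ind[K] 'chi_(lam u))%R ->
    deg t = (p ^ a)%N.
  move=> nzu tu; apply: degK; apply: contra (lam_nz u nzu) => lin_t.
  apply/eqP/(invariant_lin_char_trivial cVV nVS coVS regVS).
  rewrite constt_Ind_Res in tu.
  have dt: deg t = deg (lam u).
    by rewrite (eqP lin_t); apply/esym/eqP; rewrite -lin_deg.
  have <- := constt_Res_eq_deg sVK tu dt.
  have sIS: S \subset 'I_S[('chi_t)%R].
    by rewrite subsetI subxx (subset_trans sSK) ?sub_inertia.
  apply: subset_trans sIS _; apply: subset_trans (sub_inertia_Res _ nVS) _.
  exact: subsetIr.
have nlinL u (i : Iirr L) : u != 0%R -> lam u \in irr_constt ('Res[V] 'chi_i)%R ->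
    deg i = (p ^ a)%N.
  move=> nzu iu; have [t ti tu] := constt_Res_between sVK sKL iu.
  rewrite -constt_Ind_Res in tu; apply: degL.
  apply: dvdn_trans (deg_constt_dvd (normalS sKL sLG nsKG) ti).
  by rewrite (nlinK u) // dvdn_exp.
have lam_fix u x: x \in X -> (u *m rX x == u)%R = (x \in 'I['chi_(lam u)]%R).
  move=> Xx; rewrite inE (subsetP nVX) //= -lamJ // (inj_eq irr_inj) (inj_eq lam_inj).
  by [].
have sSXL := subset_trans sSK sKL.
(* A character t of K over [lam u] is the restriction of one of L, by equality of degrees, so it is
   L-invariant. Hence R preserves the S-orbit of [lam u], and its stabiliser A in S R satisfies A S
   = S R. So A contains a Sylow r-subgroup of S R, which is conjugate to R. *)
have fix_conj (u : 'rV['F_l]_n.+1) : u != 0%R -> exists2 s, s \in S &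
    {in R, forall x, u *m rX s *m rX x = u *m rX s}%R.
  move=> nzu; have [t tu] := constt_cfInd_irr (lam u) sVK.
  have dt := nlinK u t nzu tu; rewrite constt_Ind_Res in tu.
  have [i it] := constt_cfInd_irr t sKL; rewrite constt_Ind_Res in it.
  have nsKL: K <| L := normalS sKL sLG nsKG.
  have di: deg i = deg t.
    by rewrite dt; apply: degL; rewrite (dvdn_trans _ (deg_constt_dvd nsKL it)) // dt dvdn_exp.
  have sLI: L \subset 'I['chi_t]%R.
    rewrite -(constt_Res_eq_deg sKL it di).
    have sLL: L \subset 'I_L['chi_i]%R by rewrite subsetI subxx sub_inertia.
    apply: subset_trans sLL _; apply: subset_trans (sub_inertia_Res _ (normal_norm nsKL)) _.
    exact: subsetIr.
  have moveRS x: x \in R -> exists2 s, s \in S & (u *m rX x = u *m rX s)%R.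
    move=> Rx; have Lx := subsetP sRL x Rx; have Xx := subsetP sYX x (subsetP sRY x Rx).
    have nVx := subsetP nVX x Xx; have nKx := subsetP nKR x Rx.
    have: lam (u *m rX x)%R \in irr_constt ('Res[V] 'chi_t)%R.
      rewrite irr_consttE lamJ // -{1}(inertiaJ (subsetP sLI x Lx)).
      by rewrite -cfConjgRes_norm // cfConjg_iso -irr_consttE.
    move/(constt_Res_cfclass nsVK tu)/cfclassP=> [k Kk].
    have: k \in V * S by rewrite defK.
    case/mulsgP=> v s Vv Ss ->; have Xs := subsetP sSX s Ss.
    rewrite cfConjgMnorm ?(subsetP (normG V) v) ?(subsetP nVS) // (cfConjg_id _ Vv).
    by rewrite -(lamJ s Xs) => /irr_inj/lam_inj; exists s.
  pose SR := (S <*> R)%G; pose A := 'I_SR['chi_(lam u)]%G%R.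
  have nSR: R \subset 'N(S) := subset_trans sRY nSY.
  have defSR: S * R = SR by rewrite /= norm_joinEr.
  have sSR_X: SR \subset X by rewrite join_subG sSX (subset_trans sRY).
  have sSSR: S \subset SR := joing_subl _ _; have sRSR: R \subset SR := joing_subr _ _.
  have sASR: A \subset SR := subsetIl _ _.
  have tiSR: S :&: R = 1 by apply: coprime_TIg.
  have defAS: A * S = SR.
    apply/eqP; rewrite eqEsubset mul_subG //=.
    have sRAS: R \subset A * S.
      apply/subsetP=> x Rx; have [s Ss eq_us] := moveRS x Rx.
      have Xx := subsetP sYX x (subsetP sRY x Rx); have Xs := subsetP sSX s Ss.
      have SRxs: x * s^-1 \in SR.
        by rewrite groupM ?groupV ?(subsetP sRSR x) ?(subsetP sSSR s).
      rewrite -(mulgKV s x) mem_mulg //; apply/setIP; split=> //.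
      by rewrite -lam_fix ?groupM ?groupV // repr_mxM ?groupV // mulmxA eq_us repr_mxK.
    rewrite -{1}defSR; apply/subsetP=> _ /mulsgP[s x Ss Rx ->].
    have /mulsgP[g s' Ag Ss' ->] := subsetP sRAS x Rx.
    have nSg: g \in 'N(S) by rewrite (subsetP _ g (subsetP sASR g Ag)) // join_subG normG.
    rewrite mulgA [s * g](_ : _ = g * s ^ g); last by rewrite conjgE mulKVg.
    by rewrite -mulgA mem_mulg // groupM // memJ_norm.
  have [B sylB] := Sylow_exists r A; have [sBA rB _] := and3P sylB.
  have r'S: r^'.-group S by rewrite /pgroup (pi_pnat pS) // !inE eq_sym.
  have r'SR_A: r^'.-nat #|SR : A|.
    apply: pnat_dvd r'S; rewrite -(dvdn_pmul2l (cardG_gt0 A)) Lagrange // -defAS.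
    by rewrite mul_cardG dvdn_mulr.
  have sylB': r.-Sylow(SR) B.
    rewrite /pHall (subset_trans sBA) // rB -(Lagrange_index sASR sBA) pnatM r'SR_A.
    by case/and3P: sylB.
  have sylR: r.-Sylow(SR) R.
    rewrite /pHall sRSR rR -divgS // -defSR TI_cardMg // mulnK //.
  have [g SRg defB] := Sylow_trans sylR sylB'.
  move: SRg; rewrite -defSR -(normC nSR) => /mulsgP[x s Rx Ss def_g].
  exists s^-1; rewrite ?groupV // => z Rz.
  have Xs := subsetP sSX s Ss; have Xz := subsetP sYX z (subsetP sRY z Rz).
  have: z ^ s \in B by rewrite defB def_g conjsgM (conjGid Rx) memJ_conjg.
  move/(subsetP sBA)/setIP=> [_]; rewrite -lam_fix ?groupJ // => /eqP eq_zs.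
  rewrite -[in RHS]eq_zs conjgE !repr_mxM ?groupM ?groupV // !mulmxA repr_mxK //.
(* The inertia group T of [lam u] in L is V : (Su R), and [lam u] extends to it. Multiplying the
   extension by characters b of T / V and inducing to L gives |L : T| * deg b = p^a for every b: the
   trivial b yields the index, and then T / V is abelian. *)
have stab_ab (u : 'rV['F_l]_n.+1) : u != 0%R -> {in R, forall x, u *m rX x = u}%R ->
    exists Su : {group gT},
    [/\ Su \subset S, {in S, forall s, (s \in Su) = (u *m rX s == u)%R},
        abelian Su, R \subset 'C(Su) & #|S : Su| = (p ^ a)%N].
  move=> nzu fixu; pose Su := 'I_S['chi_(lam u)]%G%R; exists Su.
  have sSuS: Su \subset S := subsetIl _ _.
  have defSu: {in S, forall s, (s \in Su) = (u *m rX s == u)%R}.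
    by move=> s Ss; rewrite inE Ss /= lam_fix ?(subsetP sSX).
  pose H := (Su <*> R)%G; pose T := 'I_L['chi_(lam u)]%G%R.
  have sRI: R \subset 'I['chi_(lam u)]%R.
    apply/subsetP=> x Rx; rewrite -lam_fix ?(subsetP sYX) ?(subsetP sRY) //.
    exact/eqP/fixu.
  have sHX: H \subset X by rewrite join_subG (subset_trans sSuS) // (subset_trans sRY).
  have sHI: H \subset 'I['chi_(lam u)]%R by rewrite join_subG subsetIr.
  have sHL: H \subset L by rewrite join_subG (subset_trans sSuS).
  have sVL: V \subset L := subset_trans sVK sKL.
  have sTL: T \subset L := subsetIl _ _.
  have tiVH: V :&: H = 1 by apply/trivgP; rewrite -tiVX setIS.
  have nVH: H \subset 'N(V) := subset_trans sHX nVX.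
  have defT: V ><| H = T.
    rewrite sdprodE //; apply/eqP; rewrite eqEsubset; apply/andP; split.
      by rewrite mul_subG // subsetI ?sVL ?sHL //= sub_inertia.
    apply/subsetP=> g /setIP[Lg Ig].
    have: g \in V * S * R by rewrite defK defKR.
    case/mulsgP=> _ x /mulsgP[v s Vv Ss ->] Rx def_g.
    have [Iv Ix] := (subsetP (sub_inertia 'chi_(lam u)%R) v Vv, subsetP sRI x Rx).
    rewrite def_g -mulgA mem_mulg // groupM ?(subsetP (joing_subl _ _) s) ?(subsetP (joing_subr _ _) x) //.
    rewrite inE Ss /=; move: Ig; rewrite def_g groupMr // groupMl //.
  have [c lin_c cV] := lin_char_extend_sdprod defT (lin_lam u) sHI.
  have nsVL: V <| L := normalS sVL sLG nsVG.
  have nsVT: V <| T := normal_Inertia _ sVL.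
  have [irrM _ _ _] := constt_Ind_ext nsVT cV.
  have [irrInd _ _ _ IndRes] := constt_Inertia_bijection (lam u) nsVL.
  have deg_b (b : Iirr (T / V)): (#|L : T| * deg b)%N = (p ^ a)%N.
    have /irrP[d def_d] := irrM b.
    have dT: d \in irr_constt ('Ind[T] 'chi_(lam u))%R.
      rewrite constt_Ind_Res -def_d rmorphM /= cV mod_IirrE // cfRes_sub_ker ?cfker_mod //.
      rewrite cfMod1 -scalerAl mul1r irr_consttE cfdotZl cfnorm_irr mulr1.
      exact: irr1_neq0.
    have /irrP[i def_i] := irrInd d dT; rewrite -(nlinL u i) //.
      apply/esym/eq_deg; rewrite -def_i cfInd1 // natrM; congr (_ * _)%R.
      by rewrite -def_d cfunE (lin_char1 lin_c) mulr1 mod_IirrE // cfMod1 degE.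
    have /= := IndRes d dT; rewrite def_i irr_consttE => <-.
    by rewrite -irr_consttE -constt_Ind_Res.
  have iLT: #|L : T| = (p ^ a)%N.
    by rewrite -(deg_b 0%R) (_ : deg _ = 1%N) ?muln1 //; apply: eq_deg; rewrite irr0 cfun11.
  have cTV: abelian (T / V).
    apply/char_abelianP=> b; rewrite lin_deg.
    by have /eqP := deg_b b; rewrite iLT -[X in _ == X]muln1 eqn_pmul2l ?expn_gt0 ?prime_gt0.
  have cHH: abelian H.
    rewrite (isog_abelian (quotient_isog nVH tiVH)).
    by rewrite (abelianS _ cTV) // quotientS //; case/sdprod_context: defT.
  have cSuR: R \subset 'C(Su).
    by rewrite (subset_trans (joing_subr Su R)) // (subset_trans cHH) // centS ?joing_subl.
  split=> //; first exact: abelianS (joing_subl _ _) cHH.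
  rewrite -iLT -!divgS //.
  have oK: #|K| = (#|V| * #|S|)%N by rewrite -defK TI_cardMg.
  have oL: #|L| = (#|V| * #|S| * #|R|)%N by rewrite -oK -defKR TI_cardMg // setIC.
  have oH: #|H| = (#|Su| * #|R|)%N.
    rewrite /= norm_joinEr ?cents_norm // TI_cardMg //.
    by apply/trivgP; rewrite -(coprime_TIg coSR) setSI.
  rewrite -(sdprod_card defT) oL oH -!mulnA divnMl // divnMr //.
have [u0 nzu0 fixu0]: exists2 u : 'rV['F_l]_n.+1, u != 0%R & {in R, forall x, u *m rX x = u}%R.
  have nz1: (const_mx 1 : 'rV['F_l]_n.+1)%R != 0%R.
    by apply/eqP=> /matrixP/(_ 0 0)%R/eqP; rewrite !mxE oner_eq0.
  have [s Ss fixs] := fix_conj _ nz1; exists (const_mx 1 *m rX s)%R => //.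
  apply: contra nz1 => /eqP us0; have Xs := subsetP sSX s Ss.
  by rewrite -[const_mx 1%R](repr_mxK rX Xs) us0 mul0mx.
have regNR x : x \in R^# -> {in K, forall z, commute z x -> z \in N}.
  by move=> Rx z Kz /commgP/eqP czx; apply: (fpfR x) => //; rewrite czx group1.
have [x0 Rx0] : exists x, x \in R^#.
  by have /trivgPn[x Rx ntx] := ntR; exists x; apply/setD1P.
(* C_S(V) lies in the stabiliser of the R-fixed u0, which R centralises; fixed-point freeness of R
   on K / N puts it into N, where no nontrivial normal p-subgroup of G exists. *)
have D1: 'C_S(V) = 1.
  apply: (noPN (W := 'C_S(V)%G)).
  - rewrite /normal subIset ?sSG //= -defG mul_subG //.
      by rewrite cents_norm // centsC subsetIr.
    by rewrite normsI ?norms_cent // subsetIr.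
  - have [Su [sSuS SuE _ cSuR _]] := stab_ab u0 nzu0 fixu0.
    apply/subsetP=> s /setIP[Ss cVs]; have [_ Rx] := setD1P Rx0.
    apply: (regNR x0) => //; first exact: (subsetP sSK).
    have: s \in Su.
      rewrite SuE // lam_fix ?(subsetP sSX) //.
      exact: (subsetP (cent_sub_inertia _)).
    by move=> Sus; apply: esym; apply: (centsP cSuR).
  exact: pgroupS (subsetIl _ _) pS.
(* A nonabelian S has an irreducible character of degree p^a, bounded by the index of the abelian
   group Su Z(S), while Su alone has index p^a. So Z(S) lies in each Su, fixes every vector, and is
   contained in C_S(V) = 1. *)
have cSS: abelian S.
  apply/idPn=> ncSS; have [j nlin_j]: exists j : Iirr S, deg j != 1%N.
    apply/existsP; apply: contraR ncSS; rewrite negb_exists => /forallP lin.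
    by apply/char_abelianP=> j; have:= lin j; rewrite negbK lin_deg.
  have defKS: V ><| S = K by rewrite sdprodE.
  have dj: deg j = (p ^ a)%N.
    have dj': deg (sdprod_Iirr defKS j) = deg j.
      by apply: eq_deg; rewrite sdprod_IirrE cfSdprod1 degE.
    by rewrite -dj' degK // dj'.
  suffices Z1: 'Z(S) = 1.
    case/negP: ncSS; have /eqP-> : S :==: 1; last exact: abelian1.
    by rewrite -(center_nil_eq1 (pgroup_nil pS)) Z1.
  apply/trivgP; rewrite -D1 subsetI center_sub; apply/subsetP=> z Zz.
  have /centerP[Sz cSz] := Zz; have Xz := subsetP sSX z Sz.
  apply: ffulX => //; apply/row_matrixP=> k; rewrite rowE row1.
  set u := delta_mx 0 k; have [->|nzu] := eqVneq u 0%R; first by rewrite mul0mx.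
  have [s Ss fixs] := fix_conj u nzu; have Xs := subsetP sSX s Ss.
  have nzus: (u *m rX s)%R != 0%R.
    by apply: contra nzu => /eqP us0; rewrite -[u](repr_mxK rX Xs) us0 mul0mx.
  have [Su [sSuS SuE cSuSu _ iSu]] := stab_ab _ nzus fixs.
  pose A := (Su <*> 'Z(S))%G.
  have sAS: A \subset S by rewrite join_subG sSuS center_sub.
  have cAA: abelian A.
    by rewrite abelianY cSuSu center_abelian /= (subset_trans (subsetIr _ _)) // centS.
  have := deg_le_index_abelian j sAS cAA; rewrite dj -iSu.
  rewrite -(Lagrange_index sAS (joing_subl Su 'Z(S))) /=.
  rewrite -[X in (_ <= X)%N]muln1 leq_pmul2l ?indexg_gt0 // => iA.
  have sASu: A \subset Su by rewrite -indexg_eq1 eqn_leq iA indexg_gt0.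
  have: z \in Su by rewrite (subsetP sASu) // (subsetP (joing_subr _ _)).
  rewrite SuE // -mulmxA -repr_mxM // -cSz // repr_mxM // mulmxA => /eqP eq_us.
  by rewrite -[LHS](repr_mxK rX Xs) eq_us repr_mxK.
have nSR: R \subset 'N(S) := subset_trans sRY nSY.
pose B := [~: S, R]%G.
have sBS: B \subset S by rewrite commg_subl.
have cBB: abelian B := abelianS sBS cSS.
have regBR: 'C_B(R) = 1 := coprime_abel_cent_TI nSR coSR cSS.
have cRy: R \subset 'C[y].
  by rewrite -cent_set1 centsC sub1set (subsetP _ y Yy) // (subset_trans cYY) // centS.
have q'R: coprime #|R| #[y].
  by rewrite (pnat_coprime rR) // (pi_pnat qy) // !inE.
have q'B: coprime #|B| #[y].
  by rewrite (pnat_coprime (pgroupS sBS pS)) // (pi_pnat qy) // !inE.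
have Xy := subsetP sYX y Yy.
have defSB: B * 'C_S(R) = S := coprime_commg_cent_mulG nSR coSR (abelian_sol cSS).
have nBX: X \subset 'N(B).
  rewrite -defSY mul_subG //; first by rewrite cents_norm // (subset_trans cSS) ?centS.
  by rewrite normsR // cents_norm // (subset_trans cYY) // centS.
(* Otherwise the fixed-point freeness of y puts B into N and that of R puts C_S(R) into N, so that K
   = V B C_S(R) lies in N. *)
have ncBy: ~~ (B \subset 'C[y]).
  apply/negP=> cBy; case/negP: (proper_subn prNK); rewrite -defK mul_subG // -defSB mul_subG //.
    apply/subsetP=> z Bz; have Kz := subsetP sSK z (subsetP sBS z Bz).
    apply: fpfy => //; have /cent1P/commgP/eqP-> := subsetP cBy z Bz; exact: group1.
  apply/subsetP=> z /setIP[Sz cRz]; apply: (regNR x0) => //; first exact: (subsetP sSK).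
  by have [_ Rx] := setD1P Rx0; apply: (centP cRz).
have k'B: [pchar 'F_l]^'.-group B.
  rewrite /pgroup (pi_pnat (pgroupS sBS pS)) // inE /=.
  by rewrite (pcharf_eq (pchar_Fp pr_l)) inE eq_sym.
apply: (abelian_pgroup_fixed_trivial (pgroupS sBS pS) k'B cBB (subset_trans sBS sSX) nBX _
         (subset_trans sRY sYX) Xy cRy q'R q'B regBR ncBy (rX := rX)).
- move=> c Bc u nzu uc; have Sc := subsetP sBS c Bc.
  have [s Ss fixs] := fix_conj u nzu; have Xs := subsetP sSX s Ss.
  have nzus: (u *m rX s)%R != 0%R.
    by apply: contra nzu => /eqP us0; rewrite -[u](repr_mxK rX Xs) us0 mul0mx.
  have [Su [_ SuE _ cSuR _]] := stab_ab _ nzus fixs.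
  apply/set1gP; rewrite -regBR inE Bc; apply: (subsetP (_ : Su \subset 'C(R))).
    by rewrite centsC.
  have Xc := subsetP sSX c Sc.
  by rewrite SuE // -mulmxA -repr_mxM // (centsP cSS s Ss c Sc) repr_mxM // mulmxA uc.
move=> u; have [->|nzu] := eqVneq u 0%R.
  by exists 1 => // x _; rewrite !mul0mx.
have [s Ss fixs] := fix_conj u nzu.
have: s \in B * 'C_S(R) by rewrite defSB.
case/mulsgP=> b c Bb /setIP[Sc cRc] def_s; exists b => // x Rx.
have [Xb Xc] := (subsetP sSX b (subsetP sBS b Bb), subsetP sSX c Sc).
have Xx := subsetP sYX x (subsetP sRY x Rx).
have eq_bc: (u *m rX b *m rX c *m rX x = u *m rX b *m rX c)%R.
  by have := fixs x Rx; rewrite def_s repr_mxM // !mulmxA.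
rewrite -[LHS](repr_mxK rX Xc) -[X in (X *m _)%R]mulmxA -repr_mxM //.
by rewrite -(centP cRc x Rx) repr_mxM // mulmxA eq_bc repr_mxK.
Qed.
End Core.

End MinimalCounterexample.

(** * From the section K / N to a normal Sylow subgroup *)

Section NormalSylow.
Set Implicit Arguments.
Unset Strict Implicit.
Unset Printing Implicit Defensive.
Import Order.TTheory GRing.Theory Num.Theory.
Local Open Scope group_scope.

Lemma fpf_on_quotient (gT : finGroupType) (K N W : {group gT}) (x : gT) :
    W \subset N -> N \subset K -> K \subset 'N(W) -> x \in 'N(W) ->
  fpf_on K N x -> fpf_on (K / W) (N / W) (coset W x).
Proof.
move=> sWN sNK nWK nWx fpfx _ /morphimP[z nWz Kz ->] Nzx; rewrite mem_quotient //.
have nsWN: W <| N by rewrite /normal sWN (subset_trans sNK).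
apply: fpfx => //; rewrite -(quotientGK nsWN) mem_morphpre ?groupR //.
by rewrite /= morphR.
Qed.

(** The hypotheses are such that they pass to G / W for each nontrivial W normal in G inside N. A
    minimal counterexample therefore satisfies those of [noncentral_core_false], with V = M. *)
Lemma complement_centralised (gT : finGroupType) (G L K M N : {group gT})
    (p r q a : nat) (y : gT) :
    prime p -> prime r -> r != p -> q != p -> q != r -> (0 < a)%N ->
    [/\ M <| G, K <| G, L <| G & N <| G] ->
    [/\ M \subset N, N \proper K & K \proper L] ->
    abelian M -> p^'.-group M -> p.-nat #|K : M| ->
    G^`(1) \subset K -> p^'.-nat #|G : K| -> r.-nat #|L : K| -> abelian (K / N) ->
    (forall t : Iirr K, deg t != 1%N -> deg t = (p ^ a)%N) ->
    (forall i : Iirr L, (p %| deg i)%N -> deg i = (p ^ a)%N) ->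
    {in L :\: K, forall x, fpf_on K N x} -> y \in G -> q.-elt y -> fpf_on K N y ->
  K \subset 'C(M).
Proof.
move=> pr_p pr_r neq_rp neq_qp neq_qr a_gt0; have [n] := ubnP #|G|.
elim: n => // n IHn in gT G L K M N y *; rewrite ltnS => leGn.
move=> [nsMG nsKG nsLG nsNG] [sMN prNK prKL] cMM p'M pKM sG'K p'GK rLK cKN.
move=> degK degL fpfL Gy qy fpfy; apply/idPn=> ncMK.
have [sNK sKL] := (proper_sub prNK, proper_sub prKL).
have [sKG nKG] := andP nsKG; have [sMG nMG] := andP nsMG.
have [sLG nLG] := andP nsLG; have [sNG nNG] := andP nsNG.
have sMK := subset_trans sMN sNK.
(* By minimality of [G], every nontrivial normal subgroup of [G] inside [N]
   contains [[K, M]]; hence [M] is a minimal normal subgroup. *)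
have sub_comm (W : {group gT}): W <| G -> W \subset N -> W :!=: 1 -> [~: K, M] \subset W.
  move=> nsWG sWN ntW; have [sWG nWG] := andP nsWG.
  have sWK := subset_trans sWN sNK; have sWL := subset_trans sWK sKL.
  have [nWK nWM] := (subset_trans sKG nWG, subset_trans sMG nWG).
  have nWL := subset_trans sLG nWG.
  have nsWK: W <| K := normalS sWK sKG nsWG.
  have nsWL: W <| L := normalS sWL sLG nsWG.
  have nsWN: W <| N := normalS sWN sNG nsWG.
  rewrite -quotient_cents2 //.
  apply: (IHn _ (G / W)%G (L / W)%G (K / W)%G (M / W)%G (N / W)%G (coset W y)).
  - by apply: leq_trans leGn; apply: ltn_quotient.
  - by rewrite !quotient_normal.
  - by rewrite quotientS // !quotient_proper.
  - exact: quotient_abelian.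
  - exact: quotient_pgroup.
  - by apply: pnat_dvd pKM; apply: index_morphim; rewrite subIset ?nWK.
  - by rewrite -quotient_der // quotientS.
  - by rewrite -(index_quotient_eq _ sKG nWG) // subIset ?sWK ?orbT in p'GK *.
  - by rewrite -(index_quotient_eq _ sKL nWL) // subIset ?sWK ?orbT in rLK *.
  - by rewrite (isog_abelian (third_isog sWN nsWK (normalS sNK sKG nsNG))).
  - by move=> t; rewrite -(deg_mod t) //; apply: degK.
  - by move=> i; rewrite -(deg_mod i) //; apply: degL.
  - move=> _ /setDP[/morphimP[x nWx Lx ->] nKx]; apply: fpf_on_quotient => //.
    by apply: fpfL; rewrite inE Lx andbT; apply: contra nKx; apply: mem_quotient.
  - exact: mem_quotient.
  - by apply: morph_p_elt => //; apply: (subsetP nWG).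
  - by apply: fpf_on_quotient => //; apply: (subsetP nWG).
have ntKM: [~: K, M] != 1 by apply: contra ncMK => /eqP/commG1P.
have [S sylS] := Sylow_exists p K; have [sSK pS _] := and3P sylS.
have nsMK: M <| K := normalS sMK sKG nsMG.
have hallM: p^'.-Hall(K) M by rewrite /pHall sMK p'M pnatNK.
have defK: M * S = K := normal_Hall_mulG nsMK hallM sylS.
have coMS: coprime #|M| #|S| by rewrite coprime_sym (pnat_coprime pS).
have nMS: S \subset 'N(M) := subset_trans sSK (normal_norm nsMK).
have sMS_KM: [~: M, S] \subset [~: K, M] by rewrite commGC commSg.
have eqC: 'C_M(S) = 'C_M(K).
  rewrite -defK centM setIA; congr (_ :&: _); apply/esym/setIidPl.
  exact: cMM.
have regMK: 'C_M(K) = 1.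
  apply/eqP; apply/idPn=> ntC; case/negP: ncMK.
  have nsCG: 'C_M(K) <| G by rewrite /normal subIset ?sMG // normsI ?norms_cent.
  have sKMC := sub_comm 'C_M(K)%G nsCG (subset_trans (subsetIl _ _) sMN) ntC.
  rewrite -defK mul_subG // centsC; apply/commG1P.
  rewrite -(coprime_commg_id nMS coMS (abelian_sol cMM)); apply/commG1P.
  by rewrite (subset_trans sMS_KM) // (subset_trans sKMC) //= -eqC subsetIr.
have defM: [~: M, S] = M.
  by rewrite -[RHS](coprime_commg_cent_mulG nMS coMS (abelian_sol cMM)) eqC regMK mulg1.
have minM: minnormal M G.
  apply/mingroupP; split.
    rewrite nMG andbT; apply: contra ntKM => /eqP->; rewrite commG1 //.
  move=> W /andP[ntW nWG] sWM; apply/eqP; rewrite eqEsubset sWM -{1}defM.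
  rewrite (subset_trans sMS_KM) // sub_comm // ?(subset_trans sWM) //.
  by rewrite /normal (subset_trans sWM).
apply: (@noncentral_core_false _ G L K M N p r q a y) => //.
- by rewrite /pgroup card_quotient ?normal_norm.
- by rewrite /pgroup card_quotient.
- by rewrite /pgroup card_quotient // (subset_trans sLG).
(* A nontrivial W would contain [K, M], which is a nontrivial p'-group. *)
move=> W nsWG sWN pW; apply/eqP; apply/idPn=> ntW; case/negP: ntKM.
have pKM' := pgroupS (sub_comm W nsWG sWN ntW) pW.
have p'KM: p^'.-group [~: K, M].
  by apply: pgroupS p'M; rewrite commg_subr normal_norm.
by rewrite (card1_trivg (pnat_1 pKM' p'KM)).
Qed.

(** Nonlinear characters of K have degree p^a and are L-invariant. So K = M x P with P = O_p(K),
    then L centralises M, and finally L / P is abelian, whence G' <= L' <= P. *)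
Lemma normal_Sylow_of_section (gT : finGroupType) (G L K N : {group gT})
    (p q r a c s : nat) (y : gT) :
    prime p -> prime r -> p != q -> r != q -> r != p -> (0 < a)%N -> (0 < c)%N ->
    L <| G -> q^'.-Hall(G) L -> solvable (G / L) -> solvable L ->
    G^`(1) \subset L^`(1) -> degrees L [:: 1; p ^ a; r ^ c]%N ->
    [/\ prime s, K <| G, N <| G & s.-abelem (K / N)] ->
    [/\ L^`(1) \subset K, K \proper L, N \proper K & y \in G /\ q.-elt y] ->
    [/\ {in L :\: K, forall x, fpf_on K N x} & fpf_on K N y] ->
    #|L : K| = (r ^ c)%N ->
  exists P : {group gT}, [/\ p.-Sylow(G) P, P <| G & abelian (G / P)].
Proof.
move=> pr_p pr_r neq_pq neq_rq neq_rp a0 c0 nsLG hallL solGL solL sG'L' [degL Ldeg].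
move=> [pr_s nsKG nsNG abelKN] [sL'K prKL prNK [Gy qy]] [fpfL fpfy] iLK.
have [[sLG nLG] [sKG nKG]] := (andP nsLG, andP nsKG).
have [sKL sNK] := (proper_sub prKL, proper_sub prNK).
have nsKL: K <| L := normalS sKL sLG nsKG.
have nsNL: N <| L := normalS (subset_trans sNK sKL) sLG nsNG.
have nsNK: N <| K := normalS sNK sKG nsNG.
have neq_pr: p != r by rewrite eq_sym.
have gt1X t k: prime t -> (0 < k)%N -> (t ^ k != 1)%N.
  by move=> pr_t k0; rewrite -(expn0 t) eqn_exp2l ?prime_gt1 // -lt0n.
have p'rX k: p^'.-nat (r ^ k)%N by rewrite pnatX pnatE // inE neq_rp.
have r'pX k: r^'.-nat (p ^ k)%N by rewrite pnatX pnatE // inE neq_pr.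
have pX k: p.-nat (p ^ k)%N by rewrite pnatX pnat_id.
have rX k: r.-nat (r ^ k)%N by rewrite pnatX pnat_id.
have solLK: solvable (L / K) := quotient_sol _ solL.
(* The product r^c * deg t is a degree of L, and among 1, p^a, r^c only r^c is possible. *)
have degt (t : Iirr K) : ~~ (s %| deg t)%N -> deg t = 1%N.
  move=> s't; have [i] := deg_fpf_index pr_s nsKL nsNL prNK abelKN sL'K fpfL s't.
  rewrite iLK => di; have := degL i; rewrite di !inE => /or3P[].
  - by rewrite muln_eq1 (negPf (gt1X r c _ _)).
  - move/eqP=> def_pa; have := r'pX a; rewrite -def_pa pnatM => /andP[].
    by rewrite pnatX pnatE // !inE eqxx eqn0Ngt c0.
  - by rewrite -[X in _ == X]muln1 eqn_pmul2l ?expn_gt0 ?prime_gt0 // => /eqP.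
have deg_res i t: deg i = (p ^ a)%N -> t \in irr_constt ('Res[K] 'chi[L]_i)%R ->
    deg t = (p ^ a)%N.
  move=> di tKi; have [e] := deg_constt_index nsKL solLK tKi.
  rewrite di iLK => def_pa e_dv; rewrite def_pa.
  suff ->: e = 1%N by rewrite mul1n.
  apply: (@pnat_1 p e); first by apply: pnat_dvd (pX a); rewrite def_pa dvdn_mulr.
  exact: pnat_dvd e_dv (p'rX c).
have [i0 di0] : exists i : Iirr L, deg i = (p ^ a)%N by apply: Ldeg; rewrite !inE eqxx orbT.
have [t0 t0i0] := constt_cfRes_irr K i0; have dt0 := deg_res _ _ di0 t0i0.
(* The degree p^a survives restriction to K, as the ratio divides both p^a and |L : K| = r^c; being
   nontrivial on K, it is divisible by s. *)
have sp: s = p.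
  have: s %| deg t0 by apply: contraR (gt1X p a pr_p a0) => /degt; rewrite dt0 => ->.
  by rewrite dt0 Euclid_dvdX // => /andP[]; rewrite dvdn_prime2 // => /eqP.
rewrite {s}sp in pr_s abelKN degt.
have degpL (i : Iirr L) : (p %| deg i)%N -> deg i = (p ^ a)%N.
  move=> p_i; have:= degL i; rewrite !inE => /or3P[]/eqP di //; move: p_i; rewrite di.
    by rewrite dvdn1 => /eqP p1; rewrite p1 in pr_p.
  by rewrite Euclid_dvdX // dvdn_prime2 // (negPf neq_pr).
have degKp (t : Iirr K) : deg t != 1%N -> (p %| deg t)%N.
  by apply: contraR => /degt->.
have over (t : Iirr K) : exists i, t \in irr_constt ('Res[K] 'chi[L]_i)%R.
  by have [i] := constt_cfInd_irr t sKL; rewrite constt_Ind_Res; exists i.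
have degpi i t : t \in irr_constt ('Res[K] 'chi[L]_i)%R -> deg t != 1%N ->
    deg i = (p ^ a)%N.
  by move=> tKi /degKp p_t; apply: degpL; apply: dvdn_trans p_t (deg_constt_dvd nsKL tKi).
have degK (t : Iirr K) : deg t != 1%N -> deg t = (p ^ a)%N.
  by move=> nt; have [i tKi] := over t; apply: deg_res (tKi); apply: degpi nt.
have invK (t : Iirr K) : deg t != 1%N -> L \subset 'I[('chi_t)%R].
  move=> nt; have [i tKi] := over t; have di := degpi i t tKi nt.
  have defR := constt_Res_eq_deg sKL tKi (etrans di (esym (degK t nt))).
  have sLI := subset_trans (sub_Inertia _ (subxx L)) (sub_inertia_Res ('chi_i)%R (normal_norm nsKL)).
  by rewrite -defR; apply: subset_trans sLI (subsetIr _ _).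
have hallM: p^'.-Hall(K) 'O_p^'(K).
  by apply: Thompson_normal_complement => // t; rewrite lin_deg; apply: degKp.
pose M := 'O_p^'(K)%G; pose P := 'O_p(K)%G.
have [sMK p'M pKM] := and3P hallM; rewrite pnatNK in pKM.
have nsMG: M <| G by rewrite gFnormal_trans.
have nsMK: M <| K := pcore_normal _ _.
have nsPG: P <| G by rewrite gFnormal_trans.
have cMM: abelian M.
  apply/char_abelianP=> j; rewrite lin_deg.
  have [t] := constt_cfInd_irr j sMK; rewrite constt_Ind_Res => jMt.
  have dv := deg_constt_dvd nsMK jMt; have p'j := pnat_dvd (deg_dvd_card j) p'M.
  have [dt | /degK dt] := eqVneq (deg t) 1%N; first by rewrite dt dvdn1 in dv.
  by rewrite dt in dv; rewrite (pnat_1 (pnat_dvd dv (pX a)) p'j).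
have pKN := abelem_pgroup abelKN.
have sMN: M \subset N.
  rewrite -quotient_sub1 ?(subset_trans sMK) ?normal_norm //.
  have pMN := pgroupS (quotientS N sMK) pKN.
  have p'MN: p^'.-group (M / N) := quotient_pgroup N p'M.
  by rewrite (card1_trivg (pnat_1 pMN p'MN)).
have rLK: r.-nat #|L : K| by rewrite iLK.
have qGL: q.-nat #|G : L| by case/and3P: hallL => _ _; rewrite pnatNK.
have p'GK: p^'.-nat #|G : K|.
  rewrite -(Lagrange_index sLG sKL) pnatM iLK p'rX andbT.
  by apply: pi_pnat qGL _; rewrite !inE eq_sym.
have sG'K := subset_trans sG'L' sL'K.
have cKM: K \subset 'C(M).
  have [neq_qp neq_qr]: q != p /\ q != r by rewrite ![q == _]eq_sym.
  apply: (@complement_centralised _ G L K M N p r q a y) => //.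
  exact: abelem_abelian abelKN.
have [S sylS] := Sylow_exists p K; have [sSK pS _] := and3P sylS.
have defK: M * S = K := normal_Hall_mulG nsMK hallM sylS.
have nsSK: S <| K.
  rewrite /normal sSK -defK mul_subG ?normG //.
  by rewrite (subset_trans _ (cent_sub S)) // centsC (subset_trans sSK).
have sylP: p.-Sylow(K) P by rewrite /= (normal_Hall_pcore sylS nsSK).
have defKP: M \x P = K.
  rewrite dprodE ?(normal_Hall_mulG nsMK hallM sylP) //.
    by rewrite (subset_trans (pcore_sub _ _)).
  by apply: coprime_TIg; rewrite coprime_sym (pnat_coprime (pcore_pgroup _ _)).
have ncPP: ~~ abelian P.
  apply/negP=> cPP; have cKK: abelian K.
    by have [_ <- cMP _] := dprodP defKP; rewrite abelianM cMM cPP cMP.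
  have /char_abelianP/(_ t0) := cKK; rewrite lin_deg dt0.
  by rewrite (negPf (gt1X p a _ _)).
have [f]: exists f : Iirr P, ('chi_f)%R \isn't a linear_char.
  by apply/existsP; rewrite -negb_forall; apply: contra ncPP => /forallP/char_abelianP.
rewrite lin_deg => ntf.
(* For a nonlinear f of P, the product of f with any j of M is nonlinear on K, hence L-invariant; so
   every character of M is L-invariant. *)
have cML: L \subset 'C(M).
  rewrite centsC; apply/commG1P/trivgP; rewrite -(TI_cfker_irr M); apply/bigcapsP=> j _.
  have lin_j: ('chi_j)%R \is a linear_char by move/char_abelianP: cMM.
  apply: inertia_commg_cfker => //.
  have: L \subset 'I_L[('chi_(dprod_Iirr defKP (j, f)))%R].
    rewrite subsetI subxx invK //; apply: contraNneq ntf => d1.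
    have := degE (dprod_Iirr defKP (j, f)); rewrite dprod_IirrE cfDprod1 (lin_char1 lin_j).
    by rewrite d1 mul1r => /eq_deg ->.
  rewrite dprod_IirrE (inertia_dprod_irr _ _ _ (subset_trans sLG (normal_norm nsMG)) (subset_trans sLG (normal_norm nsPG))) subsetI => /andP[sLI _].
  exact: subset_trans sLI (subsetIr _ _).
have sPK := pcore_sub p K : P \subset K.
have sPL := subset_trans sPK sKL; have nsPL: P <| L := normalS sPL sLG nsPG.
have nPL := normal_norm nsPL.
have p'GP: p^'.-nat #|G : P|.
  rewrite -(Lagrange_index sKG sPK) pnatM p'GK /=.
  by case/and3P: sylP.
have p'LP: p^'.-nat #|L : P| by apply: pnat_dvd p'GP; apply: indexSg.
(* A nonlinear degree of L / P is prime to p, hence r^c. But K / P = M P / P is central in L / P, so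
   its square is at most |L : K| = r^c. *)
have cLP: abelian (L / P).
  apply/char_abelianP=> i; rewrite lin_deg; apply/idPn=> nti.
  have di: deg i = (r ^ c)%N.
    have := degL (mod_Iirr i); rewrite deg_mod // !inE (negPf nti) /=.
    case/orP=> /eqP // di; have := deg_dvd_card i; rewrite di card_quotient // => dv.
    by have := gt1X p a pr_p a0; rewrite (pnat_1 (pX a) (pnat_dvd dv p'LP)).
  have: ((deg i) ^ 2 <= #|L : K|)%N.
    have [le_d _] := irr1_bound i; rewrite degE -natrX ler_nat in le_d.
    apply: leq_trans le_d _.
    have -> : #|L : K| = #|L / P : K / P|.
      by rewrite index_quotient_eq // subIset ?sPK ?orbT.
    have sZ: 'Z(L / P) \subset 'Z(('chi_i)%R)%CF by rewrite -cap_cfcenter_irr; apply: bigcap_inf.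
    apply: dvdn_leq => //; apply: indexgS; apply: subset_trans sZ; rewrite subsetI quotientS //=.
    have defKq: (M * P) / P = M / P by rewrite quotientMidr.
    suff: K / P \subset 'C(L / P) by [].
    have -> : K / P = M / P by rewrite -defKq (dprodW defKP).
    by rewrite quotient_cents // centsC.
  rewrite di iLK -expnM leq_exp2l ?prime_gt1 // => le_c.
  by move: le_c; rewrite leqNgt muln2 -addnn -[X in (X < _)%N]addn0 ltn_add2l c0.
exists P; split=> //.
  by rewrite /pHall (subset_trans sPK) // pcore_pgroup.
apply: sub_der1_abelian; apply: subset_trans sG'L' _.
by rewrite der1_min.
Qed.

Lemma exists_normal_Sylow (gT : finGroupType) (G : {group gT})
    (p q r a b c d : nat) :
    prime p -> prime q -> prime r -> p != q -> r != q -> p != r ->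
    (0 < a)%N -> (0 < b)%N -> (0 < c)%N -> (0 < d)%N ->
    degrees G [:: 1; p ^ a * q ^ b; r ^ c * q ^ d]%N ->
  (exists P : {group gT}, [/\ p.-Sylow(G) P, P <| G & abelian (G / P)]) \/
  (exists P : {group gT}, [/\ r.-Sylow(G) P, P <| G & abelian (G / P)]).
Proof.
move=> pr_p pr_q pr_r neq_pq neq_rq neq_pr a0 b0 c0 d0 degG.
have [solG [L [hallL nsLG cGL sLG_L' degL]]] :=
  normal_q'_Hall_of_degrees pr_p pr_q pr_r neq_pq neq_rq a0 b0 c0 d0 degG.
have [sLG nLG] := andP nsLG; have solL := solvableS sLG solG.
have solGL : solvable (G / L) := quotient_sol _ solG.
have sG'L' := der1_sub_normal_Hall nsLG hallL cGL sLG_L'.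
have q'L: q^'.-group L by case/and3P: hallL.
have coLG: coprime #|L| #|G : L|.
  by case/and3P: hallL => _ _; rewrite pnatNK coprime_sym => /pnat_coprime; apply.
have q_dv (i : Iirr G) : deg i != 1%N -> (q %| deg i)%N.
  have:= proj1 degG i; rewrite !inE => /or3P[]/eqP-> // _.
    by rewrite dvdn_mull // dvdn_exp.
  by rewrite dvdn_mull // dvdn_exp.
(* An invariant nonlinear character of L would extend to G, giving a nontrivial degree prime to
   q. *)
have ninv (j : Iirr L) : ('chi_j)%R \isn't a linear_char ->
    ~~ (G \subset 'I[('chi_j)%R]).
  rewrite lin_deg => nj; apply/negP=> sGI.
  have [i] := deg_Ind_Hall j nsLG solGL coLG.
  have -> : 'I_G[('chi_j)%R] = G by apply/setIidPl.
  rewrite indexgg mul1n => di _; have := q_dv i; rewrite di => /(_ nj) q_j.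
  by have := pnat_dvd (dvdn_trans q_j (deg_dvd_card j)) q'L; rewrite pnatE // !inE eqxx.
have ncLL: ~~ abelian L.
  apply/negP=> /char_abelianP cLL; have [_ /(_ (p ^ a)%N)] := degL.
  case=> [|i di]; first by rewrite !inE eqxx orbT.
  have := cLL i; rewrite lin_deg di -(expn0 p) eqn_exp2l ?prime_gt1 //.
  by rewrite eqn0Ngt a0.
have [s [K [N [y [sec1 [sec2 sec3]]]]]] :=
  exists_fpf_section solL nsLG hallL cGL sLG_L' ncLL ninv.
(* Applying [deg_fpf_index] to the principal character of K shows that |L : K| is a degree of L; the
   last two cases differ by exchanging p and r. *)
have [iLK1 | [iLKp | iLKr]]: #|L : K| = 1%N \/ #|L : K| = (p ^ a)%N \/ #|L : K| = (r ^ c)%N.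
- have [[pr_s nsKG nsNG abelKN] [sL'K prKL prNK _] [fpfL _]] := And3 sec1 sec2 sec3.
  have [sKL sNK] := (proper_sub prKL, proper_sub prNK).
  have nsKL: K <| L := normalS sKL sLG nsKG.
  have nsNL: N <| L := normalS (subset_trans sNK sKL) sLG nsNG.
  have d0K: deg (0%R : Iirr K) = 1%N by apply/eqP; rewrite -lin_deg irr0 rpred1.
  have [|i] := deg_fpf_index (t := 0%R) pr_s nsKL nsNL prNK abelKN sL'K fpfL.
    by rewrite d0K dvdn1 neq_ltn prime_gt1 ?orbT.
  rewrite d0K muln1 => <-; have := proj1 degL i; rewrite !inE.
  by case/or3P=> /eqP; tauto.
- by case: sec2 => _ /proper_subn; rewrite -indexg_eq1 iLK1.
- right; apply: (@normal_Sylow_of_section _ G L K N r q p c a s y) => //.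
  case: degL => degL Ldeg; split=> [i | e e_in]; last apply: Ldeg; last move: e_in.
    by have:= degL i; rewrite !inE => /or3P[] ->; rewrite ?orbT.
  by rewrite !inE => /or3P[] ->; rewrite ?orbT.
- by left; apply: (@normal_Sylow_of_section _ G L K N p q r a c s y) => //; rewrite eq_sym.
Qed.

End NormalSylow.

(** * The structure of the centreless quotient *)

Section Structure.
Set Implicit Arguments.
Unset Strict Implicit.
Unset Printing Implicit Defensive.
Import Order.TTheory GRing.Theory Num.Theory.
Local Open Scope ring_scope.
Local Open Scope group_scope.

Lemma mem_inertia_val (gT : finGroupType) (V : {group gT}) (phi : 'CF(V)) x :
  x \in 'N(V) -> {in V, forall v, phi (v ^ x) = phi v} -> x \in 'I[phi].
Proof.
move=> nVx fix_phi; rewrite inE nVx; apply/eqP/cfun_inP=> v Vv; rewrite cfConjgE //.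
by rewrite -fix_phi ?conjgKV // memJ_norm ?groupV.
Qed.

Lemma commg_cfker_inertia (gT : finGroupType) (V A : {group gT}) (lam : 'CF(V)) :
  lam \is a linear_char -> A \subset 'N(V) -> [~: V, A] \subset cfker lam ->
  A \subset 'I[lam].
Proof.
move=> lin_lam nVA ker; apply/subsetP=> x Ax.
apply: mem_inertia_val (subsetP nVA x Ax) _ => v Vv.
have kc : [~ v, x] \in cfker lam by rewrite (subsetP ker) ?mem_commg.
by rewrite -[RHS](cfkerMr _ kc) commgEl mulKVg.
Qed.

Lemma sub_lin_cfkers (gT : finGroupType) (P X D : {group gT}) :
    P^`(1) \subset X -> X \subset P -> D \subset P ->
    (forall j : Iirr P, ('chi_j)%R \is a linear_char -> X \subset cfker ('chi_j)%R ->
       D \subset cfker ('chi_j)%R) ->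
  D \subset X.
Proof.
move=> sP'X sXP sDP kerD; have nsXP := sub_der1_normal sP'X sXP.
rewrite -quotient_sub1 ?(subset_trans sDP) ?normal_norm // -(TI_cfker_irr (P / X)%G).
apply/bigcapsP=> i _; pose phi := (('chi_i)%R %% X)%CF.
have /irrP[k def_k] : phi \in irr P by rewrite cfMod_irr ?mem_irr.
have kerk : X \subset cfker ('chi_k)%R by rewrite -def_k cfker_mod.
have lin_k : ('chi_k)%R \is a linear_char.
  rewrite -def_k cfMod_lin_char //.
  by have /char_abelianP: abelian (P / X) by apply: sub_der1_abelian.
have -> : ('chi_i)%R = (phi / X)%CF by rewrite cfModK.
by rewrite cfker_quo ?def_k // quotientS // kerD.
Qed.

Lemma exists_lin_char_trivial_on (gT : finGroupType) (P X : {group gT}) :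
    P^`(1) \subset X -> X \proper P ->
  exists j : Iirr P, [/\ ('chi_j)%R \is a linear_char, j != 0%R & X \subset cfker ('chi_j)%R].
Proof.
move=> sP'X /andP[sXP]; have [j /and3P[] | no_j nsPX] :=
  pickP (fun j : Iirr P => [&& ('chi_j)%R \is a linear_char, j != 0%R & X \subset cfker ('chi_j)%R]).
  by exists j.
case/negP: nsPX; apply: sub_lin_cfkers sP'X sXP (subxx P) _ => j lin_j sXj.
by rewrite subGcfker; have := no_j j; rewrite lin_j sXj andbT => /negbFE.
Qed.

Lemma pgroup_der1_nongen (gT : finGroupType) (p : nat) (P X : {group gT}) :
  p.-group P -> X \subset P -> P \subset P^`(1) * X -> X :=: P.
Proof.
move=> pP sXP sPX; apply/eqP; rewrite eqEsubset sXP /=.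
suff defP: <<X>> = P by rewrite -{1}defP genGid.
apply: Phi_nongen.
apply/eqP; rewrite eqEsubset join_subG Phi_sub sXP /=.
apply: subset_trans sPX _; rewrite mul_subG ?joing_subr //.
by rewrite (subset_trans _ (joing_subl _ _)) // (Phi_joing pP) joing_subl.
Qed.

(** Here P = P' C_P(A), and P' consists of nongenerators. *)
Lemma coprime_cent_der1 (gT : finGroupType) (p : nat) (P A : {group gT}) :
    p.-group P -> A \subset 'N(P) -> coprime #|P| #|A| -> [~: P, A] \subset P^`(1) ->
  A \subset 'C(P).
Proof.
move=> pP nPA coPA sPA; rewrite centsC; apply/setIidPl.
apply: (@pgroup_der1_nongen _ p P 'C_P(A)%G) => //; first exact: subsetIl.
by rewrite -{1}(coprime_commg_cent_mulG nPA coPA (pgroup_sol pP)) mulSg.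
Qed.

(* Otherwise twisting [j] by a linear character trivial on ['C_P(T)] and not
   on [[P, T]], with [T] the inertia group, gives a smaller inertia group. *)
Lemma inertia_lin_cent (gT : finGroupType) (p n : nat) (P H : {group gT}) (j : Iirr P) :
    p.-group P -> abelian H -> H \subset 'N(P) -> coprime #|P| #|H| ->
    (forall k : Iirr P, ('chi_k)%R \is a linear_char ->
       #|H : 'I_H[('chi_k)%R]| \in [:: 1%N; n]) ->
    ('chi_j)%R \is a linear_char -> ~~ (H \subset 'I[('chi_j)%R]) ->
  'I_H[('chi_j)%R] = 'C_H(P).
Proof.
move=> pP cHH nPH coPH indH lin_j ninvj; set T := 'I_H[('chi_j)%R]%G.
have sTH : T \subset H := Inertia_sub _ _; have nPT := subset_trans sTH nPH.
have coPT := coprimegS sTH coPH.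
apply/eqP; rewrite eqEsubset; apply/andP; split; last exact: cent_sub_Inertia.
rewrite subsetI sTH.
apply: (coprime_cent_der1 pP nPT coPT); apply/idPn=> nsPT.
pose X := ('C_P(T) <*> P^`(1))%G.
have defP := coprime_commg_cent_mulG nPT coPT (pgroup_sol pP).
have nXP: P^`(1) \subset X := joing_subr _ _.
have sCX: 'C_P(T) \subset X := joing_subl _ _.
have prXP: X \proper P.
  rewrite properE join_subG subsetIl der_sub /=; apply: contra nsPT => sPX.
  have {}defP: P :=: 'C_P(T).
    apply/esym; apply: (@pgroup_der1_nongen _ p P 'C_P(T)%G) => //; first exact: subsetIl.
    by rewrite -norm_joinEr ?(subset_trans (subsetIl _ _)) ?der_norm // joingC.
  have /commG1P->: P \subset 'C(T) by rewrite {1}defP subsetIr.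
  exact: sub1G.
have [k [lin_k ntk sXk]] := exists_lin_char_trivial_on nXP prXP.
have kerj : [~: P, T] \subset cfker ('chi_j)%R.
  by apply: inertia_commg_cfker lin_j (subsetIr _ _).
have lin_jk: ('chi_j * 'chi_k)%R \is a linear_char by rewrite rpredM.
have /irrP[i def_i] := lin_char_irr lin_jk.
(* On C_P(T) the characters 'chi_i and 'chi_j agree, and on [P, T] the latter is trivial. Both
   subgroups are H-stable with product P, so whatever fixes 'chi_i fixes 'chi_j. *)
have sIT: 'I_H[('chi_i)%R] \subset T.
  apply/subsetP=> h /setIP[Hh Ih]; rewrite inE Hh.
  have nTH := sub_abelian_norm cHH sTH.
  apply: (mem_inertia_val (subsetP nPH h Hh)) => v; rewrite -{1}defP => /mulsgP[c e Kc Ce ->].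
  have [Pe CTe] := setIP Ce.
  have Kch : c ^ h \in [~: P, T].
    by rewrite memJ_norm // (subsetP (normsR nPH nTH)).
  have Ceh : e ^ h \in 'C_P(T) by rewrite memJ_norm // (subsetP (normsI nPH (norms_cent nTH))).
  rewrite conjMg (cfkerMl _ (subsetP kerj _ Kch)) (cfkerMl _ (subsetP kerj _ Kc)).
  have val u : u \in 'C_P(T) -> ('chi_i)%R u = ('chi_j)%R u.
    move=> Cu; rewrite -def_i cfunE [X in (_ * X)%R](cfker1 (subsetP sXk _ (subsetP sCX _ Cu))).
    by rewrite lin_char1 ?mulr1.
  by rewrite -!val // inertia_valJ.
have iT: #|H : T| = n.
  have:= indH j lin_j; rewrite !inE => /orP[|/eqP//]; rewrite indexg_eq1 => sHT.
  by case/negP: ninvj; apply: subset_trans sHT (subsetIr _ _).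
(* The index of the smaller inertia group is also n, so it equals T. Then 'chi_i, and with it
   'chi_k, is trivial on [P, T]; but 'chi_k is already trivial on C_P(T). *)
have:= indH i; rewrite -{1}def_i => /(_ lin_jk); rewrite !inE => /orP[].
  rewrite indexg_eq1 => sHI; case/negP: ninvj.
  exact: subset_trans (subset_trans sHI sIT) (subsetIr _ _).
rewrite -iT -(Lagrange_index sTH sIT) -[X in _ == X]muln1 eqn_pmul2l // indexg_eq1 => sTI.
case/negP: ntk; rewrite -subGcfker -{1}defP mul_subG ?(subset_trans sCX) //.
have keri : [~: P, T] \subset cfker ('chi_i)%R.
  by apply: inertia_commg_cfker; rewrite -?def_i // def_i (subset_trans sTI) ?subsetIr.
apply/subsetP=> u Ku; have Pu : u \in P by apply: subsetP Ku; rewrite commg_subl.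
rewrite /= cfkerEirr inE (lin_char1 lin_k).
have := cfker1 (subsetP keri u Ku); rewrite -def_i !cfunE (cfker1 (subsetP kerj u Ku)).
by rewrite (lin_char1 lin_k) (lin_char1 lin_j) !mul1r => ->.
Qed.

(** If [P, x] P' were proper, a nontrivial linear character trivial on it would be fixed by x. So x
    acts on P / P' with commutator everything, and by coprimality without fixed points. *)
Lemma fpf_on_der1 (gT : finGroupType) (P : {group gT}) (x : gT) :
    solvable P -> x \in 'N(P) -> coprime #|P| #[x] ->
    (forall j : Iirr P, ('chi_j)%R \is a linear_char -> j != 0%R -> x \notin 'I[('chi_j)%R]) ->
  fpf_on P P^`(1) x.
Proof.
move=> solP nPx coPx ninv z Pz Czx; pose X := <[x]>%G.
have nPX: X \subset 'N(P) by rewrite cycle_subG.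
have nP'X: X \subset 'N(P^`(1)) by rewrite gFnorm_trans.
have nP'P: P \subset 'N(P^`(1)) := der_norm 1 P.
have coPX: coprime #|P / P^`(1)| #|X / P^`(1)|.
  by apply: coprime_morph.
have defP: [~: P, X] <*> P^`(1) = P.
  apply/eqP; apply: contraT => neqP.
  have prP: [~: P, X] <*> P^`(1) \proper P.
    by rewrite properEneq neqP join_subG commg_subl nPX der_sub.
  have [j [lin_j ntj kerj]] := exists_lin_char_trivial_on (joing_subr _ _) prP.
  have := ninv j lin_j ntj; rewrite -cycle_subG; case/negP.
  by apply: commg_cfker_inertia => //; apply: subset_trans (joing_subl _ _) kerj.
have defW: [~: P / P^`(1), X / P^`(1)] = P / P^`(1).
  have sRP': [~: P, X] \subset 'N(P^`(1)) by apply: subset_trans nP'P; rewrite commg_subl.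
  have eqW: ([~: P, X] * P^`(1)) / P^`(1) = [~: P, X] / P^`(1) by rewrite quotientMidr.
  by rewrite -quotientR // -eqW -norm_joinEl ?defP.
have cWW: abelian (P / P^`(1)) by apply: sub_der1_abelian.
have nWX : X / P^`(1) \subset 'N(P / P^`(1)) by apply: quotient_norms.
have regW: 'C_(P / P^`(1))(X / P^`(1)) = 1.
  have := coprime_abelian_dprod nWX coPX cWW; rewrite defW => /dprodP[_ _ _].
  by apply: contra_eq => nt; rewrite (setIidPr _) ?subsetIl.
have nP'x: x \in 'N(P^`(1)) by rewrite -cycle_subG.
have nP'z: z \in 'N(P^`(1)) by apply: subsetP Pz.
rewrite coset_idr // -/(coset _ z); apply/set1gP; rewrite -regW.
rewrite inE mem_quotient //= /X quotient_cycle // cent_cycle.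
by apply/cent1P/commgP; rewrite -morphR //= coset_id.
Qed.

Lemma cfRes_central (gT : finGroupType) (P Z : {group gT}) (i : Iirr P) (j : Iirr Z) :
    Z \subset 'Z(P) -> j \in irr_constt ('Res[Z] ('chi_i))%R ->
  ('Res[Z] 'chi_i = (deg i)%:R *: 'chi_j)%R.
Proof.
move=> sZZ jZi; have [sZP cPZ] := subsetIP sZZ.
have nsZP: Z <| P := sub_center_normal sZZ.
have lin_j: ('chi_j)%R \is a linear_char.
  by have /char_abelianP: abelian Z by apply: abelianS sZZ (center_abelian P).
have defR := Clifford_Res_sum_cfclass nsZP jZi.
have clj: (('chi_j)%R ^: P)%CF = [:: ('chi_j)%R].
  by rewrite cfclass_invariant // (subset_trans _ (cent_sub_inertia _)) // centsC.
rewrite clj big_seq1 in defR.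
have := congr1 (fun f : 'CF(Z) => f 1%g) defR; rewrite /= cfRes1 cfunE (lin_char1 lin_j) mulr1.
by rewrite degE => ->.
Qed.

(** Compare degrees in the induced character of j: each constituent i has multiplicity deg i,
    because Z is central. *)
Lemma central_char_sum_square (gT : finGroupType) (P Z : {group gT}) (j : Iirr Z) :
    Z \subset 'Z(P) ->
  (\sum_(i : Iirr P | j \in irr_constt ('Res[Z] ('chi_i))%R) deg i ^ 2 = #|P : Z|)%N.
Proof.
move=> sZZ; have [sZP cPZ] := subsetIP sZZ.
have lin_j: ('chi_j)%R \is a linear_char.
  by have /char_abelianP: abelian Z by apply: abelianS sZZ (center_abelian P).
have := congr1 (fun f : 'CF(P) => f 1%g) (cfun_sum_constt ('Ind[P] ('chi_j)%R)).
rewrite /= sum_cfunE cfInd1 // (lin_char1 lin_j) mulr1 => /esym eqS.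
apply/eqP; rewrite -(eqr_nat algC) natr_sum -eqS; apply/eqP.
apply: eq_big => i; first by rewrite constt_Ind_Res.
move=> jZi; rewrite cfunE -cfdot_Res_r (cfRes_central sZZ jZi) cfdotZr conjC_nat.
by rewrite cfdot_irr eqxx mulr1 degE natrX expr2.
Qed.

(* All irreducible characters of [P] agree on [g] and [g ^ x] for [g] in the
   derived subgroup and [x] in [R], so these elements are conjugate in [P] and
   [R] stabilises a [P]-central series of the derived subgroup. *)
Lemma cent_der1_of_nonlinear_inertia (gT : finGroupType) (p : nat) (P R : {group gT}) :
    p.-group P -> R \subset 'N(P) -> coprime #|P| #|R| ->
    (forall i : Iirr P, ('chi_i)%R \isn't a linear_char -> R \subset 'I[('chi_i)%R]) ->
  R \subset 'C(P^`(1)).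
Proof.
move=> pP nPR coPR invR.
have main (n : nat) (D : {group gT}) : (#|D| <= n)%N ->
    D <| P -> D \subset P^`(1) -> R \subset 'N(D) -> R \subset 'C(D).
  elim: n D => [|n IHn] D leDn nsDP sDP' nDR; first by rewrite leqNgt cardG_gt0 in leDn.
  have [D1 | ntD] := eqsVneq D 1; first by rewrite D1 cents1.
  have [sDP nDP] := andP nsDP.
  have prD: [~: D, P] \proper D.
    by apply: nil_comm_properl (pgroup_nil pP) _ ntD _; rewrite // subsetI subxx.
  have coDR := coprimeSg sDP coPR.
  apply: (coprime_stable_cent nDR coDR (pgroup_sol (pgroupS sDP pP))) (IHn [~: D, P]%G _ _ _ _).
  - rewrite gen_subG; apply/subsetP=> _ /imset2P[g x Dg Rx ->].
    have Pg := subsetP sDP g Dg; have nPx := subsetP nPR x Rx.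
    have : g ^ x \in g ^: P.
      apply/(eq_irr_mem_classP _ Pg) => i.
      have [lin_i | nlin_i] := boolP (('chi_i)%R \is a linear_char).
        have ker u : u \in P^`(1) -> ('chi_i)%R u = 1%R.
          by move=> P'u; rewrite (cfker1 (subsetP (lin_char_der1 lin_i) u P'u)) lin_char1.
        by rewrite !ker // ?(subsetP sDP') // memJ_norm // (subsetP nDR).
      by rewrite (inertia_valJ _ (subsetP (invR i nlin_i) x Rx)).
    case/imsetP=> u Pu eq_gx; rewrite commgEl eq_gx -commgEl.
    by rewrite mem_commg.
  - by rewrite -ltnS (leq_trans _ leDn) ?proper_card.
  - by rewrite /normal normsR // (subset_trans (proper_sub prD)).
  - exact: subset_trans (proper_sub prD) sDP'.
  by rewrite normsR.
by apply: (main _ P^`(1)%G (leqnn _)); rewrite ?der_normal // gFnorm_trans.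
Qed.

(** * Groups P : H with abelian H and degrees 1, p^a q^b, n *)

Section NormalSylowStructure.

Variables (gT : finGroupType) (G P H : {group gT}) (p q a b n : nat).
Hypotheses (pr_p : prime p) (pr_q : prime q) (neq_pq : p != q) (a_gt0 : (0 < a)%N)
  (b_gt0 : (0 < b)%N).
Hypotheses (p'n : p^'.-nat n) (q'n : ~~ q.-nat n).
Hypotheses (sdG : P ><| H = G) (pP : p.-group P) (p'H : p^'.-group H) (cHH : abelian H).
Hypothesis degG : forall i : Iirr G, deg i \in [:: 1; p ^ a * q ^ b; n]%N.
Hypothesis Gdeg : exists i : Iirr G, deg i = (p ^ a * q ^ b)%N.
Let R := 'O_q^'(H)%G.

Let nsPG : P <| G. Proof. by case/sdprod_context: sdG. Qed.
Let sPG : P \subset G. Proof. exact: normal_sub nsPG. Qed.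
Let nPG : G \subset 'N(P). Proof. exact: normal_norm nsPG. Qed.
Let sHG : H \subset G. Proof. by case/sdprod_context: sdG. Qed.
Let nPH : H \subset 'N(P). Proof. exact: subset_trans sHG nPG. Qed.
Let defG : P * H = G. Proof. exact: sdprodW sdG. Qed.
Let coPH : coprime #|P| #|H|. Proof. exact: pnat_coprime pP p'H. Qed.
Let sRH : R \subset H. Proof. exact: pcore_sub. Qed.
Let nPR : R \subset 'N(P). Proof. exact: subset_trans sRH nPH. Qed.
Let coPR : coprime #|P| #|R|. Proof. exact: coprimegS sRH coPH. Qed.
Let solP : solvable P. Proof. exact: pgroup_sol pP. Qed.
Let cGP : abelian (G / P).
Proof. by rewrite -defG quotientMidl quotient_abelian. Qed.
Let iGP : #|G : P| = #|H|. Proof. by rewrite -divgS // -(sdprod_card sdG) mulKn. Qed.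
Let solGP : solvable (G / P). Proof. exact: abelian_sol. Qed.
Let hallR : q^'.-Hall(H) R.
Proof. exact: nilpotent_pcore_Hall (abelian_nil cHH). Qed.
Let gt1X k : (0 < k)%N -> (p ^ k != 1)%N.
Proof. by move=> k0; rewrite -(expn0 p) eqn_exp2l ?prime_gt1 // -lt0n. Qed.
Let gt1Xq k : (0 < k)%N -> (q ^ k != 1)%N.
Proof. by move=> k0; rewrite -(expn0 q) eqn_exp2l ?prime_gt1 // -lt0n. Qed.
Let pX k : p.-nat (p ^ k)%N. Proof. by rewrite pnatX pnat_id. Qed.
Let p'qX k : p^'.-nat (q ^ k)%N. Proof. by rewrite pnatX pnatE // !inE [q == p]eq_sym neq_pq. Qed.

Lemma index_inertia_compl (k : Iirr P) : #|G : 'I_G[('chi_k)%R]| = #|H : 'I_H[('chi_k)%R]|.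
Proof.
have sPI : P \subset 'I_G[('chi_k)%R] := sub_Inertia _ sPG.
have -> : 'I_H[('chi_k)%R] = H :&: 'I_G[('chi_k)%R] by rewrite setIA (setIidPl sHG).
rewrite [RHS]indexgI -[RHS]indexMg; congr #|_ : _|.
apply/eqP; rewrite eqEsubset mulG_subG Inertia_sub sHG andbT.
by rewrite -{1}defG mulSg.
Qed.

Lemma p'_index_inertia (k : Iirr P) : p^'.-nat #|G : 'I_G[('chi_k)%R]|.
Proof.
apply: pnat_dvd p'H; rewrite -iGP; apply: indexgS; exact: sub_Inertia.
Qed.

Lemma deg_inertia (k : Iirr P) :
  (#|G : 'I_G[('chi_k)%R]| * deg k)%N \in [:: 1; p ^ a * q ^ b; n]%N.
Proof.
have [|i <- _] := @deg_Ind_Hall _ G P k nsPG solGP; last exact: degG.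
by rewrite iGP.
Qed.

(** The degree is a p-number and the inertia index a p'-number, so their product p^a q^b determines
    both; the product n would force degree 1. *)
Lemma nonlinear_deg_inertia (k : Iirr P) : ('chi_k)%R \isn't a linear_char ->
  deg k = (p ^ a)%N /\ #|G : 'I_G[('chi_k)%R]| = (q ^ b)%N.
Proof.
rewrite lin_deg => ntk; have p'I := p'_index_inertia k.
have pk : p.-nat (deg k) := pnat_dvd (deg_dvd_card k) pP.
have:= deg_inertia k; rewrite !inE => /or3P[]/eqP eq_d.
- by move/eqP: eq_d; rewrite muln_eq1 (negPf ntk) andbF.
- have eqk := congr1 (fun m => m`_p)%N eq_d; have eqI := congr1 (fun m => m`_p^')%N eq_d.
  have [I0 k0] : (0 < #|G : 'I_G[('chi_k)%R]|)%N /\ (0 < deg k)%N by rewrite deg_gt0.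
  have [pa0 qb0] : (0 < p ^ a)%N /\ (0 < q ^ b)%N by rewrite !expn_gt0 !prime_gt0.
  rewrite !partnM // in eqk eqI.
  have part1 m : p^'.-nat m -> (m`_p)%N = 1%N by apply: part_p'nat.
  have part1' m : p.-nat m -> (m`_p^')%N = 1%N by move=> pm; apply: part_p'nat; rewrite pnatNK.
  rewrite (part1 _ p'I) (part1 _ (p'qX b)) !part_pnat_id // mul1n muln1 in eqk.
  by rewrite (part1' _ pk) (part1' _ (pX a)) !part_pnat_id // mul1n muln1 in eqI.
by move: p'n ntk; rewrite -eq_d pnatM => /andP[_ p'k]; rewrite (pnat_1 pk p'k).
Qed.

Lemma lin_index_inertia (k : Iirr P) : ('chi_k)%R \is a linear_char ->
  #|H : 'I_H[('chi_k)%R]| \in [:: 1%N; n].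
Proof.
rewrite lin_deg => /eqP d1; have := deg_inertia k; rewrite d1 muln1 index_inertia_compl.
rewrite !inE orbCA => /orP[/eqP def_i | //].
have := p'_index_inertia k; rewrite index_inertia_compl def_i pnatM => /andP[p'pa _].
by case/negP: (gt1X a_gt0); rewrite (pnat_1 (pX a) p'pa).
Qed.

Lemma nonlinear_inertia (k : Iirr P) : ('chi_k)%R \isn't a linear_char -> R \subset 'I[('chi_k)%R].
Proof.
case/nonlinear_deg_inertia=> _; rewrite index_inertia_compl => iI.
have nIR : R \subset 'N('I_H[('chi_k)%R]).
  by apply: subset_trans sRH (sub_abelian_norm cHH (subsetIl _ _)).
suff: R \subset 'I_H[('chi_k)%R] by move/subset_trans; apply; apply: subsetIr.
rewrite -quotient_sub1 //.
have qR : q.-group (R / 'I_H[('chi_k)%R]).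
  apply: pgroupS (quotientS _ sRH) _.
  rewrite /pgroup card_quotient ?sub_abelian_norm ?subsetIl // iI pnatX pnat_id //.
have q'R : q^'.-group (R / 'I_H[('chi_k)%R]) := quotient_pgroup _ (pcore_pgroup _ _).
by rewrite (card1_trivg (pnat_1 qR q'R)).
Qed.

Lemma cent_der1_q'core : R \subset 'C(P^`(1)).
Proof. exact: cent_der1_of_nonlinear_inertia pP nPR coPR nonlinear_inertia. Qed.

Lemma commg_q'core_cent_der1 : [~: P, R] \subset 'C(P^`(1)).
Proof.
have cRP' := cent_der1_q'core.
apply/commG1P; apply: (@three_subgroup _ R P^`(1)%G P).
  by move/commG1P: cRP' => ->; apply: comm1G.
apply/commG1P; rewrite centsC; apply: subset_trans cRP' _; apply: centS.
by rewrite commg_subl der_norm.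
Qed.

Lemma nonabelian_Sylow : ~~ abelian P.
Proof.
have [i di] := Gdeg; apply/negP=> /char_abelianP linP.
have [k kPi] := constt_cfRes_irr P i; have := linP k; rewrite lin_deg => /eqP d1.
have [e] := deg_constt_index nsPG solGP kPi; rewrite d1 muln1 di iGP => <- dv.
have := pnat_dvd dv p'H; rewrite pnatM => /andP[p'pa _].
by case/negP: (gt1X a_gt0); rewrite (pnat_1 (pX a) p'pa).
Qed.

(** If H fixed all linear characters, it would centralise P / P', hence P, and would fix the
    nonlinear ones too, against their orbits of length q^b. For a linear character that is moved,
    the stabiliser is C_H(P). *)
Lemma index_cent_compl : #|H : 'C_H(P)| = n /\ exists2 j : Iirr P,
  ('chi_j)%R \is a linear_char & ~~ (H \subset 'I[('chi_j)%R]).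
Proof.
have [j /andP[lin_j nj] | no_j] :=
  pickP (fun j : Iirr P => ('chi_j \is a linear_char)%R && ~~ (H \subset 'I[('chi_j)%R])).
  split; last by exists j.
  rewrite -(inertia_lin_cent pP cHH nPH coPH lin_index_inertia lin_j nj).
  have:= lin_index_inertia lin_j; rewrite !inE => /orP[|/eqP //]; rewrite indexg_eq1 => sHI.
  by case/negP: nj; apply: subset_trans sHI (subsetIr _ _).
have cPH : H \subset 'C(P).
  apply: (coprime_cent_der1 pP nPH coPH); apply: (@sub_lin_cfkers _ P) => //.
  - exact: der_sub.
  - by rewrite commg_subl.
  move=> j lin_j _; apply: inertia_commg_cfker => //.
  by have := no_j j; rewrite lin_j /= => /negbFE.
have [k nlin_k] : exists k : Iirr P, ('chi_k)%R \isn't a linear_char.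
  apply/existsP; rewrite -negb_forall; apply: contra nonabelian_Sylow => /forallP linP.
  exact/char_abelianP.
have [_] := nonlinear_deg_inertia nlin_k; rewrite index_inertia_compl.
have -> : 'I_H[('chi_k)%R] = H.
  by apply/setIidPl; apply: subset_trans cPH (cent_sub_inertia _).
by rewrite indexgg => /esym/eqP; rewrite (negPf (gt1Xq b_gt0)).
Qed.

(** Otherwise n = |H : C_H(P)| would divide |H : R|, a power of q. *)
Lemma q'core_not_cent : ~~ (R \subset 'C(P)).
Proof.
apply: contra q'n => cPR; have [<- _] := index_cent_compl.
have sRC : R \subset 'C_H(P) by rewrite subsetI sRH.
apply: pnat_dvd (indexgS H sRC) _; by case/and3P: hallR => _ _; rewrite pnatNK.
Qed.

Lemma lin_inertia_compl (k : Iirr P) : ('chi_k)%R \is a linear_char ->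
  R \subset 'I[('chi_k)%R] -> H \subset 'I[('chi_k)%R].
Proof.
move=> lin_k sRI; apply: contraR q'core_not_cent => nk.
have := inertia_lin_cent pP cHH nPH coPH lin_index_inertia lin_k nk => defI.
have : R \subset 'I_H[('chi_k)%R] by rewrite subsetI sRH.
by rewrite defI => /subset_trans->; rewrite ?subsetIr.
Qed.

(** A linear character trivial on [P, R] is R-fixed, hence H-fixed and trivial on [P, H]. So [P, H]
    lies in [P, R] P', and P = [P, H] C_P(H) is generated by the two subgroups modulo P'. *)
Lemma commg_q'core_cent_join : [~: P, R] <*> 'C_P(H) = P.
Proof.
apply: (@pgroup_der1_nongen _ p P ([~: P, R] <*> 'C_P(H))%G pP).
  by rewrite /= join_subG commg_subl nPR subsetIl.
pose X := ([~: P, R] <*> P^`(1))%G.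
have sPHX : [~: P, H] \subset X.
  apply: (@sub_lin_cfkers _ P) => [||| j lin_j sXj].
  - exact: joing_subr.
  - by rewrite /= join_subG commg_subl nPR der_sub.
  - by rewrite commg_subl.
  apply: inertia_commg_cfker => //; apply: lin_inertia_compl => //.
  by apply: commg_cfker_inertia => //; apply: subset_trans (joing_subl _ _) sXj.
rewrite -{1}(coprime_commg_cent_mulG nPH coPH solP).
apply: subset_trans (mulSg _ sPHX) _.
have nY : [~: P, R] <*> 'C_P(H) \subset 'N(P^`(1)).
  by apply: subset_trans (der_norm 1 P); rewrite join_subG commg_subl nPR subsetIl.
rewrite -(norm_joinEr nY) mul_subG //.
  rewrite join_subG joing_subl andbT.
  by apply: subset_trans (joing_subl _ _) (joing_subr _ _).
by apply: subset_trans (joing_subr _ _) (joing_subr _ _).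
Qed.

(* Counting the irreducible characters of [P] above a nontrivial character of
   the intersection: their squared degrees add up to a power of [p], while
   they fall into [G]-orbits of length [q ^ b]. *)
Lemma der1_center_trivial : P^`(1) :&: 'Z(G) = 1.
Proof.
pose Z := (P^`(1) :&: 'Z(G))%G; apply/eqP; apply: contraT => ntZ.
have [sZP' sZZ] : Z \subset P^`(1) /\ Z \subset 'Z(G) by rewrite subsetIl subsetIr.
have [sZG cGZ] := subsetIP sZZ.
have sZP : Z \subset P := subset_trans sZP' (der_sub 1 P).
have sZZP : Z \subset 'Z(P) by rewrite subsetI sZP (subset_trans cGZ) ?centS.
have [j ntj] : exists j : Iirr Z, j != 0%R.
  apply/existsP; apply: contraR ntZ; rewrite negb_exists => /forallP all0.
  apply/eqP/trivgP; rewrite -(TI_cfker_irr Z); apply/bigcapsP=> i _.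
  by have := all0 i; rewrite negbK => /eqP->; rewrite irr0 cfker_cfun1.
pose S := [set i : Iirr P | j \in irr_constt ('Res[Z] ('chi_i))%R].
have nlinS i : i \in S -> ('chi_i)%R \isn't a linear_char.
  rewrite inE => jZi; apply: contra ntj => lin_i.
  rewrite -subGcfker; apply: subset_trans (cfker_constt (cfRes_char _ (irr_char i)) jZi).
  rewrite cfker_Res ?irr_char // subsetI subxx (subset_trans sZP') //.
  exact: lin_char_der1.
have [Q sylQ] := Sylow_exists q G; have [sQG qQ iGQ] := and3P sylQ.
have nPQ := subset_trans sQG nPG.
have actsQ : [acts Q, on S | conjg_Iirr_act P].
  apply/subsetP=> y Qy; apply/setIP; split; first exact: subsetP nPQ y Qy.
  rewrite inE; apply/subsetP=> i; rewrite !inE /= => jZi.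
  have Gy := subsetP sQG y Qy.
  rewrite conjg_IirrE; suff -> : ('Res[Z] ('chi_i ^ y) = 'Res[Z] 'chi_i)%R%CF by [].
  apply/cfun_inP=> z Zz; rewrite !cfResE ?cfConjgE ?(subsetP nPQ) //.
  congr ('chi_i _)%R; apply/conjg_fixP/commgP; apply: (centP (subsetP cGZ z Zz)).
  by rewrite groupV.
have := @pgroup_fix_sum q _ _ _ _ Q S (fun i => (deg i ^ 2)%N) qQ actsQ.
have -> : (\sum_(i in S) deg i ^ 2 = #|P : Z|)%N.
  rewrite -(central_char_sum_square j sZZP); apply: eq_bigl => i; by rewrite inE.
have -> : 'Fix_(S | conjg_Iirr_act P)(Q) = set0.
  apply/setP=> i; rewrite in_set0; apply/negP=> /setIP[/nlinS nlin_i].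
  rewrite afix_conjg_Iirr // => sQI; have [_ iI] := nonlinear_deg_inertia nlin_i.
  have sQI' : Q \subset 'I_G[('chi_i)%R] by rewrite subsetI sQG.
  have := pnat_dvd (indexgS G sQI') iGQ; rewrite iI pnatX pnatE // !inE eqxx /=.
  by rewrite eqn0Ngt b_gt0.
rewrite big_set0 mod0n => /(_ _)/eqP; rewrite -/(q %| _)%N.
case/(_ _)/negP=> [y i _ _|].
  by congr (_ ^ 2)%N; apply: eq_deg; rewrite conjg_IirrE cfConjg1 degE.
move=> q_dv; have := pnat_dvd (dvdn_trans q_dv (dvdn_indexg P Z)) pP.
by rewrite pnatE // inE eq_sym (negPf neq_pq).
Qed.

(** By three subgroups C = C_P(H) centralises [P, R], and G is generated by [P, R], C and H:
    whatever in C commutes with C is central in G. If C were nonabelian, C' would meet Z(C) in a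
    nontrivial part of P' and Z(G). *)
Lemma cent_compl_sub_center : 'C_P(H) \subset 'Z(G).
Proof.
pose C := 'C_P(H)%G; have [sCP cHC] : C \subset P /\ C \subset 'C(H).
  by rewrite subsetIl subsetIr.
have cRP' := cent_der1_q'core.
have cBC : C \subset 'C([~: P, R]).
  rewrite centsC; apply/commG1P; apply: (@three_subgroup _ R C P).
    have /commG1P-> : R \subset 'C(C) by rewrite centsC; apply: subset_trans cHC (centS sRH).
    exact: comm1G.
  apply/commG1P; rewrite centsC; apply: subset_trans cRP' _; apply: centS.
  exact: commSg.
have sGC (D : {group gT}) : D \subset C -> C \subset 'C(D) -> D \subset 'Z(G).
  move=> sDC cCD; have sDG := subset_trans (subset_trans sDC sCP) sPG.
  have sDB := subset_trans sDC cBC; have sDH := subset_trans sDC cHC.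
  rewrite subsetI sDG -defG centM subsetI sDH andbT.
  by rewrite -commg_q'core_cent_join centY subsetI sDB centsC.
have cCC : abelian C.
  apply/idPn=> ncCC; have ntC' : C^`(1) != 1 by apply: contra ncCC => /eqP/derG1P.
  have nilC := pgroup_nil (pgroupS sCP pP).
  have := meet_center_nil nilC (der_normal 1 C) ntC'.
  case/eqP; apply/trivgP; rewrite -der1_center_trivial subsetI; apply/andP; split.
    by apply: subset_trans (subsetIl _ _) (dergS 1 sCP).
  apply: sGC; last by rewrite centsC; apply: subset_trans (subsetIr _ _) (subsetIr _ _).
  exact: subset_trans (subsetIl _ _) (der_sub 1 C).
exact: sGC.
Qed.

(** Modulo P', G' lies in [P, H], which meets the centraliser of H trivially; so a central element
    of G' is already in P'. *)
Lemma der1_center_group_trivial : G^`(1) :&: 'Z(G) = 1.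
Proof.
apply/trivgP; rewrite -der1_center_trivial subsetI subsetIr andbT.
apply/subsetP=> z /setIP[G'z Zz]; have /centerP[Gz cGz] := Zz.
have nP'G : G \subset 'N(P^`(1)) by rewrite gFnorm_trans.
have [nP'P nP'H] := (subset_trans sPG nP'G, subset_trans sHG nP'G).
have cWW : abelian (P / P^`(1)) by apply: sub_der1_abelian.
have sG'Y : G^`(1) / P^`(1) \subset [~: P / P^`(1), H / P^`(1)].
  have nYG : G / P^`(1) \subset 'N([~: P / P^`(1), H / P^`(1)]).
    rewrite -defG quotientMl // mulG_subG commg_norml commg_normr //.
  rewrite quotient_der //; apply: der1_min => //.
  have nYP : P / P^`(1) \subset 'N([~: P / P^`(1), H / P^`(1)]) := commg_norml _ _.
  rewrite /= -defG !quotientMl // abelianM (quotient_abelian _ cWW) (quotient_abelian _ (quotient_abelian _ cHH)) /=.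
  by rewrite quotient_cents2 ?commg_normr // commGC.
have nWH : H / P^`(1) \subset 'N(P / P^`(1)) := quotient_norms _ nPH.
have coWH : coprime #|P / P^`(1)| #|H / P^`(1)| by apply: coprime_morph.
have [_ _ _ tiWH] := dprodP (coprime_abelian_dprod nWH coWH cWW).
have G'P : G^`(1) \subset P by rewrite der1_min.
have nP'z : z \in 'N(P^`(1)) by rewrite (subsetP nP'G).
apply: coset_idr => //; apply/set1gP; rewrite -tiWH inE.
rewrite (subsetP sG'Y) ?mem_quotient // inE mem_quotient ?(subsetP G'P) //=.
apply/centP=> _ /morphimP[h nh Hh ->]; rewrite /commute -!morphM // cGz //.
exact: subsetP sHG h Hh.
Qed.

End NormalSylowStructure.

Lemma center_quotient_trivial (gT : finGroupType) (G : {group gT}) :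
  G^`(1) :&: 'Z(G) = 1 -> 'Z(G / 'Z(G)) = 1.
Proof.
move=> tiZ; have nsZ := center_normal G.
apply/trivgP/subsetP=> _ /setIP[/morphimP[x nZx Gx ->] cGx]; apply/set1gP.
apply: coset_id; rewrite inE Gx; apply/centP=> g Gg; apply/commgP.
have nZg : g \in 'N('Z(G)) by apply: (subsetP (normal_norm nsZ)).
rewrite -in_set1 -[[set 1]]tiZ inE mem_commg //=.
apply: coset_idr; first by rewrite groupR.
rewrite morphR //; apply/eqP/commgP; apply: (centP cGx).
exact: mem_quotient.
Qed.

(** A constituent above the product of j with the principal character of G' is trivial on G', hence
    linear. *)
Lemma lin_char_extend_center (gT : finGroupType) (G Z : {group gT}) (j : Iirr Z) :
    Z \subset 'Z(G) -> G^`(1) :&: Z = 1 ->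
  exists2 i : Iirr G, ('chi_i)%R \is a linear_char & ('Res[Z] 'chi_i = 'chi_j)%R.
Proof.
move=> sZZ tiZ; have [sZG cGZ] := subsetIP sZZ.
have sG'G : G^`(1) \subset G := der_sub 1 G.
have lin_j : ('chi_j)%R \is a linear_char.
  by have /char_abelianP: abelian Z by apply: abelianS sZZ (center_abelian G).
have sdX : Z \x G^`(1) = (Z <*> G^`(1))%G.
  by rewrite dprodEY 1?setIC // (subset_trans sG'G) // centsC.
have sXG : (Z <*> G^`(1))%G \subset G by rewrite /= join_subG sZG.
pose k := dprod_Iirr sdX (j, 0%R).
have [i] := constt_cfInd_irr k sXG; rewrite constt_Ind_Res => kXi.
have resX (Y : {group gT}) (l : Iirr Y) : Y \subset Z <*> G^`(1) ->
    ('Res[Y] 'chi_k = 'chi_l)%R -> l \in irr_constt ('Res[Y] 'chi_i)%R.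
  move=> sYX defl; rewrite -(cfResRes _ sYX sXG).
  apply: (constt_Res_trans (cfRes_char _ (irr_char i)) kXi).
  by rewrite defl irr_consttE cfdot_irr eqxx oner_eq0.
have lin_i : ('chi_i)%R \is a linear_char.
  rewrite lin_irr_der1; apply: constt0_Res_cfker (der_normal 1 G) _.
  apply: resX; first exact: joing_subr.
  by rewrite dprod_IirrE cfDprod_Resr lin_char1 // scale1r.
exists i => //.
have jZi : j \in irr_constt ('Res[Z] 'chi_i)%R.
  apply: resX; first exact: joing_subl.
  by rewrite dprod_IirrE cfDprod_Resl irr0 cfun1E group1 scale1r.
rewrite (cfRes_central sZZ jZi); move: lin_i; rewrite lin_deg => /eqP->.
by rewrite scale1r.
Qed.

(** Multiply a character by a linear one that extends the conjugate of its central character: the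
    degree stays, and Z enters the kernel. *)
Lemma degrees_central_quotient (gT : finGroupType) (G Z : {group gT}) (s : seq nat) :
    Z \subset 'Z(G) -> G^`(1) :&: Z = 1 -> degrees G s -> degrees (G / Z) s.
Proof.
move=> sZZ tiZ [degG Gdeg]; have nsZG : Z <| G := sub_center_normal sZZ.
have [sZG _] := andP nsZG.
split=> [i | d /Gdeg[i di]]; first by rewrite -(deg_mod i nsZG).
have [j jZi] := constt_cfRes_irr Z i.
have lin_j : ('chi_j)%R \is a linear_char.
  by have /char_abelianP: abelian Z by apply: abelianS sZZ (center_abelian G).
have [l lin_l res_l] := lin_char_extend_center (conjC_Iirr j) sZZ tiZ.
have /irrP[k def_k] : ('chi_l * 'chi_i)%R \in irr G by rewrite mul_lin_irr ?mem_irr.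
have dk : ('chi_k)%R 1 = d%:R%R by rewrite -def_k cfunE (lin_char1 lin_l) mul1r degE di.
have kerk : Z \subset cfker ('chi_k)%R.
  apply/subsetP=> z Zz; rewrite cfkerEirr inE dk -def_k cfunE.
  rewrite -(cfResE _ sZG Zz) res_l -(cfResE 'chi_i sZG Zz) (cfRes_central sZZ jZi) cfunE.
  by rewrite conjC_IirrE di cfunE mulrCA [X in (_ * X)%R]mulrC -normCK normC_lin_char // expr1n mulr1.
exists (quo_Iirr Z k); apply: eq_deg.
by rewrite quo_IirrE // cfQuo1.
Qed.

Lemma irr_center_neq0 (gT : finGroupType) (G : {group gT}) (i : Iirr G) (z : gT) :
  z \in 'Z(G) -> ('chi_i z)%R != 0%R.
Proof.
move=> Zz; have [j jZi] := constt_cfRes_irr 'Z(G) i.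
have lin_j : ('chi_j)%R \is a linear_char by have /char_abelianP := center_abelian G.
rewrite -(cfResE _ (center_sub G) Zz) (cfRes_central (subxx _) jZi) cfunE.
by rewrite mulf_neq0 ?lin_char_neq0 // -degE irr1_neq0.
Qed.

(** H acts faithfully and irreducibly on a minimal H-invariant subgroup of V. *)
Lemma abelian_semiregular_cyclic (gT : finGroupType) (p : nat) (V H : {group gT}) :
    p.-group V -> V :!=: 1 -> H \subset 'N(V) -> abelian H -> semiregular V H ->
  cyclic H.
Proof.
move=> pV ntV nVH cHH regH; have [W minW sWV] := minnormal_exists ntV nVH.
have [[ntW nWH] _] := (andP (mingroupp minW), minW).
have pW := pgroupS sWV pV.
have [_ _ /is_abelemP[l pr_l abelW]] := minnormal_solvable minW (subxx W) (pgroup_sol pW).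
have regW : 'C_H(W) = 1.
  apply/trivgP/subsetP=> h /setIP[Hh cWh]; apply/set1gP; apply: contraNeq ntW => nth.
  rewrite -subG1 -(regH h) ?inE ?nth // subsetI sWV /=.
  by apply/subsetP=> w Ww; apply/cent1P/esym/(centP cWh).
apply: (mx_faithful_irr_abelian_cyclic (rG := abelem_repr abelW ntW nWH)) => //.
  exact: abelem_mx_faithful.
exact/abelem_mx_irrP.
Qed.

Lemma extraspecial_of_prime_center (gT : finGroupType) (p : nat) (Q : {group gT}) :
    prime p -> p.-group Q -> #|'Z(Q)| = p -> Q^`(1) = 'Z(Q) -> extraspecial Q.
Proof.
move=> pr_p pQ oZ defQ'; split; last by rewrite oZ.
split=> //; apply/eqP; rewrite eqEsubset; apply/andP; split; last first.
  by rewrite -defQ' (Phi_joing pQ) joing_subl.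
have nZQ := normal_norm (center_normal Q).
apply: (Phi_min pQ nZQ); apply/(abelemP pr_p); split.
  by apply: sub_der1_abelian; rewrite defQ'.
move=> _ /morphimP[x nZx Qx ->]; rewrite -morphX //= coset_id // inE groupX //=.
apply/centP=> y Qy; apply/commgP.
have Zxy : [~ x, y] \in 'Z(Q) by rewrite -defQ' mem_commg.
rewrite commXg; first by rewrite -oZ expg_cardG.
by have /centerP[_ cxy] := Zxy; apply: esym; apply: cxy.
Qed.

(** * The same groups when the centre is trivial *)

Section CenterlessStructure.

Variables (gT : finGroupType) (G P H : {group gT}) (p q a b n : nat).
Hypotheses (pr_p : prime p) (pr_q : prime q) (neq_pq : p != q) (a_gt0 : (0 < a)%N)
  (b_gt0 : (0 < b)%N).
Hypotheses (p'n : p^'.-nat n) (q'n : ~~ q.-nat n).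
Hypotheses (sdG : P ><| H = G) (pP : p.-group P) (p'H : p^'.-group H) (cHH : abelian H).
Hypothesis degG : forall i : Iirr G, deg i \in [:: 1; p ^ a * q ^ b; n]%N.
Hypothesis Gdeg : exists i : Iirr G, deg i = (p ^ a * q ^ b)%N.
Hypothesis regZ : 'Z(G) = 1.
Let R := 'O_q^'(H)%G.

Let nsPG : P <| G. Proof. by case/sdprod_context: sdG. Qed.
Let sPG : P \subset G. Proof. exact: normal_sub nsPG. Qed.
Let nPG : G \subset 'N(P). Proof. exact: normal_norm nsPG. Qed.
Let sHG : H \subset G. Proof. by case/sdprod_context: sdG. Qed.
Let nPH : H \subset 'N(P). Proof. exact: subset_trans sHG nPG. Qed.
Let defG : P * H = G. Proof. exact: sdprodW sdG. Qed.
Let tiPH : P :&: H = 1. Proof. by case/sdprod_context: sdG. Qed.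
Let coPH : coprime #|P| #|H|. Proof. exact: pnat_coprime pP p'H. Qed.
Let sRH : R \subset H. Proof. exact: pcore_sub. Qed.
Let sRG : R \subset G. Proof. exact: subset_trans sRH sHG. Qed.
Let nPR : R \subset 'N(P). Proof. exact: subset_trans sRH nPH. Qed.
Let solP : solvable P. Proof. exact: pgroup_sol pP. Qed.
Let sP'P : P^`(1) \subset P. Proof. exact: der_sub. Qed.
Let nP'G : G \subset 'N(P^`(1)). Proof. by rewrite gFnorm_trans. Qed.
Let hallR : q^'.-Hall(H) R.
Proof. exact: nilpotent_pcore_Hall (abelian_nil cHH). Qed.
Let cGP : abelian (G / P).
Proof. by rewrite -defG quotientMidl quotient_abelian. Qed.
Let nonlin_deg (k : Iirr P) (nk : ('chi_k)%R \isn't a linear_char) :=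
  nonlinear_deg_inertia pr_p pr_q neq_pq p'n sdG pP p'H cHH degG nk.
Let invR (k : Iirr P) (nk : ('chi_k)%R \isn't a linear_char) :=
  nonlinear_inertia pr_p pr_q neq_pq p'n sdG pP p'H cHH degG nk.

Let regPH : 'C_P(H) = 1.
Proof.
apply/trivgP; rewrite -regZ.
exact: (cent_compl_sub_center pr_p pr_q neq_pq a_gt0 b_gt0 p'n q'n sdG pP p'H cHH degG Gdeg).
Qed.

Let regHP : 'C_H(P) = 1.
Proof.
apply/trivgP; rewrite -regZ subsetI subIset ?sHG //= -defG centM subsetI.
by rewrite subsetIr andbC (subset_trans (subsetIl _ _)).
Qed.

Let defPR : [~: P, R] = P.
Proof.
have := commg_q'core_cent_join pr_p pr_q neq_pq a_gt0 b_gt0 p'n q'n sdG pP p'H cHH degG Gdeg.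
by rewrite regPH joingG1.
Qed.

Let defPH : [~: P, H] = P.
Proof.
by apply/eqP; rewrite eqEsubset commg_subl nPH /= -{1}defPR commgS.
Qed.

Let cRP' : R \subset 'C(P^`(1)).
Proof. exact: (cent_der1_q'core pr_p pr_q neq_pq p'n sdG pP p'H cHH degG). Qed.

Let cPP' : P \subset 'C(P^`(1)).
Proof.
rewrite -{1}defPR.
exact: (commg_q'core_cent_der1 pr_p pr_q neq_pq p'n sdG pP p'H cHH degG).
Qed.

Let ncPP : ~~ abelian P.
Proof. exact: (nonabelian_Sylow pr_p a_gt0 sdG p'H cHH Gdeg). Qed.

Let ntR : R :!=: 1.
Proof.
apply: contra (q'core_not_cent pr_p pr_q neq_pq a_gt0 b_gt0 p'n q'n sdG pP p'H cHH degG Gdeg).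
by move/eqP=> R1; rewrite -/R R1 sub1G.
Qed.

Let ntP' : P^`(1) != 1. Proof. by apply: contra ncPP => /eqP/derG1P. Qed.

Let lin_inertia (j : Iirr P) :
  ('chi_j)%R \is a linear_char -> j != 0%R -> 'I_H[('chi_j)%R] = 1.
Proof.
move=> lin_j ntj; rewrite -regHP.
apply: (inertia_lin_cent (n := n) pP cHH nPH coPH) => //.
  exact: (lin_index_inertia pr_p a_gt0 sdG pP p'H cHH degG).
apply: contra ntj => sHI; rewrite -subGcfker -{1}defPH.
exact: inertia_commg_cfker.
Qed.

Let fpfH (x : gT) : x \in H^# -> fpf_on P P^`(1) x.
Proof.
case/setD1P=> ntx Hx; apply: fpf_on_der1 => // [||j lin_j ntj].
- exact: subsetP nPH x Hx.
- by apply: coprime_dvdr coPH; apply: order_dvdG.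
apply: contra ntx => Ix; rewrite -in_set1 -[[set 1]](lin_inertia lin_j ntj).
by rewrite inE Hx.
Qed.

(* Both ['chi_k] and its product with a linear character are fixed by [R], so
   every linear character is constant on the [R]-orbit of [g]. *)
Lemma nonlinear_vanish (k : Iirr P) (g : gT) :
  ('chi_k)%R \isn't a linear_char -> g \notin P^`(1) -> ('chi_k g = 0)%R.
Proof.
move=> nlin_k; have [Pg | nPg] := boolP (g \in P); last by rewrite cfun0.
apply: contraNeq => nz; have [x Rx ntx] := trivgPn _ ntR.
have Hx := subsetP sRH x Rx.
have Hx' : x \in H^# by apply/setD1P.
apply: (fpfH Hx' Pg).
rewrite -cap_cfker_lin_irr; apply/bigcapP=> j lin_j.
have nPx := subsetP nPR x Rx.
have Pgx : g ^ x \in P by rewrite memJ_norm.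
have /irrP[l def_l] : ('chi_j * 'chi_k)%R \in irr P by rewrite mul_lin_irr ?mem_irr.
have nlin_l : ('chi_l)%R \isn't a linear_char.
  by move: nlin_k; rewrite !lin_deg -!(eqr_nat algC) -!degE -def_l cfunE (lin_char1 lin_j) mul1r.
have := inertia_valJ g (subsetP (invR nlin_l) x Rx).
rewrite -def_l !cfunE (inertia_valJ g (subsetP (invR nlin_k) x Rx)) => /(mulIf nz) eq_j.
rewrite commgEl cfkerEirr inE (lin_charM lin_j) ?groupV // eq_j lin_charV // mulVf ?lin_char_neq0 //.
by rewrite (lin_char1 lin_j).
Qed.

Let exists_nonlinear : exists k : Iirr P, ('chi_k)%R \isn't a linear_char.
Proof.
apply/existsP; rewrite -negb_forall; apply: contra ncPP => /forallP linP.
exact/char_abelianP.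
Qed.

Let defZ : 'Z(P) = P^`(1).
Proof.
apply/eqP; rewrite eqEsubset; apply/andP; split; last by rewrite subsetI sP'P centsC.
have [k nlin_k] := exists_nonlinear.
apply/subsetP=> z Zz; apply: contraR (irr_center_neq0 k Zz) => nP'z.
by rewrite nonlinear_vanish.
Qed.

Let deg_square (k : Iirr P) : ('chi_k)%R \isn't a linear_char ->
  ((deg k) ^ 2 = #|P : P^`(1)|)%N.
Proof.
move=> nlin_k; have defZk : 'Z(('chi_k)%R)%CF = P^`(1).
  apply/eqP; rewrite eqEsubset; apply/andP; split; last first.
    by rewrite -defZ -cap_cfcenter_irr bigcap_inf.
  apply/subsetP=> z Zz; have Pz := subsetP (cfcenter_sub _) z Zz.
  apply: contraT => /(nonlinear_vanish nlin_k) z0.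
  by move: Zz; rewrite char_cfcenterE ?irr_char // z0 normr0 eq_sym (negPf (irr1_neq0 k)).
have [_] := irr1_bound k; rewrite defZk.
have -> : ('chi_k)%R \in 'CF(P, P^`(1)).
  by apply/cfun_onP=> g; apply: nonlinear_vanish.
by rewrite degE -natrX eqr_nat => /eqP.
Qed.

Lemma Sylow_index : (p ^ (2 * a))%N = #|P : P^`(1)|.
Proof.
have [k nlin_k] := exists_nonlinear.
by rewrite -(deg_square nlin_k) (proj1 (nonlin_deg nlin_k)) -expnM mulnC.
Qed.

Lemma semiextraspecial_Sylow : semiextraspecial p P.
Proof.
split=> // N maxN; have [sNZ _] := andP (maxgroupp maxN).
have sNP : N \subset P := subset_trans sNZ (center_sub P).
have nsNP : N <| P := sub_center_normal sNZ.
have pQ : p.-group (P / N) := quotient_pgroup N pP.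
have iN : #|'Z(P) / N| = p.
  rewrite card_quotient ?(subset_trans (center_sub P)) ?normal_norm //.
  by apply: p_maximal_index maxN; apply: pgroupS (center_sub P) pP.
have ncQ : ~~ abelian (P / N).
  apply/negP=> cQ; have : P^`(1) \subset N by rewrite der1_min ?normal_norm.
  by rewrite -defZ; apply/negP; case/andP: (maxgroupp maxN).
have defQ' : (P / N)^`(1) = 'Z(P) / N by rewrite defZ -quotient_der ?normal_norm.
(* A nonlinear character of P / N vanishes outside P' / N, but never at a central element. *)
have ZQ : 'Z(P / N) = (P / N)^`(1).
  apply/eqP; rewrite eqEsubset; apply/andP; split; last first.
    rewrite defQ' subsetI quotientS ?center_sub //= quotient_cents // centsC.
    by rewrite centsC subsetIr.
  have [k nlin_k] : exists k : Iirr (P / N), ('chi_k)%R \isn't a linear_char.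
    by apply/existsP; rewrite -negb_forall; apply: contra ncQ => /forallP/char_abelianP.
  apply/subsetP=> y Zz; have /setIP[/morphimP[z nNz Pz def_y] _] := Zz.
  rewrite {y}def_y in Zz *; rewrite defQ'; apply: mem_quotient; rewrite /= defZ.
  have nlin_mod : ('chi_(mod_Iirr k))%R \isn't a linear_char.
    by rewrite lin_deg deg_mod // -lin_deg.
  apply: contraR (irr_center_neq0 k Zz) => /(nonlinear_vanish nlin_mod).
  by rewrite mod_IirrE // cfModE // => ->.
apply: (extraspecial_of_prime_center pr_p pQ) => //.
by rewrite ZQ defQ' iN.
Qed.

Let nP'P : P \subset 'N(P^`(1)). Proof. exact: subset_trans sPG nP'G. Qed.
Let nP'H : H \subset 'N(P^`(1)). Proof. exact: subset_trans sHG nP'G. Qed.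

Let semiregH : semiregular (P / P^`(1)) (H / P^`(1)).
Proof.
move=> y /setD1P[ntx /morphimP[x nx Hx def_y]]; rewrite {y}def_y in ntx *.
have ntx' : x \in H^#.
  by rewrite !inE Hx andbT; apply: contra ntx => /eqP->; rewrite morph1.
apply/trivgP/subsetP=> _ /setIP[/morphimP[z nz Pz ->] /cent1P czx].
apply/set1gP; apply: coset_id; apply: (fpfH ntx' Pz).
apply: coset_idr; first by rewrite groupR.
by rewrite morphR //; apply/eqP/commgP.
Qed.

Let ntW : P / P^`(1) != 1.
Proof.
have ntP : P :!=: 1 by apply: contra ncPP => /eqP->; apply: abelian1.
rewrite -subG1 quotient_sub1 //.
by have /andP[] := sol_der1_proper solP (subxx P) ntP.
Qed.

Let ntH : H :!=: 1.
Proof. by apply: contra ntR => /eqP H1; rewrite -subG1 -H1. Qed.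

Let sdW : (P / P^`(1)) ><| (H / P^`(1)) = G / P^`(1).
Proof.
rewrite sdprodE ?quotient_norms // -?quotientMl ?defG //.
by apply: coprime_TIg; apply: coprime_morph.
Qed.

Let isoH : H \isog H / P^`(1).
Proof.
by apply: quotient_isog => //; apply/trivgP; rewrite -tiPH setSI.
Qed.

Lemma Frobenius_abelianization : [Frobenius G / P^`(1) with kernel P / P^`(1)].
Proof.
apply: (@FrobeniusWker _ _ (H / P^`(1))%G).
apply/(Frobenius_semiregularP sdW) => //.
by rewrite -(isog_eq1 isoH).
Qed.

Lemma cyclic_Sylow_quotient : cyclic (G / P).
Proof.
have isoHP : H \isog G / P.
  rewrite -defG quotientMidl; apply: quotient_isog => //.
rewrite -(isog_cyclic isoHP) (isog_cyclic isoH).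
apply: (abelian_semiregular_cyclic (quotient_pgroup _ pP) ntW) semiregH.
  exact: quotient_norms.
exact: quotient_abelian.
Qed.

Lemma Sylow_eq_der1 : P :=: G^`(1).
Proof.
apply/eqP; rewrite eqEsubset der1_min // andbT -{1}defPH.
by apply: subset_trans (commSg _ sPG) (commgS _ sHG).
Qed.

(** O_p'(G) lies in H and, being normal, commutes with P; so it is contained in C_H(P) = 1, and the
    Fitting subgroup is a p-group. *)
Lemma Sylow_eq_Fitting : P :=: 'F(G).
Proof.
have sylP : p.-Sylow(G) P.
  rewrite /pHall sPG pP /= -divgS // -(sdprod_card sdG) mulKn //.
have p'F1 : 'O_p^'(G) = 1.
  have sOH : 'O_p^'(G) \subset H.
    apply: pcore_sub_Hall; rewrite /pHall sHG p'H pnatNK /= -divgS //.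
    by rewrite -(sdprod_card sdG) mulnK.
  apply/trivgP; rewrite -regHP subsetI sOH.
  have nsOG := pcore_normal p^' G; apply/commG1P/trivgP; rewrite -tiPH subsetI.
  rewrite commg_subr (subset_trans (normal_sub nsOG)) //=.
  by apply: subset_trans sOH; rewrite commg_subl (subset_trans sPG) ?normal_norm.
apply/eqP; rewrite eqEsubset Fitting_max ?(pgroup_nil pP) //=.
rewrite (sub_normal_Hall sylP nsPG (Fitting_sub G)).
rewrite -(nilpotent_pcoreC p (Fitting_nil G)).
have -> : 'O_p^'('F(G)) = 1.
  apply/trivgP; rewrite -p'F1 pcore_max ?pcore_pgroup //.
  exact: gFnormal_trans (Fitting_normal G).
by rewrite dprodg1 pcore_pgroup.
Qed.

Lemma Sylow_proper_cent : P \proper 'C_G(P^`(1)).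
Proof.
rewrite properE subsetI sPG cPP' /=; apply: contra ntR => sCP.
rewrite -subG1 -tiPH subsetI sRH andbT; apply: subset_trans sCP.
by rewrite subsetI sRG.
Qed.

Lemma cent_der1_proper : 'C_G(P^`(1)) \proper G.
Proof.
rewrite properE subsetIl subsetI subxx /=; apply: contra ntP' => cGP'.
by rewrite -subG1 -regZ subsetI (subset_trans sP'P) // centsC.
Qed.

Let sP'Z : P^`(1) \subset 'Z(P). Proof. by rewrite defZ. Qed.
Let coP'H : coprime #|P^`(1)| #|H|. Proof. exact: coprimeSg sP'P coPH. Qed.
Let cP'P' : abelian P^`(1).
Proof. by apply: subset_trans sP'P _; apply: cPP'. Qed.

Let lin_der1 (j : Iirr P^`(1)) : ('chi_j)%R \is a linear_char.
Proof. by move/char_abelianP: cP'P'. Qed.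

Let nonlinear_over (j : Iirr P^`(1)) (k : Iirr P) :
  j != 0%R -> j \in irr_constt ('Res[P^`(1)] 'chi_k)%R -> ('chi_k)%R \isn't a linear_char.
Proof.
move=> ntj jPk; apply: contra ntj => lin_k; rewrite -subGcfker.
apply: subset_trans (cfker_constt (cfRes_char _ (irr_char k)) jPk).
by rewrite cfker_Res ?irr_char // subsetI subxx lin_char_der1.
Qed.

(** A character k of P above j vanishes off P' and is a multiple of j on P', so k and j have the
    same stabiliser in H. *)
Let index_inertia_der1 (j : Iirr P^`(1)) : j != 0%R -> #|H : 'I_H[('chi_j)%R]| = (q ^ b)%N.
Proof.
move=> ntj; have [k] := constt_cfInd_irr j sP'P; rewrite constt_Ind_Res => jPk.
have nlin_k := nonlinear_over ntj jPk; have [_ <-] := nonlin_deg nlin_k.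
rewrite (index_inertia_compl sdG); congr #|_ : _|; apply/setP=> h.
have valk g : g \in P^`(1) -> ('chi_k g = (deg k)%:R * 'chi_j g)%R.
  by move=> P'g; rewrite -(cfResE _ sP'P P'g) (cfRes_central sP'Z jPk) cfunE.
apply/idP/idP=> /setIP[Hh Ih]; rewrite inE Hh.
  apply: mem_inertia_val => [|g Pg]; first exact: subsetP nPH h Hh.
  have nP'h : h \in 'N(P^`(1)) := subsetP nP'H h Hh.
  have [P'g | nP'g] := boolP (g \in P^`(1)).
    by rewrite !valk ?memJ_norm // (inertia_valJ _ Ih).
  by rewrite !nonlinear_vanish ?memJ_norm.
have nP'h : h \in 'N(P^`(1)) := subsetP nP'H h Hh.
apply: mem_inertia_val => // g P'g.
have /mulfI : ((deg k)%:R != 0 :> algC)%R by rewrite -degE irr1_neq0.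
by apply; rewrite -!valk ?memJ_norm // (inertia_valJ _ Ih).
Qed.

(** This is [inertia_lin_cent] for H acting on P', with the orbit length q^b in the role of n. *)
Let inertia_der1 (j : Iirr P^`(1)) : j != 0%R -> 'I_H[('chi_j)%R] = 'C_H(P^`(1)).
Proof.
move=> ntj; apply: (inertia_lin_cent (n := (q ^ b)%N) (pgroupS sP'P pP) cHH nP'H coP'H) => //.
  move=> k _; have [-> | ntk] := eqVneq k 0%R; last by rewrite index_inertia_der1 // !inE eqxx orbT.
  by rewrite irr0 (setIidPl _) ?indexgg ?inE // inertia1.
apply/negP=> sHI; have := index_inertia_der1 ntj.
rewrite (setIidPl sHI) indexgg => /esym/eqP; rewrite -(expn0 q) eqn_exp2l ?prime_gt1 //.
by rewrite eqn0Ngt b_gt0.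
Qed.

Lemma index_cent_der1 : (q ^ b)%N = #|G : 'C_G(P^`(1))|.
Proof.
have [j ntj] : exists j : Iirr P^`(1), j != 0%R.
  apply/existsP; apply: contraR ntP'; rewrite negb_exists => /forallP all0.
  apply/eqP/trivgP; rewrite -(TI_cfker_irr P^`(1)); apply/bigcapsP=> i _.
  by have := all0 i; rewrite negbK => /eqP->; rewrite irr0 cfker_cfun1.
rewrite -(index_inertia_der1 ntj) (inertia_der1 ntj).
have -> : 'C_H(P^`(1)) = H :&: 'C_G(P^`(1)) by rewrite setIA (setIidPl sHG).
rewrite indexgI -indexMg; congr #|_ : _|; apply/eqP.
rewrite eqEsubset mulG_subG subsetIl sHG /= -{1}defG mulSg //.
by rewrite subsetI sPG.
Qed.

Lemma acts_as_Frobenius_der1 (C := 'C_G(P^`(1))%G) :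
  acts_as_Frobenius ('J %% C) (G / C) P^`(1).
Proof.
have sCJ : C \subset 'C(P^`(1) | 'J) by rewrite astabJ subsetIr.
have nCG : G \subset 'N(C) by rewrite normsI ?normG ?norms_cent.
split.
  by rewrite /= astabs_mod // quotientS // astabsJ.
move=> y /setD1P[nty /morphimP[x nCx Gx def_y]]; rewrite {y}def_y in nty *.
have nCx' : x \notin C by apply: contra nty => Cx; apply/eqP/coset_id.
have actE z : z \in P^`(1) -> ('J %% C)%act z (coset C x) = z ^ x.
  move=> P'z; rewrite /= modactE ?in_setT //.
  apply/afixP=> c /setIP[_ /setIP[_ cz]]; apply/conjg_fixP/commgP/esym.
  exact: (centP cz).
apply/eqP; rewrite eqEsubset sub1set; apply/andP; split; last first.
  by apply/setIP; split; [apply: group1 | apply/afix1P; rewrite actE ?conj1g].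
apply/subsetP=> z /setIP[P'z /afix1P]; rewrite actE // => fixz.
(* P centralises P', so x acts on P' as its component h in H. *)
have := Gx; rewrite -defG => /mulsgP[u h Pu Hh def_x].
have ncPh : h \notin 'C(P^`(1)).
  apply: contra nCx' => ch; rewrite inE Gx def_x groupM //.
  exact: subsetP cPP' u Pu.
have zu : z ^ u = z by apply/conjg_fixP/commgP/esym/(centP (subsetP cPP' u Pu)).
(* [fpf_on_der1] is applied to the abelian group P', whose derived subgroup is trivial: there
   fixed-point freeness modulo it is the genuine one. *)
have fpfh : fpf_on P^`(1) P^`(2) h.
  apply: fpf_on_der1 => [||| j _ ntj].
  - exact: abelian_sol.
  - exact: subsetP nP'H h Hh.
  - by apply: coprime_dvdr coP'H; apply: order_dvdG.
  apply: contra ncPh => Ih; have : h \in 'I_H[('chi_j)%R] by rewrite inE Hh.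
  by rewrite inertia_der1 // => /setIP[].
have P''1 : P^`(2) = 1 by apply/derG1P.
suff: z \in P^`(2) by rewrite P''1.
apply: fpfh => //.
by rewrite P''1 inE commgEl -{2}zu -conjgM -def_x fixz mulVg.
Qed.

Lemma q'_Hall_lewis_type1 : exists L : {group gT},
  [/\ q^'.-Hall(G) L, L <| G & lewis_type1 L].
Proof.
have [L defL] : exists L : {group gT}, L = P * R :> {set gT}.
  by exists (P <*> R)%G; apply: norm_joinEr.
have [sPL sRL] : P \subset L /\ R \subset L by rewrite defL mulG_subl mulG_subr.
have sLG : L \subset G by rewrite defL mul_subG.
have tiPR : P :&: R = 1 by apply/trivgP; rewrite -tiPH setIS.
have oL : #|L| = (#|P| * #|R|)%N by rewrite defL TI_cardMg.
have p'R : p^'.-group R := pgroupS sRH p'H.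
have q'P : q^'.-group P.
  by apply: pi_pnat pP _; rewrite !inE neq_pq.
exists L; split.
- rewrite /pHall sLG /=; apply/andP; split.
    rewrite /pgroup oL pnatM; apply/andP; split; [exact: q'P | exact: pcore_pgroup].
  rewrite -divgS // oL -(sdprod_card sdG) divnMl // divgS //.
  by case/and3P: hallR.
- by apply: sub_der1_normal; rewrite // -Sylow_eq_der1.
have [nsPL iPL] : P <| L /\ #|L : P| = #|R|.
  by split; [apply: normalS nsPG | rewrite -divgS // oL mulKn].
exists p, P, R.
(* A single nontrivial element of R already has no fixed points on P / P'. *)
have eqC : 'C_P(R)%G = P^`(1)%G.
  apply/val_inj/eqP; rewrite /= eqEsubset; apply/andP; split; last first.
    by rewrite subsetI sP'P centsC.
  have [x Rx ntx] := trivgPn _ ntR; apply/subsetP=> z /setIP[Pz cRz].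
  have Hx' : x \in H^# by apply/setD1P; split=> //; apply: subsetP sRH x Rx.
  by apply: (fpfH Hx' Pz); have /commgP/eqP-> := centP cRz x Rx; apply: group1.
split=> //.
- by split=> //; rewrite /pHall sPL pP iPL.
- split; last exact: abelianS sRH cHH.
  by rewrite /pHall sRL p'R pnatNK -divgS // oL mulnK.
- by have /= -> := congr1 (@gval gT) eqC.
move=> k nlin_k; rewrite eqC; split; first exact: der_normal.
have [j jPk] := constt_cfRes_irr P^`(1) k.
exists (deg k), j; split; last exact: deg_square.
exact: cfRes_central.
Qed.

End CenterlessStructure.

(** * Factoring out the centre, and the conclusion *)

Lemma abelian_Sylow_complement (gT : finGroupType) (p : nat) (G P : {group gT}) :
    p.-Sylow(G) P -> P <| G -> abelian (G / P) ->
  exists H : {group gT}, [/\ P ><| H = G, p^'.-group H & abelian H].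
Proof.
move=> sylP nsPG cGP; have [sPG pP _] := and3P sylP.
have /splitsP[H] := SchurZassenhaus_split (pHall_Hall sylP) nsPG.
case/complP=> tiPH defG; have sHG : H \subset G by rewrite -defG mulG_subr.
have nPH := subset_trans sHG (normal_norm nsPG).
have sdG : P ><| H = G by rewrite sdprodE.
exists H; split=> //.
  have [_ _ p'GP] := and3P sylP; rewrite /pgroup.
  by rewrite -divgS // -(sdprod_card sdG) mulKn in p'GP.
rewrite (isog_abelian (quotient_isog nPH tiPH)).
by apply: abelianS (quotientS P sHG) cGP.
Qed.

(** The facts on P : H serve twice: in G0 they make G0' and Z(G0) meet trivially, which preserves
    the degrees and leaves the quotient without centre; then they are applied to that quotient. *)
Lemma quotient_structure_of_normal_Sylow (gT : finGroupType) (G0 P0 : {group gT})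
    (p q a b n : nat) :
    prime p -> prime q -> p != q -> (0 < a)%N -> (0 < b)%N ->
    p^'.-nat n -> ~~ q.-nat n -> degrees G0 [:: 1; p ^ a * q ^ b; n]%N ->
    p.-Sylow(G0) P0 -> P0 <| G0 -> abelian (G0 / P0) ->
  quotient_structure G0 p q a b.
Proof.
move=> pr_p pr_q neq_pq a0 b0 p'n q'n degG0 sylP0 nsP0 cGP0.
have [degG0' Gdeg0] := degG0.
have m_in : (p ^ a * q ^ b \in [:: 1; p ^ a * q ^ b; n])%N by rewrite !inE eqxx orbT.
have [H0 [sd0 p'H0 cH0]] := abelian_Sylow_complement sylP0 nsP0 cGP0.
have [sP0G pP0 _] := and3P sylP0.
have tiZ := der1_center_group_trivial pr_p pr_q neq_pq b0 p'n sd0 pP0 p'H0 cH0 degG0'.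
pose A := 'Z(G0)%G; exists A; split=> // G.
have nAG : G0 \subset 'N(A) := normal_norm (center_normal G0).
have degG : degrees G [:: 1; p ^ a * q ^ b; n]%N.
  exact: degrees_central_quotient (subxx _) tiZ degG0.
have regZ : 'Z(G) = 1 := center_quotient_trivial tiZ.
pose P := (P0 / A)%G.
have sylP : p.-Sylow(G) P by apply: quotient_pHall sylP0; apply: subset_trans nAG.
have nsPG : P <| G by apply: quotient_normal.
have cGP : abelian (G / P).
  apply: sub_der1_abelian; rewrite /= -quotient_der // quotientS //.
  by rewrite der1_min // normal_norm.
have [H [sd p'H cH]] := abelian_Sylow_complement sylP nsPG cGP.
have pP : p.-group P by case/and3P: sylP.
have [degG' Gdeg] := degG; have {}Gdeg := Gdeg _ m_in.
exists P; split=> //.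
- split.
    exact: (Sylow_eq_der1 pr_p pr_q neq_pq a0 b0 p'n q'n sd pP p'H cH degG' Gdeg regZ).
  exact: (Sylow_eq_Fitting sd pP p'H cH regZ).
- split.
    exact: (semiextraspecial_Sylow pr_p pr_q neq_pq a0 b0 p'n q'n sd pP p'H cH degG' Gdeg regZ).
  exact: (cyclic_Sylow_quotient pr_p pr_q neq_pq a0 b0 p'n q'n sd pP p'H cH degG' Gdeg regZ).
- exact: (Frobenius_abelianization pr_p pr_q neq_pq a0 b0 p'n q'n sd pP p'H cH degG' Gdeg regZ).
split.
- split.
    exact: (Sylow_proper_cent pr_p pr_q neq_pq a0 b0 p'n q'n sd pP p'H cH degG' Gdeg regZ).
  exact: (cent_der1_proper pr_p a0 sd p'H cH Gdeg regZ).
- exact: (acts_as_Frobenius_der1 pr_p pr_q neq_pq a0 b0 p'n q'n sd pP p'H cH degG' Gdeg regZ).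
- split.
  + by move=> x; rewrite (proj1 (cd_degrees _ _) degG) (proj1 (cd_degrees _ _) degG0).
  + exact: (Sylow_index pr_p pr_q neq_pq a0 b0 p'n q'n sd pP p'H cH degG' Gdeg regZ).
  exact: (index_cent_der1 pr_p pr_q neq_pq a0 b0 p'n q'n sd pP p'H cH degG' Gdeg regZ).
exact: (q'_Hall_lewis_type1 pr_p pr_q neq_pq a0 b0 p'n q'n sd pP p'H cH degG' Gdeg regZ).
Qed.

End Structure.

Theorem theorem2p4 (gT : finGroupType) (G0 : {group gT})
    (p q r alpha beta gamma delta : nat)
    (p_pr : prime p) (q_pr : prime q) (r_pr : prime r)
    (p_neq_q : p != q) (p_neq_r : p != r) (q_neq_r : q != r)
    (alpha_gt0 : 0 < alpha) (beta_gt0 : 0 < beta)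
    (gamma_gt0 : 0 < gamma) (delta_gt0 : 0 < delta)
    (cdG0 : cd G0 =i [:: 1%R; (p ^ alpha * q ^ beta)%:R%R;
                         (r ^ gamma * q ^ delta)%:R%R]) :
  quotient_structure G0 p q alpha beta \/
  quotient_structure G0 r q gamma delta.
Proof.
have r_neq_q : r != q by rewrite eq_sym.
have r_neq_p : r != p by rewrite eq_sym.
have degG : degrees G0 [:: 1; p ^ alpha * q ^ beta; r ^ gamma * q ^ delta].
  exact/cd_degrees.
have degG' : degrees G0 [:: 1; r ^ gamma * q ^ delta; p ^ alpha * q ^ beta].
  case: degG => deg1 deg2; split=> [i | d d_in].
    by have:= deg1 i; rewrite !inE => /or3P[] ->; rewrite ?orbT.
  by apply: deg2; move: d_in; rewrite !inE => /or3P[] ->; rewrite ?orbT.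
have p'rq s t k l : prime s -> prime t -> t != s -> q != s -> s^'.-nat (t ^ k * q ^ l).
  by move=> pr_s pr_t ts qs; rewrite pnatM !pnatX !pnatE // !inE ts qs.
have q'rq t k l : prime t -> t != q -> 0 < k -> ~~ q.-nat (t ^ k * q ^ l).
  move=> pr_t tq k0; rewrite pnatM !pnatX !pnatE // !inE (negPf tq) /=.
  by rewrite gtn_eqF.
have [[P [sylP nsP cP]] | [P [sylP nsP cP]]] :=
  exists_normal_Sylow p_pr q_pr r_pr p_neq_q r_neq_q p_neq_r alpha_gt0 beta_gt0
    gamma_gt0 delta_gt0 degG.
- left; apply: (quotient_structure_of_normal_Sylow (n := r ^ gamma * q ^ delta)
    p_pr q_pr p_neq_q alpha_gt0 beta_gt0 _ _ degG sylP nsP cP).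
    by apply: p'rq; rewrite // eq_sym.
  exact: q'rq.
right; apply: (quotient_structure_of_normal_Sylow (n := p ^ alpha * q ^ beta)
  r_pr q_pr r_neq_q gamma_gt0 delta_gt0 _ _ degG' sylP nsP cP).
  exact: p'rq.
exact: q'rq.
Qed.
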